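(* The operator-valued function $z\mapsto\mathcal Q_z$, when acting on $\mathcal H_1$, can be analytically continued to the entire $z$-plane with a cross cut along the ray $(1,+\infty)$, and for each $z$ in this domain $\mathcal Q_z$ is isomorphic (via the map $\varphi\mapsto\mathcal L[\varphi]$) to the operator $$\mathcal K_z:=z\,(1-M)(1-zM)^{-1}\mathcal K$$ acting on $L_2(m)$. Both $\mathcal Q_z$ and $\mathcal K_z$ are compact operators.
   Context: $m$ is the measure on $\mathbb R^+=(0,\infty)$ given by $dm(t)=\frac{t}{e^t-1}\,dt$. $\mathcal H_1$ is the Hilbert space of all functions of the form $$f(w)=(\mathcal L[\varphi])(w):=\int_0^\infty e^{-tw}\varphi(t)\,dm(t),\qquad\varphi\in L_2(m),$$ with inner product $(\mathcal L[\varphi_1],\mathcal L[\varphi_2])=\int_0^\infty\overline{\varphi_1}\,\varphi_2\,dm$. For $|z|\le1$ the operator $\mathcal Q_z$ is defined by $$\mathcal Q_zf(w)=\sum_{n=1}^\infty z^n\Big(\frac1{w+n}\Big)^2f\Big(\frac1{w+n}\Big).$$ $M:L_2(m)\to L_2(m)$ is $(M\varphi)(t)=e^{-t}\varphi(t)$, and $\mathcal K:L_2(m)\to L_2(m)$ is $(\mathcal K\varphi)(t)=\int_0^\infty\frac{J_1(2\sqrt{st})}{\sqrt{st}}\,\varphi(s)\,dm(s)$ with $J_1$ the Bessel function of the first kind of order $1$. The operator $(1-M)(1-zM)^{-1}$ is multiplication by $\frac{1-e^{-t}}{1-ze^{-t}}$ (the identity when $z=1$). *)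

(* Defs.v *)
(* R[i]^o is R[i] with its topology and its structure of module over itself;
   without ^o, *: on R[i] is scaling by reals. *)
From HB Require Import structures.
From mathcomp Require Import all_boot all_order all_algebra.
From mathcomp Require Import all_classical all_reals all_analysis.
From mathcomp Require Import measurable_realfun complex.
Set Implicit Arguments.
Unset Strict Implicit.
Unset Printing Implicit Defensive.
Import Order.TTheory GRing.Theory Num.Theory numFieldNormedType.Exports.
Local Open Scope classical_set_scope.
Local Open Scope ring_scope.
Local Open Scope complex_scope.

Section operators.
Variable R : realType.
Local Notation C := (R[i]^o).

(* A space of functions with its inner product, conjugate-linear in the first
   argument. Elements at distance 0 are identified, so that L_2(m) can be
   described by functions instead of classes modulo equality a.e. *)
Record hspace (T : Type) := HSpace {
  hcar : set (T -> C) ;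
  hdot : (T -> C) -> (T -> C) -> C }.

Definition hnorm T (H : hspace T) (f : T -> C) : R :=
  Num.sqrt (complex.Re (hdot H f f)).

Definition bounded_operator T (H : hspace T) (A : (T -> C) -> (T -> C)) :=
  [/\ forall f, hcar H f -> hcar H (A f),
      forall (a : C) f g, hcar H f -> hcar H g ->
        hnorm H (A (a *: f + g) - (a *: A f + A g)) = 0 &
      exists c : R, forall f, hcar H f -> hnorm H (A f) <= c * hnorm H f].

Definition compact_operator T (H : hspace T) (A : (T -> C) -> (T -> C)) :=
  bounded_operator H A /\
  forall u : nat -> T -> C,
    (forall n, hcar H (u n)) ->
    (exists c : R, forall n, hnorm H (u n) <= c) ->
    exists (s : nat -> nat) (g : T -> C),
      [/\ {homo s : i j / (i < j)%N}, hcar H g &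
          (fun n => hnorm H (A (u (s n)) - g)) @ \oo --> (0 : R)].

(* complex differentiability at z for the operator norm *)
Definition op_derivable T (H : hspace T) (F : C -> (T -> C) -> (T -> C))
    (z : C) :=
  exists D, bounded_operator H D /\
    forall e : R, 0 < e -> \forall h \near (0 : C)^',
      forall f, hcar H f ->
        hnorm H (h^-1 *: (F (z + h) f - F z f) - D f) <= e * hnorm H f.

Definition op_analytic T (H : hspace T) (U : set C)
    (F : C -> (T -> C) -> (T -> C)) :=
  (forall z, U z -> bounded_operator H (F z)) /\
  (forall z, U z -> op_derivable H F z).

Definition unitary T T' (H : hspace T) (H' : hspace T')
    (U : (T -> C) -> (T' -> C)) :=
  [/\ forall f, hcar H f -> hcar H' (U f),
      forall g, hcar H' g -> exists2 f, hcar H f & U f = g,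
      forall (a : C) f g, hcar H f -> hcar H g ->
        U (a *: f + g) = a *: U f + U g &
      forall f g, hcar H f -> hcar H g -> hdot H' (U f) (U g) = hdot H f g].

End operators.

Definition Rpos (R : realType) : set R := `]0, +oo[.

Definition m_density (R : realType) (t : R) : R := t / (expR t - 1).

Definition m_meas (R : realType) (A : set R) : \bar R :=
  (\int[@lebesgue_measure R]_(t in A `&` @Rpos R) (m_density t)%:E)%E.

Section measure_m.
Variable R : realType.
Local Open Scope ereal_scope.

Lemma m_density_ge0 (t : R) : @Rpos R t -> (0 <= m_density t)%R.
Proof.
rewrite /Rpos/= in_itv/= andbT => t0.
by apply: divr_ge0; rewrite ?subr_ge0 -?expR0 ?ler_expR; exact: ltW.
Qed.

Lemma measurable_m_density : measurable_fun (@Rpos R) (@m_density R).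
Proof.
apply: subspace_continuous_measurable_fun; first exact: measurable_itv.
apply: continuous_in_subspaceT => t; rewrite inE /Rpos/= in_itv/= andbT => t0.
apply: cvgM; first exact: cvg_id.
apply: cvgV; first by rewrite subr_eq0 gt_eqF// expR_gt1.
apply: cvgB; first exact: continuous_expR.
exact: cvg_cst.
Qed.

Let m0 : m_meas (set0 : set R) = 0.
Proof. by rewrite /m_meas set0I integral_set0. Qed.

Let m_ge0 (A : set R) : 0 <= m_meas A.
Proof.
by apply: integral_ge0 => t [_ tp]; rewrite lee_fin m_density_ge0.
Qed.

Let m_sigma : semi_sigma_additive (@m_meas R).
Proof.
move=> F mF tF mUF; rewrite /m_meas setI_bigcupl; apply: cvg_toP.
  apply: ereal_nondecreasing_is_cvgn => m n mn.
  by apply: lee_sum_nneg_natr => // k _ _; exact: m_ge0.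
rewrite ge0_integral_bigcup//=.
- by move=> k; apply: measurableI; [exact: mF|exact: measurable_itv].
- apply/measurable_EFinP; apply: (measurable_funS _ _ measurable_m_density).
    exact: measurable_itv.
  by move=> t [n _ []].
- by move=> t [n _ [_ tp]]; rewrite lee_fin m_density_ge0.
- exact: trivIset_setIr.
Qed.

HB.instance Definition _ :=
  isMeasure.Build _ _ _ (@m_meas R) m0 m_ge0 m_sigma.

End measure_m.

Section transfer.
Variable R : realType.
Local Notation C := (R[i]^o).
Local Notation m := (@m_meas R).

Definition cintegral (f : R -> C) : C :=
  (\int[m]_(t in @Rpos R) complex.Re (f t))%R +i*
  (\int[m]_(t in @Rpos R) complex.Im (f t))%R.

Definition L2m : hspace R R := {|
  hcar := [set phi : R -> C |
    [/\ measurable_fun (@Rpos R) (fun t => complex.Re (phi t)),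
        measurable_fun (@Rpos R) (fun t => complex.Im (phi t)) &
        (\int[m]_(t in @Rpos R)
           ((complex.Re (phi t)) ^+ 2 + (complex.Im (phi t)) ^+ 2)%:E
         < +oo)%E]] ;
  hdot := fun phi psi => cintegral (fun t => (phi t)^* * psi t) |}.

Definition cexp (w : C) : C :=
  (expR (complex.Re w))%:C * (cos (complex.Im w) +i* sin (complex.Im w)).

(* The functions of w live on Re w > -1/2, the largest open half-plane on which
   the integral defining the transform converges absolutely for all phi in
   L_2(m). They are represented by functions on C that are 0 outside of it. *)
Definition half_plane : set C := [set w | - 2^-1 < complex.Re w].

Definition laplace (phi : R -> C) : C -> C :=
  (fun w => cintegral (fun t => cexp (- (t%:C * w)) * phi t)) \_ half_plane.

Definition laplace_inv (f : C -> C) : R -> C :=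
  xget 0 [set phi | hcar L2m phi /\ laplace phi = f].

(* The inner product is transported from L_2(m); the choice in laplace_inv
   does not matter, since laplace is injective modulo equality a.e. *)
Definition H1 : hspace R C := {|
  hcar := laplace @` hcar L2m ;
  hdot := fun f g => hdot L2m (laplace_inv f) (laplace_inv g) |}.

(* k-th term, k = 0, 1, ..., for n = k + 1 *)
Definition Q_term (z : C) (f : C -> C) (w : C) : nat -> C :=
  fun k => z ^+ k.+1 * ((w + k.+1%:R)^-1) ^+ 2 * f ((w + k.+1%:R)^-1).

Definition Q_op (z : C) (f : C -> C) : C -> C :=
  (fun w => limn (series (Q_term z f w))) \_ half_plane.

Definition bessel_J1 (x : R) : R :=
  limn (series (fun k => (-1) ^+ k / (k`! * k.+1`!)%:R * (x / 2) ^+ k.*2.+1)).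

Definition K_op (phi : R -> C) : R -> C := fun t =>
  cintegral (fun s =>
    (bessel_J1 (2 * Num.sqrt (s * t)) / Num.sqrt (s * t))%:C * phi s).

Definition M_op (phi : R -> C) : R -> C := fun t => (expR (- t))%:C * phi t.

(* (1 - M) (1 - z M)^-1, see M_fracE *)
Definition M_frac (z : C) (phi : R -> C) : R -> C := fun t =>
  (1 - (expR (- t))%:C) / (1 - z * (expR (- t))%:C) * phi t.

Definition Kz_op (z : C) (phi : R -> C) : R -> C := z *: M_frac z (K_op phi).

(* In the order of R[i], 1 < z means that z is real and greater than 1. *)
Definition cut_plane : set C := [set z | ~~ ((1 : R[i]) < z)].

Lemma M_fracE (z : C) phi t : cut_plane z -> @Rpos R t ->
  (M_frac z phi - z *: M_op (M_frac z phi)) t = (phi - M_op phi) t.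
Proof.
rewrite /cut_plane /Rpos/= in_itv/= andbT => cz t0.
have nz : 1 - z * (expR (- t))%:C != 0 :> R[i].
  apply: contra cz; rewrite subr_eq0 => /eqP e.
  have ee : (expR (- t))%:C * (expR t)%:C = 1 :> R[i].
    by rewrite -rmorphM -expRD addNr expR0.
  have -> : z = (expR t)%:C by rewrite -[RHS]mul1r [in RHS]e -mulrA ee mulr1.
  by rewrite -[1]/(1%:C) ltcR expR_gt1.
set x := (expR (- t))%:C in nz *.
change ((1 - x) / (1 - z * x) * phi t
  - z * (x * ((1 - x) / (1 - z * x) * phi t)) = phi t - x * phi t :> R[i]).
rewrite mulrA -[X in X - _]mul1r -mulrBl mulrA.
by rewrite mulrCA divff// mulr1 mulrBl mul1r.
Qed.

End transfer.

(* Main.v *)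
(* Put [y x = J_1 (2 sqrt x) / sqrt x]. For [Re a > 0], the identity
     [int_0^oo t e^(- t a) y (s t) dt = a^-2 e^(- s / a)]
   holds because the left side, as a function of [s], solves [G' = - G / a]
   (differentiate under the integral sign, then integrate by parts using
   [x y'' + 2 y' + y = 0]). With [(e^t - 1) dm (t) = t dt] and Fubini it turns
   each term of the series of [Q_z (L phi)] into the transform of
   [z^n e^(- n t) (e^t - 1) K phi]; the geometric series in [z e^(- t)] and
   dominated convergence then give [Q_z (L phi) = L (K_z phi)] for [|z| <= 1].
   For every [z] in the cut plane, [K_z] is [K] followed by multiplication by the
   bounded function [z (1 - e^-t) / (1 - z e^-t)], which gives the analytic
   continuation. [K] is compact: [|y| <= 1] on [x >= 0] and [y] is Lipschitz, so
   along a bounded sequence of [L_2 (m)] a diagonal subsequence of [K phi_n]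
   converges pointwise and boundedly, hence in norm. [L] is injective modulo
   equality a.e. because vanishing of [L phi] makes [phi] orthogonal to all
   combinations of the functions [e^(- s t)]. *)
Require Import Defs.
From HB Require Import structures.
From mathcomp Require Import all_boot all_order all_algebra.
From mathcomp Require Import all_classical all_reals all_analysis.
From mathcomp Require Import complex.
From mathcomp Require Import measurable_realfun ring lra.
Set Implicit Arguments.
Unset Strict Implicit.
Unset Printing Implicit Defensive.
Import Order.TTheory GRing.Theory Num.Theory numFieldNormedType.Exports.
Local Open Scope classical_set_scope.
Local Open Scope ring_scope.

(** The continuation is not obtained by extending the power series: for every z the operator is
    defined at once as [K_op] followed by multiplication by the explicit function [kz z], moved to
    [H1] by [laplace]; only for |z| <= 1 is it compared with the series. The point z = 1 needs
    separate care: it lies in [cut_plane] but not in its interior, and there 1 - z e^-t has no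
    positive lower bound; the factor 1 - e^-t cancels it, so the operator is still bounded and
    compact. Elements of L_2(m) are functions, not classes, so [laplace_inv] may return any
    representative. This does no harm: [K_op] is an integral and takes exactly equal values on a.e.
    equal arguments, so the identities in [H1] hold as equalities of functions. The density of m
    decays almost like e^-t; hence m is finite, bounded functions are square integrable, and e^(- t
    w) is in L_2(m) for Re w > -1/2. Integrals are computed on real and imaginary parts, so complex
    identities appear below as pairs of real ones. *)

Section bessel.
Variable R : realType.
Implicit Types (nu k : nat) (x : R).

Definition bcoef nu k : R := (-1) ^+ k / (k`! * (k + nu)`!)%:R.
(** This is x^(- nu / 2) J_nu (2 sqrt x): an entire function, free of square roots, whose order
    rises by one under differentiation. The kernel of [K_op] is the case nu = 1. *)
Definition bfun nu x : R := limn (pseries (bcoef nu) x).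

Lemma bcoef_diffs nu : pseries_diffs (bcoef nu) = - bcoef nu.+1.
Proof.
apply/funext => k; rewrite /pseries_diffs /bcoef !fctE exprS mulN1r mulNr mulrN.
congr (- _); rewrite mulrCA; congr (_ * _).
rewrite factS addSnnS -mulnA natrM invfM mulrA divff ?mul1r//.
Qed.

Lemma pseriesN (f : nat -> R) x : pseries (- f) x = - pseries f x.
Proof.
by apply/funext => n; rewrite !fctE /pseries /series/= -sumrN;
  apply: eq_bigr => i _; rewrite mulNr.
Qed.

Lemma bcoef_le_exp_coeff nu x k : `|bcoef nu k * x ^+ k| <= exp_coeff `|x| k.
Proof.
rewrite /exp_coeff/= /bcoef !normrM normrX normrN normr1 expr1n mul1r.
rewrite mulrC normrX ler_wpM2l ?exprn_ge0//.
rewrite normfV ger0_norm// lef_pV2 ?posrE ?ltr0n ?muln_gt0 ?fact_gt0//.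
by rewrite ler_nat leq_pmulr// fact_gt0.
Qed.

Lemma is_cvg_bfun nu x : cvgn (pseries (bcoef nu) x).
Proof.
apply: normed_cvg; apply: (series_le_cvg _ _ _ (is_cvg_series_exp_coeff `|x|)).
- by move=> n /=.
- by move=> n; rewrite exp_coeff_ge0.
- by move=> n; exact: bcoef_le_exp_coeff.
Qed.

Global Instance is_derive_bfun nu x : is_derive x 1 (bfun nu) (- bfun nu.+1 x).
Proof.
have -> : - bfun nu.+1 x = limn (pseries (pseries_diffs (bcoef nu)) x).
  by rewrite bcoef_diffs pseriesN limN//; exact: is_cvg_bfun.
(* Any point beyond [|x|] serves, since the series and its two formal derivatives converge
   everywhere. *)
apply: (@pseries_snd_diffs _ _ (`|x| + 1)).
- exact: is_cvg_bfun.
- by rewrite bcoef_diffs pseriesN; apply: is_cvgN; exact: is_cvg_bfun.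
- rewrite bcoef_diffs pseries_diffsN pseriesN bcoef_diffs pseriesN opprK.
  exact: is_cvg_bfun.
- by rewrite [ltRHS]ger0_norm ?addr_ge0// ltrDl.
Qed.

Lemma continuous_bfun nu : continuous (bfun nu).
Proof.
by move=> x; apply: differentiable_continuous; apply/derivable1_diffP.
Qed.

Lemma bfun0 nu : bfun nu 0 = nu`!%:R^-1.
Proof.
apply/cvg_lim => //; rewrite -cvg_shiftS/=.
apply: cvg_near_cst; near=> n.
rewrite /pseries /series/= big_nat_recl//= big1.
  by rewrite addr0 /bcoef expr0 mulr1 mul1r fact0 mul1n add0n.
by move=> i _; rewrite expr0n mulr0.
Unshelve. all: end_near. Qed.

(** The three-term recurrence of Bessel functions, that is, x y'' + (nu + 1) y' + y = 0 for y =
    [bfun nu]. It already holds for partial sums, power by power, once the truncations are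
    aligned. *)
Lemma bfun_ode nu x : x * bfun nu.+2 x - nu.+1%:R * bfun nu.+1 x + bfun nu x = 0.
Proof.
have cS j : (fun n => pseries (bcoef j) x n.+1) @ \oo --> bfun j x.
  by rewrite (cvg_shiftS (pseries (bcoef j) x)); exact: is_cvg_bfun.
(* The first series is cut one term earlier: its factor x raises every power by one, and then all
   powers cancel exactly. *)
have : (fun n => x * pseries (bcoef nu.+2) x n
    - nu.+1%:R * pseries (bcoef nu.+1) x n.+1 + pseries (bcoef nu) x n.+1) @ \oo -->
    x * bfun nu.+2 x - nu.+1%:R * bfun nu.+1 x + bfun nu x.
  apply: cvgD; last exact: cS.
  by apply: cvgB; apply: cvgM; [exact: cvg_cst|exact: is_cvg_bfun|exact: cvg_cst|exact: cS].
rewrite (_ : (fun n => _) = cst 0); first by move/(cvg_lim (@Rhausdorff R)) <-; rewrite lim_cst.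
apply/funext => n /=; rewrite /pseries /series/= !big_nat_recl//= mulrDr.
rewrite /bcoef !expr0 !mulr1 !fact0 !mul1n !add0n !mul1r.
have -> : nu.+1%:R * (nu.+1)`!%:R^-1 = nu`!%:R^-1 :> R.
  by rewrite factS natrM invfM mulrA divff ?mul1r// pnatr_eq0.
set A := nu`!%:R^-1; set S1 := \sum_(_ <= _ < _) _.
set S2 := \sum_(_ <= _ < _) _; set S3 := \sum_(_ <= _ < _) _.
have -> : x * S1 - (A + nu.+1%:R * S2) + (A + S3) = x * S1 - nu.+1%:R * S2 + S3.
  by ring.
rewrite /S1 /S2 /S3 !mulr_sumr -sumrB -big_split/= big1// => k _.
have f0 (j : nat) : (j`!%:R : R) != 0 by rewrite pnatr_eq0 -lt0n fact_gt0.
have -> : (k + nu.+2)`! = ((k + nu).+2 * (k + nu).+1`!)%N by rewrite !addnS factS.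
have -> : (k.+1 + nu.+1)`! = ((k + nu).+2 * (k + nu).+1`!)%N by rewrite !addSn !addnS factS.
rewrite addSn (factS k) (factS (k + nu)) !natrM !exprS.
rewrite -[(k + nu).+2%:R]natr1 -[(k + nu).+1%:R]natr1 -[k.+1%:R]natr1 -[nu.+1%:R]natr1 natrD.
have := f0 k; have := f0 (k + nu)%N.
move: (k`!%:R : R) ((k + nu)`!%:R : R) => a b b0 a0.
field.
by rewrite a0 b0 -!natrD !natr1 !pnatr_eq0.
Qed.

(* The energy [x y'^2 + y^2] of a solution of [x y'' + (nu + 1) y' + y = 0] has
   derivative [- (2 nu + 1) y'^2]. *)
Lemma bfun_energy nu x : 0 <= x ->
  x * bfun nu.+1 x ^+ 2 + bfun nu x ^+ 2 <= (nu`!%:R^-1) ^+ 2.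
Proof.
move=> x0; pose E (t : R) : R := t * bfun nu.+1 t ^+ 2 + bfun nu t ^+ 2.
have dE (t : R) : is_derive t 1 E (- (2 * nu.+1%:R - 1) * bfun nu.+1 t ^+ 2).
  rewrite /E; apply: is_derive_eq.
  rewrite /GRing.scale/= -[nu.+1%:R]natr1.
  have := bfun_ode nu t; rewrite -[nu.+1%:R]natr1.
  set u := bfun nu t; set v := bfun nu.+1 t; set w := bfun nu.+2 t => e.
  have -> : u = (nu%:R + 1) * v - t * w by apply/eqP; rewrite -subr_eq0 -e; apply/eqP; ring.
  ring.
suff : E x <= E 0 by rewrite /E mul0r add0r bfun0.
apply: (@ler0_derive1_le_cc _ E 0 x) => //.
- by move=> t _; rewrite derive1E derive_val mulNr oppr_le0 mulr_ge0 ?sqr_ge0// subr_ge0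
       -natrM ler1n.
- by apply: derivable_within_continuous => t _.
- by rewrite in_itv/= lexx x0.
- by rewrite in_itv/= lexx x0.
Qed.

Lemma bfun_le nu x : 0 <= x -> `|bfun nu x| <= nu`!%:R^-1.
Proof.
move=> x0; rewrite -ler_sqr ?nnegrE ?invr_ge0// real_normK ?num_real//.
apply: (le_trans _ (bfun_energy nu x0)).
by rewrite lerDr mulr_ge0// sqr_ge0.
Qed.

(** Mean value theorem: the derivative is [- bfun nu.+1], of size at most 1 / (nu + 1)! <= 1 on the
    half-line. *)
Lemma bfun_lipschitz nu (x y : R) : 0 <= x -> 0 <= y ->
  `|bfun nu x - bfun nu y| <= `|x - y|.
Proof.
wlog xy : x y / x <= y => [H x0 y0|x0 _].
  have [/H|/ltW/H] := leP x y; first exact.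
  by rewrite distrC (distrC y); exact.
have [->|xney] := eqVneq x y; first by rewrite !subrr.
have {}xy : x < y by rewrite lt_neqAle xney.
have dy (t : R) : t \in `]x, y[ -> is_derive t 1 (bfun nu) (- bfun nu.+1 t).
  by move=> _; exact: is_derive_bfun.
have cy : {within `[x, y], continuous (bfun nu)}.
  by apply: derivable_within_continuous => t _.
have [c] := MVT xy dy cy.
rewrite in_itv/= => /andP[/ltW xc _] e.
rewrite distrC e normrM normrN [`|y - x|]distrC ler_piMl//.
apply: (le_trans (bfun_le _ (le_trans x0 xc))).
by rewrite invf_le1 ?ler1n ?ltr0n fact_gt0.
Qed.

Lemma bessel_J1E x : 0 < x ->
  bessel_J1 (2 * Num.sqrt x) / Num.sqrt x = bfun 1 x.
Proof.
move=> x0; have s0 : Num.sqrt x != 0 by rewrite sqrtr_eq0 -ltNge.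
rewrite -[RHS](mulfK s0); congr (_ / _).
rewrite [RHS]mulrC; apply/cvg_lim => //.
rewrite [X in X @ _ --> _](_ : _ = (fun n => Num.sqrt x * pseries (bcoef 1) x n)).
  by apply: cvgM; [exact: cvg_cst|exact: is_cvg_bfun].
apply/funext => n; rewrite /pseries /series/= mulr_sumr; apply: eq_bigr => k _.
rewrite [2 * _]mulrC mulfK ?pnatr_eq0// exprS -mul2n exprM sqr_sqrtr ?ltW//.
by rewrite [RHS]mulrCA /bcoef addn1.
Qed.
End bessel.

(** * Integrals against a measure given by a density *)

Section density.
Local Open Scope ereal_scope.
Context d (T : measurableType d) (R : realType).
Variables (mu nu : {measure set T -> \bar R}) (D : set T) (mD : measurable D).
Variable w : T -> R.
Hypotheses (w0 : forall x, D x -> (0 <= w x)%R) (mw : measurable_fun D w).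
Hypothesis nuE : forall A, measurable A -> nu A = \int[mu]_(x in A `&` D) (w x)%:E.

Import HBNNSimple.

Let integral_density_nnsfun (h : {nnsfun T >-> R}) :
  \int[nu]_(x in D) (h x)%:E = \int[mu]_(x in D) ((h x)%:E * (w x)%:E).
Proof.
have mEw : measurable_fun D (EFin \o w) by exact/measurable_EFinP.
under [LHS]eq_integral do rewrite fimfunE -fsumEFin//.
rewrite [LHS]ge0_integral_fsum//; last 2 first.
  - by move=> r; exact/measurable_EFinP/measurableT_comp.
  - by move=> n x _; rewrite EFinM nnfun_muleindic_ge0.
under [RHS]eq_integral.
  move=> x xD; rewrite fimfunE -fsumEFin// ge0_mule_fsuml; last first.
    by move=> r; rewrite EFinM nnfun_muleindic_ge0.
  over.
rewrite [RHS]ge0_integral_fsum//; last 2 first.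
  - move=> r; apply: emeasurable_funM => //.
    by apply/measurable_EFinP; do 2 apply/measurableT_comp => //.
  - move=> n x Dx; rewrite mule_ge0// ?lee_fin ?w0//.
    by rewrite -lee_fin EFinM nnfun_muleindic_ge0.
apply: eq_fsbigr => r; rewrite inE => -[t _ rE].
have r0 : (0 <= r)%R by rewrite -rE.
under eq_integral do rewrite EFinM.
rewrite integralZl_indic_nnsfun//= integral_indic//.
under [RHS]eq_integral do rewrite EFinM -muleA.
rewrite ge0_integralZl//.
- rewrite [in LHS]nuE; last exact: measurableI.
  congr (_ * _); rewrite -setIA setIid integral_mkcondl.
  by apply: eq_integral => x xD; rewrite epatch_indic muleC.
- by apply: emeasurable_funM => //; exact/measurable_EFinP.
- by move=> x Dx; rewrite mule_ge0// lee_fin w0.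
Qed.

(** Known for simple functions; both sides pass to increasing limits because w is nonnegative. *)
Lemma ge0_integral_density (f : T -> \bar R) : measurable_fun D f ->
  (forall x, D x -> 0 <= f x) ->
  \int[nu]_(x in D) f x = \int[mu]_(x in D) (f x * (w x)%:E).
Proof.
move=> mf f0; pose f_ := nnsfun_approx mD mf.
have mEw : measurable_fun D (EFin \o w) by exact/measurable_EFinP.
transitivity (limn (fun n => \int[nu]_(x in D) (f_ n x)%:E)).
  rewrite -monotone_convergence//=.
  - apply: eq_integral => x /[!inE] xD; apply/esym/cvg_lim => //=.
    exact: cvg_nnsfun_approx.
  - by move=> n; apply: measurableT_comp => //; exact: measurable_funTS.
  - by move=> n x _; rewrite lee_fin.
  - by move=> x _ a b ab; rewrite lee_fin//; exact/lefP/nd_nnsfun_approx.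
under eq_fun do rewrite integral_density_nnsfun.
rewrite -monotone_convergence//=.
- apply: eq_integral => x /[!inE] xD; apply/cvg_lim => //=.
  by apply: cvgeZr => //; exact: cvg_nnsfun_approx.
- move=> n; apply: emeasurable_funM => //.
  by apply: measurableT_comp => //; exact: measurable_funTS.
- by move=> n x Dx; rewrite mule_ge0// lee_fin// w0.
- move=> x Dx a b ab; rewrite lee_wpmul2r ?lee_fin ?w0//.
  exact/lefP/nd_nnsfun_approx.
Qed.

Lemma integrable_density (f : T -> R) : measurable_fun D f ->
  nu.-integrable D (EFin \o f) <->
  mu.-integrable D (EFin \o (fun x => f x * w x)%R).
Proof.
move=> mf; have mEf : measurable_fun D (EFin \o f) by exact/measurable_EFinP.
have e : \int[nu]_(x in D) `|(f x)%:E| = \int[mu]_(x in D) `|(f x * w x)%:E|.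
  rewrite ge0_integral_density//; last exact: measurableT_comp.
  by apply: eq_integral => x /[!inE] Dx; rewrite EFinM abseM [X in _ = _ * X]gee0_abs// lee_fin w0.
split=> /integrableP[m1 i1]; apply/integrableP; split => //=; rewrite -?e// ?e//.
by apply/measurable_EFinP; exact: measurable_funM.
Qed.

(** Multiplication by the nonnegative w commutes with taking positive and negative parts. *)
Lemma Rintegral_density (f : T -> R) :
  nu.-integrable D (EFin \o f) ->
  (\int[nu]_(x in D) f x = \int[mu]_(x in D) (f x * w x))%R.
Proof.
move=> fi.
have mf : measurable_fun D f by case/integrableP : fi => /measurable_EFinP.
have mEf : measurable_fun D (EFin \o f) by exact/measurable_EFinP.
rewrite /Rintegral; congr fine.
rewrite integralE [RHS]integralE !ge0_integral_density//.
- congr (_ - _); apply: eq_integral => x /[!inE] Dx.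
    by rewrite !funeposE EFinM muleC [in RHS]muleC maxe_pMr ?lee_fin ?w0// mule0.
  by rewrite !funenegE EFinM muleC [in RHS]muleC -muleN maxe_pMr ?lee_fin ?w0// mule0.
- exact: measurable_funeneg.
- exact: measurable_funepos.
Qed.

End density.

(** * The measure m: decay of its density, integrability criteria, finiteness *)

Section m_measure.
Variable R : realType.
Local Notation m := (@m_meas R).
Local Notation leb := (@lebesgue_measure R).
Implicit Types (f g : R -> R) (t c : R).

Lemma RposE t : @Rpos R t <-> 0 < t.
Proof. by rewrite /Rpos/= in_itv/= andbT. Qed.

Lemma measurable_Rpos : measurable (@Rpos R).
Proof. exact: measurable_itv. Qed.

Lemma measurable_RposL : @measurable _ (measurableTypeR R) (@Rpos R).
Proof. exact: measurable_itv. Qed.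

(** Keeps a single term of the exponential series of d t. *)
Lemma expr_le_expR k t (d : R) : 0 <= t -> 0 < d ->
  t ^+ k <= k`!%:R / d ^+ k * expR (d * t).
Proof.
move=> t0 d0; have dt0 : 0 <= d * t by rewrite mulr_ge0// ltW.
have : (d * t) ^+ k <= k`!%:R * expR (d * t).
  case: k => [|k]; first by rewrite expr0 fact0 mul1r -expR0 ler_expR.
  rewrite -ler_pdivrMl ?ltr0n ?fact_gt0// mulrC.
  by apply: (le_trans _ (expR_ge1Dxn k dt0)); rewrite lerDr.
by rewrite exprMn mulrAC ler_pdivlMr ?exprn_gt0// mulrC.
Qed.

(** Half of the decay rate pays for the power of t. *)
Lemma expr_expR_le k t (b : R) : 0 <= t -> 0 < b ->
  t ^+ k * expR (- b * t) <= k`!%:R / (b / 2) ^+ k * expR (- (b / 2) * t).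
Proof.
move=> t0 b0; have b20 : 0 < b / 2 by rewrite divr_gt0.
have -> : - b * t = - (b / 2 * t) + - (b / 2) * t by field.
rewrite expRD mulrA ler_wpM2r ?expR_ge0// expRN ler_pdivrMr ?expR_gt0//.
exact: expr_le_expR.
Qed.

Lemma is_derive_compMl f c t (df : R) :
  is_derive (c * t) 1 f df -> is_derive t 1 (fun t => f (c * t)) (c * df).
Proof.
move=> fdf; have gdg : is_derive t 1 (fun t : R => c * t) c.
  have := is_deriveZ c (is_derive_id t 1).
  by rewrite /GRing.scale/= mulr1.
by rewrite mulrC; exact: (@is_derive1_comp _ f (fun t => c * t)).
Qed.

Global Instance is_derive_expRMl c t :
  is_derive t 1 (fun t => expR (c * t)) (c * expR (c * t)) | 0.
Proof. exact: (is_derive_compMl (is_derive_expR (c * t))). Qed.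

Lemma continuous_expRM c : continuous (fun t : R => expR (c * t)).
Proof.
move=> t; apply: continuous_comp; last exact: continuous_expR.
by apply: cvgM; [exact: cvg_cst|exact: cvg_id].
Qed.

Lemma cvg_expRM_pinfty (a : R) : 0 < a -> expR (- a * t) @[t --> +oo] --> 0.
Proof.
move=> a0; rewrite (_ : (fun t => _) = (fun z => expR (- z)) \o (fun z => a * z)).
  apply: (@cvg_comp _ _ _ _ _ _ (pinfty_nbhs R)); last exact: cvgr_expR.
  exact: gt0_cvgMry.
by apply/funext => t/=; rewrite mulNr.
Qed.

Lemma lebesgue_integrable_expR (a : R) : 0 < a ->
  leb.-integrable (@Rpos R) (EFin \o (fun t => expR (- a * t))).
Proof.
move=> a0; apply/integrableP; split.
  apply/measurable_EFinP; apply: measurable_funTS.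
  by apply: continuous_measurable_fun; exact: continuous_expRM.
under eq_integral => t _ do rewrite /= ger0_norm ?expR_ge0//.
rewrite integral_itv_obnd_cbnd; last first.
  apply/measurable_EFinP; apply: measurable_funTS.
  by apply: continuous_measurable_fun; exact: continuous_expRM.
have dE t : is_derive t 1 (fun t => - a^-1 * expR (- a * t)) (expR (- a * t)).
  apply: is_derive_eq; rewrite /GRing.scale/=; field; exact: lt0r_neq0.
rewrite (@ge0_continuous_FTC2y _ _ (fun t => - a^-1 * expR (- a * t)) _ 0)//.
- by rewrite -EFinB ltry.
- by apply: continuous_subspaceT; exact: continuous_expRM.
- rewrite -[X in _ --> X](mulr0 (- a^-1)); apply: cvgM; first exact: cvg_cst.
  exact: cvg_expRM_pinfty.
- apply: cvg_at_right_filter; apply: cvgM; first exact: cvg_cst.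
  exact: continuous_expRM.
- by move=> t _; rewrite derive1E derive_val.
Qed.

Lemma lebesgue_integrable_dominated f (C a : R) k :
  0 < a -> measurable_fun (@Rpos R) f ->
  (forall t, 0 < t -> `|f t| <= C * t ^+ k * expR (- a * t)) ->
  leb.-integrable (@Rpos R) (EFin \o f).
Proof.
move=> a0 mf fC; have a20 : 0 < a / 2 by rewrite divr_gt0.
have ig := integrableZl measurable_RposL (`|C| * (k`!%:R / (a / 2) ^+ k))
  (lebesgue_integrable_expR a20).
apply: (le_integrable measurable_RposL _ _ ig).
  exact/measurable_EFinP.
move=> t /RposE t0; rewrite -EFinM !abse_EFin lee_fin.
rewrite (le_trans (fC _ t0))// ler_normr; apply/orP; left.
rewrite -!mulrA; apply: (@le_trans _ _ (`|C| * (t ^+ k * expR (- a * t)))).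
  by rewrite ler_wpM2r ?ler_norm// mulr_ge0 ?expR_ge0// exprn_ge0// ltW.
rewrite ler_wpM2l//.
by rewrite [leRHS]mulrA; exact: (expr_expR_le k (ltW t0) a0).
Qed.

(** The density behaves like t e^-t at infinity, and the factor t is traded for e^(d t) / d. The two
    ingredients are t <= (1 + t) (1 - e^-t) and, for d <= 1, d (1 + t) <= e^(d t). *)
Lemma m_density_le t (d : R) : 0 < t -> 0 < d <= 1 ->
  m_density t <= d^-1 * expR (- (1 - d) * t).
Proof.
move=> t0 /andP[d0 d1]; have e1 : 0 < expR t - 1 by rewrite subr_gt0 expR_gt1.
rewrite /m_density ler_pdivrMr//.
have dt : d * t + d <= expR (d * t).
  by apply: le_trans (expR_ge1Dx _); rewrite addrC lerD2r.
have et : t <= (1 + t) * (1 - expR (- t)).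
  suff : (1 + t) * expR (- t) <= 1 by lra.
  by rewrite expRN ler_pdivrMr ?expR_gt0// mul1r expR_ge1Dx.
have -> : d^-1 * expR (- (1 - d) * t) * (expR t - 1) =
    d^-1 * (expR (d * t) * (1 - expR (- t))).
  have -> : - (1 - d) * t = d * t - t by ring.
  rewrite -mulrA; congr (_ * _); rewrite expRD -mulrA; congr (_ * _).
  by rewrite mulrBr -expRD addNr expR0 mulr1.
rewrite -ler_pdivrMl ?invr_gt0// invrK; apply: (@le_trans _ _ (d * ((1 + t) * (1 - expR (- t))))).
  by rewrite ler_pM2l.
rewrite mulrA ler_wpM2r//; last by rewrite mulrDr mulr1 addrC.
by rewrite subr_ge0 -expR0 ler_expR oppr_le0 ltW.
Qed.

Let idR : measurableTypeR R -> R := idfun.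

Let midR : measurable_fun setT idR.
Proof. exact: measurable_id. Qed.

(* [lebesgue_measure] and [m_meas] live on two copies of [R] as a measurable
   type, with different displays. *)
Let leb' : {measure set R -> \bar R} :=
  measure_function_pushforward__canonical__measure_function_Measure leb midR.

Let ge0_integral_leb' (D : set R) (f : R -> \bar R) : measurable D -> measurable_fun D f ->
  (forall x, D x -> 0 <= f x)%E ->
  (\int[leb']_(x in D) f x = \int[leb]_(x in D) f x)%E.
Proof.
move=> mD mf f0; apply: (@ge0_integral_pushforward _ _ _ _ _ idR midR leb D f) => //.
by move=> x /set_mem; exact: f0.
Qed.

Let integrable_leb' (D : set R) (f : R -> R) : measurable D -> measurable_fun D f ->
  leb'.-integrable D (EFin \o f) <-> leb.-integrable D (EFin \o f).
Proof.
move=> mD mf.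
have mEf : measurable_fun D (EFin \o f) by exact/measurable_EFinP.
have mEf' : measurable_fun (D : set (measurableTypeR R)) (EFin \o f) by [].
have e : (\int[leb']_(x in D) `|(f x)%:E| = \int[leb]_(x in D) `|(f x)%:E|)%E.
  by rewrite ge0_integral_leb'//; exact: measurableT_comp.
by split=> /integrableP[_ i]; apply/integrableP; split => //=; rewrite ?e// -e.
Qed.

Let m_measE (A : set R) : measurable A ->
  m A = (\int[leb']_(x in A `&` @Rpos R) (m_density x)%:E)%E.
Proof.
move=> mA; rewrite ge0_integral_leb'//.
- by apply: measurableI => //; exact: measurable_Rpos.
- apply/measurable_EFinP; apply: (measurable_funS _ _ (@measurable_m_density R)).
    exact: measurable_Rpos.
  exact: subIsetr.
- by move=> t [_ t0]; rewrite lee_fin m_density_ge0.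
Qed.

Lemma m_integrableE f : measurable_fun (@Rpos R) f ->
  m.-integrable (@Rpos R) (EFin \o f) <->
  leb.-integrable (@Rpos R) (EFin \o (fun t => f t * m_density t)).
Proof.
move=> mf; have mr := measurable_Rpos; have md := @measurable_m_density R.
have m0 := @m_density_ge0 R.
rewrite -integrable_leb'//; first exact: integrable_density.
exact: measurable_funM.
Qed.

Lemma m_RintegralE f : m.-integrable (@Rpos R) (EFin \o f) ->
  \int[m]_(t in @Rpos R) f t = \int[leb]_(t in @Rpos R) (f t * m_density t).
Proof.
move=> fi; have mr := measurable_Rpos; have md := @measurable_m_density R.
have m0 := @m_density_ge0 R.
have mf : measurable_fun (@Rpos R) f by case/integrableP : fi => /measurable_EFinP.
have mg : measurable_fun (@Rpos R) (fun t => f t * m_density t).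
  exact: measurable_funM.
have mEg : measurable_fun (@Rpos R) (fun t => (f t * m_density t)%:E).
  exact/measurable_EFinP.
rewrite (@Rintegral_density _ _ _ leb' _ _ mr (@m_density R))// /Rintegral; congr fine.
by rewrite integralE [RHS]integralE !ge0_integral_leb'//;
  [exact: measurable_funeneg|exact: measurable_funepos].
Qed.

Lemma m_integrable_dominated f (C c : R) k :
  c < 1 -> measurable_fun (@Rpos R) f ->
  (forall t, 0 < t -> `|f t| <= C * t ^+ k * expR (c * t)) ->
  m.-integrable (@Rpos R) (EFin \o f).
Proof.
move=> c1 mf fC; apply/m_integrableE => //.
(* Leaves a decay rate 1 - d - c >= (1 - c) / 2 > 0 after the density bound; the cap at 1 is
   demanded by [m_density_le]. *)
pose d := Num.min 1 ((1 - c) / 2); have d0 : 0 < d.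
  by rewrite lt_min ltr01 divr_gt0// subr_gt0.
have d1 : d <= 1 by rewrite ge_min lexx.
have dc : d <= (1 - c) / 2 by rewrite ge_min lexx orbT.
have a0 : 0 < 1 - d - c by lra.
apply: (@lebesgue_integrable_dominated _ (C / d) (1 - d - c) k) => //.
  by apply: measurable_funM => //; exact: measurable_m_density.
move=> t t0; rewrite normrM [`|m_density t|]ger0_norm; last exact/m_density_ge0/RposE.
have -> : - (1 - d - c) * t = c * t + - (1 - d) * t by ring.
rewrite expRD.
have -> : C / d * t ^+ k * (expR (c * t) * expR (- (1 - d) * t)) =
  C * t ^+ k * expR (c * t) * (d^-1 * expR (- (1 - d) * t)) by ring.
rewrite ler_pM//; [exact/m_density_ge0/RposE|exact: fC|].
by rewrite m_density_le// d0 d1.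
Qed.

Lemma m_integrable_bounded f (C : R) : measurable_fun (@Rpos R) f ->
  (forall t, 0 < t -> `|f t| <= C) -> m.-integrable (@Rpos R) (EFin \o f).
Proof.
move=> mf fC; apply: (@m_integrable_dominated _ C 0 0) => //.
by move=> t t0; rewrite expr0 mulr1 mul0r expR0 mulr1 fC.
Qed.

(** The constant 1 is integrable. Finiteness makes m eligible for the Fubini argument of
    [Rintegral_exchange]. *)
Lemma m_meas_fin_num : fin_num_fun m.
Proof.
move=> A mA; rewrite ge0_fin_numE//; apply: (@le_lt_trans _ _ (m setT)).
  by rewrite le_measure// inE.
have mT : m setT = m (@Rpos R) by rewrite /= /m_meas setTI setIid.
have := @m_integrable_bounded (cst 1) 1 (@measurable_cst _ _ _ _ _ _)
  (fun _ _ => ltac:(by rewrite normr1)).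
move=> /integrableP[_]; rewrite mT.
rewrite (eq_integral (cst 1%E)); last by move=> x _; rewrite /= normr1.
by rewrite integral_cst ?mul1e//; exact: measurable_Rpos.
Qed.

HB.instance Definition _ := @Measure_isFinite.Build _ _ _ (@m_meas R) m_meas_fin_num.

End m_measure.

(** * The fundamental theorem of calculus on the half-line *)

Section ftc_pinfty.
Variable R : realType.
Local Notation leb := (@lebesgue_measure R).

(** The integrands to come oscillate, so no sign is assumed: f is cut off to [[0, n]], integrated
    there, and n tends to infinity under the majorant |f|. *)
Lemma Rintegral_derive_pinfty (F f : R -> R) :
  (forall t : R, is_derive t 1 F (f t)) -> continuous f ->
  leb.-integrable (@Rpos R) (EFin \o f) -> F t @[t --> +oo] --> 0 ->
  \int[leb]_(t in @Rpos R) f t = - F 0.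
Proof.
move=> dF cf fi F0.
have mf : measurable_fun setT f by exact: continuous_measurable_fun.
pose f_ (n : nat) : R -> \bar R := (EFin \o f) \_ `[0, n%:R].
have := @dominated_convergence _ _ _ leb (@Rpos R) (@measurable_RposL R) f_
  (EFin \o f) (abse \o (EFin \o f)).
case.
- move=> n; apply: measurable_funTS; apply/(measurable_restrictT _ _).1.
    exact: measurable_itv.
  by apply: measurable_funTS; exact/measurable_EFinP.
- by apply: measurable_funTS; exact/measurable_EFinP.
- apply: aeW => t /RposE t0; apply: cvg_near_cst.
  near=> n; rewrite /f_ patchE mem_set//= in_itv/= ltW//=.
  near: n; exact: nbhs_infty_ger.
- exact: integrable_abse.
- apply: aeW => t n _; rewrite /f_ patchE; case: ifPn => //= _.
  by rewrite normr0 lee_fin.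
move=> _ _ f_f.
rewrite /Rintegral; have -> : (\int[leb]_(t in @Rpos R) (f t)%:E)%E = (- F 0)%:E; last by [].
move/(cvg_lim (@ereal_hausdorff R)) : f_f => <-.
apply/cvg_lim => //.
(* From n to n + 1, so that the interval of integration is never degenerate. *)
rewrite -(cvg_shiftS _ (nbhs ((- F 0)%:E)))/=.
rewrite (_ : (fun n => _) = (fun n => (F n.+1%:R - F 0)%:E)); last first.
  apply/funext => n; rewrite /f_ -integral_mkcondr.
  have -> : @Rpos R `&` `[0, n.+1%:R] = `]0, n.+1%:R]%classic.
    apply/seteqP; split => t /=; rewrite !in_itv/=.
      by move=> [/RposE -> /andP[_ ->]].
    by move=> /andP[t0 ->]; split; [exact/RposE|rewrite (ltW t0)].
  rewrite integral_itv_obnd_cbnd; last first.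
    by apply: measurable_funTS; exact/measurable_EFinP.
  rewrite (@continuous_FTC2 _ _ F)//.
  - exact: continuous_subspaceT.
  - split.
    + by move=> x _.
    + apply: cvg_at_right_filter.
      by apply: differentiable_continuous; apply/derivable1_diffP.
    + apply: cvg_at_left_filter.
      by apply: differentiable_continuous; apply/derivable1_diffP.
  - by move=> x _; rewrite derive1E derive_val.
apply: cvg_EFin; first exact: nearW.
rewrite -[X in _ --> X]add0r; apply: cvgB; last exact: cvg_cst.
rewrite (cvg_shiftS (fun n => F n%:R)).
by move/cvg_pinftyP : F0; apply; exact: cvgr_idn.
Unshelve. all: end_near. Qed.
End ftc_pinfty.

(** * Integrals of [bfun] against exponentially decaying weights *)

Section bfun_expR.
Variable R : realType.
Local Notation leb := (@lebesgue_measure R).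
Implicit Types (x t s : R).

(** Termwise comparison with the exponential series. It serves negative arguments, where the bound 1
    / nu! fails; they occur because differentiation at s = 0 needs a two-sided neighbourhood. *)
Lemma bfun_le_expR nu x : `|bfun nu x| <= expR `|x|.
Proof.
have cvn := @is_cvg_bfun R nu x.
have cvN := is_cvg_series_exp_coeff `|x|.
have le_term n : `|bcoef R nu n * x ^+ n| <= exp_coeff `|x| n.
  by exact: bcoef_le_exp_coeff.
rewrite -(cvg_lim (@Rhausdorff R) (cvg_norm cvn)); apply: ler_lim => //.
  exact: is_cvg_norm.
apply: nearW => n; rewrite /pseries /series/=.
by apply: (le_trans (ler_norm_sum _ _ _)); apply: ler_sum => i _; exact: le_term.
Qed.
End bfun_expR.

Section weighted_bfun.
Variable R : realType.
Local Notation leb := (@lebesgue_measure R).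
Implicit Types (s t : R).
Variables (a C : R) (a0 : 0 < a).

Let a20 : 0 < a / 2. Proof. by rewrite divr_gt0. Qed.

(** Half of the decay of the weight h is given up in order to admit slightly negative s. *)
Lemma bfunM_le_expR nu s t : - (a / 2) < s -> 0 < t ->
  `|bfun nu (s * t)| <= expR (a / 2 * t).
Proof.
move=> sa t0; have [s0|s0] := leP 0 s.
  apply: (le_trans (bfun_le _ _)); first by rewrite mulr_ge0// ltW.
  apply: (@le_trans _ _ 1); first by rewrite invf_le1 ?ler1n ?ltr0n fact_gt0.
  by rewrite -[leLHS]expR0 ler_expR mulr_ge0 ?ltW//.
apply: (le_trans (bfun_le_expR _ _)); rewrite ler_expR normrM (gtr0_norm t0).
by rewrite ler_pM2r// ltr0_norm// lerNl ltW.
Qed.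

Variable h : R -> R.
Hypotheses (ch : continuous h) (hC : forall t, 0 < t -> `|h t| <= C * expR (- a * t)).

Let C0 : 0 <= C.
Proof.
have := hC ltr01; have := normr_ge0 (h 1) => /le_trans /[apply].
by rewrite pmulr_lge0// expR_gt0.
Qed.

Lemma weighted_bfun_le nu k s t : - (a / 2) < s -> 0 < t ->
  `|t ^+ k * h t * bfun nu (s * t)| <= C * t ^+ k * expR (- (a / 2) * t).
Proof.
move=> sa t0; have tk0 : 0 <= t ^+ k by rewrite exprn_ge0// ltW.
rewrite !normrM (@ger0_norm _ (t ^+ k))//.
have -> : - (a / 2) * t = - a * t + a / 2 * t by field.
rewrite expRD [C * _]mulrC -!mulrA ler_wpM2l// mulrA.
by rewrite ler_pM// ?hC// mulrA bfunM_le_expR.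
Qed.

Lemma continuous_weighted_bfun nu k s :
  continuous (fun t => t ^+ k * h t * bfun nu (s * t)).
Proof.
move=> t; apply: cvgM; first by apply: cvgM; [exact: exprn_continuous|exact: ch].
apply: continuous_comp; last exact: continuous_bfun.
by apply: cvgM; [exact: cvg_cst|exact: cvg_id].
Qed.

Lemma weighted_bfun_integrable nu k s : - (a / 2) < s ->
  leb.-integrable (@Rpos R) (EFin \o (fun t => t ^+ k * h t * bfun nu (s * t))).
Proof.
move=> sa; apply: (lebesgue_integrable_dominated a20 (C := C) (k := k)).
  apply: measurable_funTS; apply: continuous_measurable_fun.
  exact: continuous_weighted_bfun.
by move=> t t0; exact: weighted_bfun_le.
Qed.

Lemma is_derive_weighted_bfun s : - (a / 2) < s ->
  is_derive s 1 (fun s => \int[leb]_(t in @Rpos R) (t * h t * bfun 1 (s * t)))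
    (- \int[leb]_(t in @Rpos R) (t ^+ 2 * h t * bfun 2 (s * t))).
Proof.
move=> sa; pose f s t := t * h t * bfun 1 (s * t).
have df s' t : is_derive s' 1 (f ^~ t) (- (t ^+ 2 * h t * bfun 2 (s' * t))).
  have := is_derive_compMl (@is_derive_bfun R 1 (t * s')).
  move/(is_deriveZ (t * h t)); rewrite /GRing.scale/=.
  have -> : f ^~ t = (t * h t) \*: (fun x => bfun 1 (t * x)).
    by apply/funext => x; rewrite /f [x * t]mulrC.
  rewrite (_ : t * h t * (t * - bfun 2 (t * s')) = - (t ^+ 2 * h t * bfun 2 (s' * t)))//.
  by rewrite [s' * t]mulrC; ring.
(* An open interval around s on which the majorant [G] below serves all parameters at once. *)
have Is : [set` `]- (a / 2), s + 1[] s by rewrite /= in_itv/= sa ltrDl ltr01.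
have fi x : [set` `]- (a / 2), s + 1[] x -> leb.-integrable (@Rpos R) (EFin \o f x).
  rewrite /= in_itv/= => /andP[ax _].
  have := @weighted_bfun_integrable 1 1 x ax.
  by under eq_fun do rewrite expr1.
have dfi x y : [set` `]- (a / 2), s + 1[] x -> Rpos y -> derivable (f ^~ y) x 1.
  by move=> _ _; exact: ex_derive.
pose G t := C * t ^+ 2 * expR (- (a / 2) * t).
have G0 t : 0 <= G t by rewrite mulr_ge0 ?expR_ge0// mulr_ge0// sqr_ge0.
have Gi : leb.-integrable (@Rpos R) (EFin \o G).
  apply: (lebesgue_integrable_dominated a20 (C := C) (k := 2)).
    apply: measurable_funTS; apply: continuous_measurable_fun => t.
    apply: cvgM; last exact: continuous_expRM.
    by apply: cvgM; [exact: cvg_cst|exact: exprn_continuous].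
  by move=> t _; rewrite ger0_norm.
have d1E x y : partial1of2 f x y = - (y ^+ 2 * h y * bfun 2 (x * y)).
  by rewrite partial1of2E derive_val.
have Gub x y : [set` `]- (a / 2), s + 1[] x -> Rpos y -> `|partial1of2 f x y| <= G y.
  rewrite /= in_itv/= => /andP[ax _] /RposE y0.
  by rewrite d1E normrN weighted_bfun_le.
have mr := @measurable_RposL R.
apply: DeriveDef; first exact: (derivable_under_integral mr Is fi dfi G0 Gi Gub).
rewrite -derive1E (differentiation_under_integral mr Is fi dfi G0 Gi Gub).
under eq_Rintegral do rewrite d1E -mulN1r.
by rewrite RintegralZl ?mulN1r//; exact: weighted_bfun_integrable.
Qed.

Lemma cvg_weighted_bfun_pinfty nu k s : - (a / 2) < s ->
  t ^+ k * h t * bfun nu (s * t) @[t --> +oo] --> 0.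
Proof.
move=> sa; have a40 : 0 < a / 2 / 2 by rewrite !divr_gt0.
pose K := C * (k`!%:R / (a / 2 / 2) ^+ k).
have : K * expR (- (a / 2 / 2) * t) @[t --> +oo] --> 0.
  rewrite -[X in _ --> X](mulr0 K); apply: cvgM; first exact: cvg_cst.
  exact: cvg_expRM_pinfty.
move=> KE; apply: norm_cvg0; apply: (squeeze_cvgr _ (cvg_cst 0) KE); near=> t.
have t0 : 0 < t by near: t; exact: nbhs_pinfty_gt.
rewrite normr_ge0/=; apply: (le_trans (weighted_bfun_le _ _ sa t0)).
rewrite -mulrA /K -[X in _ <= X]mulrA ler_wpM2l//.
exact: expr_expR_le (ltW t0) a20.
Unshelve. all: end_near. Qed.
End weighted_bfun.

Section weighted_bfun_parts.
Variable R : realType.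
Local Notation leb := (@lebesgue_measure R).
Implicit Types (s t : R).
Variables (a C C' : R) (h h' : R -> R).
Hypothesis a0 : 0 < a.
Hypotheses (dh : forall t, is_derive t 1 h (h' t)).
Hypotheses (hC : forall t, 0 < t -> `|h t| <= C * expR (- a * t)).
Hypotheses (ch' : continuous h') (hC' : forall t, 0 < t -> `|h' t| <= C' * expR (- a * t)).

Let ch : continuous h.
Proof.
by move=> t; apply: differentiable_continuous; apply/derivable1_diffP.
Qed.

(** By [bfun_ode 1] the two integrands add up to the derivative of t^2 h(t) [bfun 2] (s t), which
    vanishes at 0 and at infinity. *)
Lemma weighted_bfun_parts s : 0 <= s ->
  \int[leb]_(t in @Rpos R) (t ^+ 2 * h' t * bfun 2 (s * t)) +
  \int[leb]_(t in @Rpos R) (t * h t * bfun 1 (s * t)) = 0.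
Proof.
move=> s0; have sa : - (a / 2) < s by rewrite (lt_le_trans _ s0)// oppr_lt0 divr_gt0.
pose F t := t ^+ 2 * h t * bfun 2 (s * t).
pose f t := t ^+ 2 * h' t * bfun 2 (s * t) + t * h t * bfun 1 (s * t).
have dF t : is_derive t 1 F (f t).
  have db := is_derive_compMl (@is_derive_bfun R 2 (s * t)).
  have dt2 : is_derive t 1 (fun t : R => t ^+ 2) (2 * t).
    have := is_deriveX 2 (is_derive_id t 1).
    by rewrite /GRing.scale/= expr1 mulr1.
  have := is_deriveM (is_deriveM dt2 (dh t)) db.
  rewrite /GRing.scale/=.
  suff -> : f t = t ^+ 2 * h t * (s * - bfun 3 (s * t)) +
    bfun 2 (s * t) * (t ^+ 2 * h' t + h t * (2 * t)) by [].
  have e := bfun_ode 1 (s * t); rewrite /f.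
  have -> : bfun 1 (s * t) = 2 * bfun 2 (s * t) - s * t * bfun 3 (s * t).
    by apply/eqP; rewrite -subr_eq0 -e; apply/eqP; ring.
  by ring.
have i1 := weighted_bfun_integrable a0 ch' hC' 2 2 sa.
have i2 := weighted_bfun_integrable a0 ch hC 1 1 sa.
rewrite -[LHS]RintegralD//=; last exact: measurable_RposL.
rewrite (@Rintegral_derive_pinfty _ F f)//.
- by rewrite /F expr0n/= !mul0r oppr0.
- move=> t; apply: cvgD; first exact: continuous_weighted_bfun.
  exact: (@continuous_weighted_bfun _ _ ch 1 1 s t).
- exact: (integrableD (@measurable_RposL R) i1 i2).
- exact: (cvg_weighted_bfun_pinfty a0 hC 2 2 sa).
Qed.
End weighted_bfun_parts.

(** * The transform of t [bfun 1] (s t) at a complex point a + i b *)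

Section laplace_bfun.
Variable R : realType.
Local Notation leb := (@lebesgue_measure R).
Implicit Types (s t : R).

(* real and imaginary parts of [exp (- (a + i b) t)] *)
Definition expcos (a b t : R) := expR (- a * t) * cos (b * t).
Definition expsin (a b t : R) := - (expR (- a * t) * sin (b * t)).

Variables (a b : R).
Hypothesis a0 : 0 < a.

Lemma is_derive_expcos t :
  is_derive t 1 (expcos a b) (- a * expcos a b t + b * expsin a b t).
Proof.
have dc := is_derive_compMl (is_derive_cos (b * t)).
have := is_deriveM (is_derive_expRMl (- a) t) dc; rewrite /GRing.scale/=.
suff -> : - a * expcos a b t + b * expsin a b t =
  expR (- a * t) * (b * - sin (b * t)) + cos (b * t) * (- a * expR (- a * t)) by [].
by rewrite /expcos /expsin; ring.
Qed.

Lemma is_derive_expsin t :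
  is_derive t 1 (expsin a b) (- a * expsin a b t - b * expcos a b t).
Proof.
have dc := is_derive_compMl (is_derive_sin (b * t)).
have := is_deriveN (is_deriveM (is_derive_expRMl (- a) t) dc); rewrite /GRing.scale/=.
suff -> : - a * expsin a b t - b * expcos a b t =
  - (expR (- a * t) * (b * cos (b * t)) + sin (b * t) * (- a * expR (- a * t))) by [].
by rewrite /expcos /expsin; ring.
Qed.

Lemma continuous_expcos : continuous (expcos a b).
Proof.
move=> t; have dc := is_derive_expcos t.
by apply: differentiable_continuous; apply/derivable1_diffP.
Qed.

Lemma continuous_expsin : continuous (expsin a b).
Proof.
move=> t; have dc := is_derive_expsin t.
by apply: differentiable_continuous; apply/derivable1_diffP.
Qed.

Lemma expcos_le t : `|expcos a b t| <= expR (- a * t).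
Proof.
rewrite /expcos normrM ger0_norm ?expR_ge0// ler_piMr ?expR_ge0//.
by rewrite ler_norml cos_geN1 cos_le1.
Qed.

Lemma expsin_le t : `|expsin a b t| <= expR (- a * t).
Proof.
rewrite /expsin normrN normrM ger0_norm ?expR_ge0// ler_piMr ?expR_ge0//.
by rewrite ler_norml sin_geN1 sin_le1.
Qed.

Let hc t : 0 < t -> `|expcos a b t| <= 1 * expR (- a * t).
Proof. by rewrite mul1r expcos_le. Qed.

Let hs t : 0 < t -> `|expsin a b t| <= 1 * expR (- a * t).
Proof. by rewrite mul1r expsin_le. Qed.

Let hlin (c d : R) t : 0 < t ->
  `|c * expcos a b t + d * expsin a b t| <= (`|c| + `|d|) * expR (- a * t).
Proof.
move=> _; rewrite (le_trans (ler_normD _ _))// mulrDl lerD// normrM ler_wpM2l//.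
  exact: expcos_le.
exact: expsin_le.
Qed.

Let clin (c d : R) : continuous (fun t => c * expcos a b t + d * expsin a b t).
Proof.
move=> t; apply: cvgD; apply: cvgM; try exact: cvg_cst.
  exact: continuous_expcos.
exact: continuous_expsin.
Qed.

(** G = [G1 + i G2] is the integral of t e^(- (a + i b) t) [bfun 1] (s t), and D = [D1 + i D2] is
    its derivative in s. *)
Let G1 s := \int[leb]_(t in @Rpos R) (t * expcos a b t * bfun 1 (s * t)).
Let G2 s := \int[leb]_(t in @Rpos R) (t * expsin a b t * bfun 1 (s * t)).
Let D1 s := - \int[leb]_(t in @Rpos R) (t ^+ 2 * expcos a b t * bfun 2 (s * t)).
Let D2 s := - \int[leb]_(t in @Rpos R) (t ^+ 2 * expsin a b t * bfun 2 (s * t)).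

Let sa s : 0 <= s -> - (a / 2) < s.
Proof. by move=> s0; rewrite (lt_le_trans _ s0)// oppr_lt0 divr_gt0. Qed.

Let ode_aux (c d : R) s : 0 <= s ->
  \int[leb]_(t in @Rpos R) (t ^+ 2 * (c * expcos a b t + d * expsin a b t) * bfun 2 (s * t))
  = - c * D1 s - d * D2 s.
Proof.
move=> s0; have i1 := weighted_bfun_integrable a0 continuous_expcos hc 2 2 (sa s0).
have i2 := weighted_bfun_integrable a0 continuous_expsin hs 2 2 (sa s0).
have mr := @measurable_RposL R.
rewrite /D1 /D2 !mulNr !mulrN !opprK -!RintegralZl// -RintegralD//.
- by apply: eq_Rintegral => t _; ring.
- exact: (integrableZl mr c i1).
- exact: (integrableZl mr d i2).
Qed.

(** Real part of (a + i b) D + G = 0, which is integration by parts for a weight with h' = - (a + i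
    b) h; [ode2] is the imaginary part. *)
Let ode1 s : 0 <= s -> a * D1 s - b * D2 s + G1 s = 0.
Proof.
move=> s0; have := weighted_bfun_parts a0 is_derive_expcos hc
  (@clin (- a) b) (hlin (- a) b) s0.
by rewrite ode_aux// opprK.
Qed.

Let ode2 s : 0 <= s -> a * D2 s + b * D1 s + G2 s = 0.
Proof.
move=> s0; have e t : - a * expsin a b t - b * expcos a b t =
  - b * expcos a b t + - a * expsin a b t by ring.
have dh t : is_derive t 1 (expsin a b) (- b * expcos a b t + - a * expsin a b t).
  by rewrite -e; exact: is_derive_expsin.
have := weighted_bfun_parts a0 dh hs (@clin (- b) (- a)) (hlin (- b) (- a)) s0.
by rewrite ode_aux// => <-; rewrite /G2; ring.
Qed.

(* [k + i l] is the inverse of [a + i b] *)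
Variables (k l : R).
Hypotheses (kl1 : a * k - b * l = 1) (kl2 : a * l + b * k = 0).

(** Since [bfun 1 0 = 1], this is t^j h(t) written with the kernel at s = 0, so that the limit at
    infinity proved for the kernel applies. *)
Let w j (h : R -> R) t : R := t ^+ j * h t * bfun 1 (0 * t).

Let wE j h t : w j h t = t ^+ j * h t.
Proof. by rewrite /w mul0r bfun0 invr1 mulr1. Qed.

Let cvg_w j (c : R) (h : R -> R) : continuous h ->
  (forall t, 0 < t -> `|h t| <= 1 * expR (- a * t)) ->
  c * w j h t @[t --> +oo] --> 0.
Proof.
move=> ch hC; rewrite -[X in _ --> X](mulr0 c); apply: cvgM; first exact: cvg_cst.
exact: (cvg_weighted_bfun_pinfty a0 hC 1 j (sa (lexx 0))).
Qed.

Let p := expcos a b.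
Let q := expsin a b.

Let is_derive_lin (c d t : R) : is_derive t 1 (fun t : R => t * c + d) c.
Proof.
have := is_deriveD (is_deriveZ c (is_derive_id t 1)) (is_derive_cst d t 1).
rewrite /GRing.scale/= mulr1 addr0.
by have -> : (fun t : R => t * c + d) = (c \*: id + cst d)
  by apply/funext => u; rewrite !fctE mulrC.
Qed.

Let derive_aux (g h : R -> R) (g' h' t c d e f : R) :
  is_derive t 1 g g' -> is_derive t 1 h h' ->
  is_derive t 1 (fun t => (t * c + d) * g t + (t * e + f) * h t)
    (c * g t + (t * c + d) * g' + (e * h t + (t * e + f) * h')).
Proof.
move=> dg dh.
have := is_deriveD (is_deriveM (is_derive_lin c d t) dg)
  (is_deriveM (is_derive_lin e f t) dh).
rewrite /GRing.scale/=.
suff -> : c * g t + (t * c + d) * g' + (e * h t + (t * e + f) * h') =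
  (t * c + d) * g' + g t * c + ((t * e + f) * h' + h t * e) by [].
by ring.
Qed.

Let G1_0 : G1 0 = k ^+ 2 - l ^+ 2.
Proof.
have [cp cq] := (continuous_expcos, continuous_expsin).
(* Real part of the antiderivative - (c t + c^2) e^(- (a + i b) t), where c = k + i l. *)
pose F t := (t * - k + (l ^+ 2 - k ^+ 2)) * p t + (t * l + 2 * k * l) * q t.
have dF t : is_derive t 1 F (t * p t * bfun 1 (0 * t)).
  have := derive_aux (- k) (l ^+ 2 - k ^+ 2) l (2 * k * l)
    (is_derive_expcos t) (is_derive_expsin t).
  congr (is_derive _ _ _ _); rewrite mul0r bfun0 invr1 mulr1 -/p -/q.
  (* The excess is grouped into multiples of [a * k - b * l - 1] and [a * l + b * k], both zero. *)
  transitivity (t * p t +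
    p t * ((a * k - b * l - 1) * (t + k) - l * (a * l + b * k)) +
    q t * (- (t + k) * (a * l + b * k) - l * (a * k - b * l - 1))); first by ring.
  by rewrite kl1 kl2; ring.
rewrite /G1 (Rintegral_derive_pinfty dF).
- by rewrite /F /p /q /expcos /expsin !mulr0 cos0 sin0 expR0; ring.
- exact: (@continuous_weighted_bfun _ _ cp 1 1 0).
- exact: (weighted_bfun_integrable a0 cp hc 1 1 (sa (lexx 0))).
- have -> : F = (fun t => - k * w 1 p t + (l ^+ 2 - k ^+ 2) * w 0 p t +
      (l * w 1 q t + (2 * k * l) * w 0 q t)).
    by apply/funext => t; rewrite /F !wE expr1 expr0; ring.
  rewrite -[X in _ --> X](addr0 0) -[X in _ --> X + _](addr0 0) -[X in _ --> _ + X](addr0 0).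
  by apply: cvgD; apply: cvgD; exact: cvg_w.
Qed.

Let G2_0 : G2 0 = 2 * k * l.
Proof.
have [cp cq] := (continuous_expcos, continuous_expsin).
(* Imaginary part of the same antiderivative. *)
pose F t := (t * - k + (l ^+ 2 - k ^+ 2)) * q t + (t * - l + - (2 * k * l)) * p t.
have dF t : is_derive t 1 F (t * q t * bfun 1 (0 * t)).
  have := derive_aux (- k) (l ^+ 2 - k ^+ 2) (- l) (- (2 * k * l))
    (is_derive_expsin t) (is_derive_expcos t).
  congr (is_derive _ _ _ _); rewrite mul0r bfun0 invr1 mulr1 -/p -/q.
  transitivity (t * q t +
    q t * ((a * k - b * l - 1) * (t + k) - l * (a * l + b * k)) -
    p t * (- (t + k) * (a * l + b * k) - l * (a * k - b * l - 1))); first by ring.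
  by rewrite kl1 kl2; ring.
rewrite /G2 (Rintegral_derive_pinfty dF).
- by rewrite /F /p /q /expcos /expsin !mulr0 cos0 sin0 expR0; ring.
- exact: (@continuous_weighted_bfun _ _ cq 1 1 0).
- exact: (weighted_bfun_integrable a0 cq hs 1 1 (sa (lexx 0))).
- have -> : F = (fun t => - k * w 1 q t + (l ^+ 2 - k ^+ 2) * w 0 q t +
      (- l * w 1 p t + (- (2 * k * l)) * w 0 p t)).
    by apply/funext => t; rewrite /F !wE expr1 expr0; ring.
  rewrite -[X in _ --> X](addr0 0) -[X in _ --> X + _](addr0 0) -[X in _ --> _ + X](addr0 0).
  by apply: cvgD; apply: cvgD; exact: cvg_w.
Qed.

(** Multiplying (a + i b) D + G = 0 by k + i l gives G' = - (k + i l) G; this is its real part, and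
    [dG2] the imaginary one. *)
Let dG1 s : 0 <= s -> is_derive s 1 G1 (- k * G1 s + l * G2 s).
Proof.
move=> s0; have := is_derive_weighted_bfun a0 continuous_expcos hc (sa s0).
congr (is_derive _ _ _ _); rewrite -/(D1 s).
transitivity (D1 s * (a * k - b * l) - D2 s * (a * l + b * k)).
  by rewrite kl1 kl2; ring.
have -> : G1 s = - (a * D1 s - b * D2 s).
  by apply/eqP; rewrite -addr_eq0 addrC ode1.
have -> : G2 s = - (a * D2 s + b * D1 s).
  by apply/eqP; rewrite -addr_eq0 addrC ode2.
ring.
Qed.

Let dG2 s : 0 <= s -> is_derive s 1 G2 (- k * G2 s - l * G1 s).
Proof.
move=> s0; have := is_derive_weighted_bfun a0 continuous_expsin hs (sa s0).
congr (is_derive _ _ _ _); rewrite -/(D2 s).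
transitivity (D2 s * (a * k - b * l) + D1 s * (a * l + b * k)).
  by rewrite kl1 kl2; ring.
have -> : G1 s = - (a * D1 s - b * D2 s).
  by apply/eqP; rewrite -addr_eq0 addrC ode1.
have -> : G2 s = - (a * D2 s + b * D1 s).
  by apply/eqP; rewrite -addr_eq0 addrC ode2.
ring.
Qed.

(* [exp ((k + i l) s) (G1 s + i G2 s)] is constant on [s >= 0]. *)
Let derive0_cst (f : R -> R) s : 0 <= s ->
  (forall t, 0 <= t -> is_derive t 1 f 0) -> f s = f 0.
Proof.
rewrite le_eqVlt => /predU1P[<-//|s0 df].
have df' x : x \in `]0, s[ -> is_derive x 1 f 0.
  by rewrite in_itv/= => /andP[/ltW x0 _]; exact: df.
have cf : {within `[0, s], continuous f}.
  apply: derivable_within_continuous => x; rewrite in_itv/= => /andP[x0 _].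
  by have [] := df _ x0.
have [c _] := MVT s0 df' cf.
by rewrite mul0r => /eqP; rewrite subr_eq0 => /eqP.
Qed.

Let dcosl s := is_derive_compMl (is_derive_cos (l * s)).
Let dsinl s := is_derive_compMl (is_derive_sin (l * s)).

Let P1E s : 0 <= s ->
  expR (k * s) * (cos (l * s) * G1 s - sin (l * s) * G2 s) = k ^+ 2 - l ^+ 2.
Proof.
move=> s0.
pose P s := expR (k * s) * (cos (l * s) * G1 s - sin (l * s) * G2 s).
suff dP t : 0 <= t -> is_derive t 1 P 0.
  by rewrite -/(P s) (derive0_cst s0 dP) /P !mulr0 expR0 cos0 sin0 G1_0 G2_0; ring.
move=> t0; have := is_deriveM (is_derive_expRMl k t)
  (is_deriveB (is_deriveM (dcosl t) (dG1 t0)) (is_deriveM (dsinl t) (dG2 t0))).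
congr (is_derive _ _ _ _); rewrite /GRing.scale !fctE/=; ring.
Qed.

Let P2E s : 0 <= s ->
  expR (k * s) * (sin (l * s) * G1 s + cos (l * s) * G2 s) = 2 * k * l.
Proof.
move=> s0.
pose P s := expR (k * s) * (sin (l * s) * G1 s + cos (l * s) * G2 s).
suff dP t : 0 <= t -> is_derive t 1 P 0.
  by rewrite -/(P s) (derive0_cst s0 dP) /P !mulr0 expR0 cos0 sin0 G1_0 G2_0; ring.
move=> t0; have := is_deriveM (is_derive_expRMl k t)
  (is_deriveD (is_deriveM (dsinl t) (dG1 t0)) (is_deriveM (dcosl t) (dG2 t0))).
congr (is_derive _ _ _ _); rewrite /GRing.scale !fctE/=; ring.
Qed.

(** Real part of (k + i l)^2 e^(- (k + i l) s): the value of G at 0 divided by the integrating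
    factor. *)
Lemma laplace_bfun_cos s : 0 <= s ->
  \int[leb]_(t in @Rpos R) (t * expcos a b t * bfun 1 (s * t)) =
  (k ^+ 2 - l ^+ 2) * expcos k l s - 2 * k * l * expsin k l s.
Proof.
move=> s0; rewrite -/(G1 s) -(P1E s0) -(P2E s0) /expcos /expsin mulNr expRN.
have c2 := cos2Dsin2 (l * s).
(* Undoes the rotation by the angle l s in the two constants. *)
transitivity (G1 s * (cos (l * s) ^+ 2 + sin (l * s) ^+ 2)).
  by rewrite c2 mulr1.
by field; rewrite expR_eq0.
Qed.

Lemma laplace_bfun_sin s : 0 <= s ->
  \int[leb]_(t in @Rpos R) (t * expsin a b t * bfun 1 (s * t)) =
  2 * k * l * expcos k l s + (k ^+ 2 - l ^+ 2) * expsin k l s.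
Proof.
move=> s0; rewrite -/(G2 s) -(P1E s0) -(P2E s0) /expcos /expsin mulNr expRN.
have c2 := cos2Dsin2 (l * s).
transitivity (G2 s * (cos (l * s) ^+ 2 + sin (l * s) ^+ 2)).
  by rewrite c2 mulr1.
by field; rewrite expR_eq0.
Qed.
End laplace_bfun.

(** * Dominated convergence for real-valued integrals *)

Section Rintegral_dominated.
Context d (T : measurableType d) (R : realType).
Variables (mu : {measure set T -> \bar R}) (D : set T) (mD : measurable D).
Variables (f_ : nat -> T -> R) (f g : T -> R).
Hypothesis mf_ : forall n, measurable_fun D (f_ n).
Hypothesis f_f : forall x, D x -> f_ n x @[n --> \oo] --> f x.
Hypothesis ig : mu.-integrable D (EFin \o g).
Hypothesis f_g : forall x n, D x -> `|f_ n x| <= g x.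

Let f_fE x : D x -> (f_ n x)%:E @[n --> \oo] --> (f x)%:E.
Proof. by move=> Dx; apply: cvg_EFin; [exact: nearW|exact: f_f]. Qed.

Let mf_E n : measurable_fun D (EFin \o f_ n).
Proof. exact/measurable_EFinP. Qed.

Let mf : measurable_fun D (EFin \o f).
Proof. exact: (emeasurable_fun_cvg (fun n => EFin \o f_ n)). Qed.

Let dct := dominated_convergence mD mf_E mf (aeW mu f_fE) ig
  (aeW mu (fun x n Dx => f_g n Dx : (`|(EFin \o f_ n) x| <= (EFin \o g) x)%E)).

Lemma Rintegral_dominated_cvg :
  \int[mu]_(x in D) f_ n x @[n --> \oo] --> \int[mu]_(x in D) f x.
Proof.
have [fi _ h] := dct; apply: fine_cvg; rewrite fineK//.
exact: integrable_fin_num.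
Qed.

End Rintegral_dominated.

(** * Uniqueness for the real Laplace transform *)

Section uniqueness.
Variable R : realType.
Local Notation m := (@m_meas R).
Implicit Types (s t : R).

Lemma bernoulli_ge (u : R) n : - 1 <= u -> 1 + n%:R * u <= (1 + u) ^+ n.
Proof.
move=> u1; elim: n => [|n ih]; first by rewrite mul0r addr0 expr0.
rewrite exprS -natr1; have u0 : 0 <= 1 + u by lra.
apply: (le_trans _ (ler_wpM2l u0 ih)).
have : 0 <= n%:R * u ^+ 2 by rewrite mulr_ge0// sqr_ge0.
nra.
Qed.

Variable f : R -> R.
Hypothesis fi : m.-integrable (@Rpos R) (EFin \o f).
Hypothesis lap0 : forall s, 0 <= s ->
  \int[m]_(t in @Rpos R) (expR (- s * t) * f t) = 0.

Let mR := @measurable_Rpos R.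

Let mf : measurable_fun (@Rpos R) f.
Proof. by case/integrableP : fi => /measurable_EFinP. Qed.

Let integrableM (h : R -> R) : measurable_fun (@Rpos R) h ->
  (forall t, 0 < t -> `|h t| <= 1) ->
  m.-integrable (@Rpos R) (EFin \o (fun t => h t * f t)).
Proof.
move=> mh h1; apply: (le_integrable mR _ _ fi).
  by apply/measurable_EFinP; exact: measurable_funM.
by move=> t /RposE t0; rewrite lee_fin/= normrM ler_piMl// h1.
Qed.

(* Test functions, combinations of exponentials: at [r = ln 2 / c * n] and
   [N = n 2^n] they tend to the indicator of [t > c]. *)
Let T (r : R) (N : nat) t := (1 - expR (- r * t)) ^+ N.

Let mT r N : measurable_fun (@Rpos R) (T r N).
Proof.
apply: measurable_funTS; apply: continuous_measurable_fun => t.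
apply: (@continuous_comp _ _ _ (fun t => 1 - expR (- r * t)) (fun x : R => x ^+ N));
  last exact: exprn_continuous.
apply: cvgB; [exact: cvg_cst|exact: continuous_expRM].
Qed.

Let expR_01 (r t : R) : 0 <= r -> 0 < t -> 0 < expR (- r * t) <= 1.
Proof. by move=> r0 t0; rewrite expR_gt0 expR_le1 mulNr oppr_le0 mulr_ge0// ltW. Qed.

Let T_01 (r : R) N t : 0 <= r -> 0 < t -> 0 <= T r N t <= 1.
Proof.
move=> r0 t0; have /andP[e0 e1] := expR_01 r0 t0.
rewrite /T exprn_ge0 ?subr_ge0//= exprn_ile1 ?subr_ge0//.
Qed.

(** Induction on N for all s at once: the new factor splits into 1 and - e^(- r t), and the second
    part moves s to s + r. *)
Let int_T (r : R) N (s : R) : 0 <= r -> 0 <= s ->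
  \int[m]_(t in @Rpos R) (expR (- s * t) * T r N t * f t) = 0.
Proof.
move=> r0; elim: N s => [|N ih] s s0.
  by under eq_Rintegral do rewrite /T expr0 mulr1; exact: lap0.
have i s' : 0 <= s' -> m.-integrable (@Rpos R) (EFin \o (fun t => expR (- s' * t) * T r N t * f t)).
  move=> s'0; apply: integrableM.
    apply: measurable_funM; last exact: mT.
    by apply: measurable_funTS; apply: continuous_measurable_fun; exact: continuous_expRM.
  move=> t t0; have /andP[e0 e1] := expR_01 s'0 t0.
  have /andP[T0 T1] := T_01 N r0 t0.
  by rewrite ger0_norm ?mulr_ge0// ?(ltW e0)// mulr_ile1// ltW.
rewrite -[RHS](subrr 0) -{1}(ih s s0) -(ih (s + r) (addr_ge0 s0 r0)) -RintegralB//.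
- apply: eq_Rintegral => t _; rewrite /T exprS.
  have -> : - (s + r) * t = - s * t + - r * t by ring.
  by rewrite expRD; ring.
- exact: i.
- by apply: i; rewrite addr_ge0.
Qed.

(** With r = ln 2 / c, x = e^(- r n t) and N = n 2^n, the product N x is n e^(r (c - t) n). If t > c
    it tends to 0, and Bernoulli's inequality gives T >= 1 - N x. If t <= c it is at least n, and T
    (1 + x)^N <= 1 yields T <= 1 / (n + 1). *)
Let T_cvg (c t : R) : 0 < c -> 0 < t ->
  T (ln 2 / c * n%:R) (n * 2 ^ n) t @[n --> \oo] --> ((c < t)%R%:R : R).
Proof.
move=> c0 t0; pose r := ln 2 / c.
have r0 : 0 < r by rewrite divr_gt0// ln_gt0// ltr1n.
have rc : expR (r * c) = 2 by rewrite /r divfK ?lnK ?posrE// lt0r_neq0.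
pose x n := expR (- (r * n%:R) * t).
have xE n : 2 ^+ n * x n = expR ((r * (c - t)) * n%:R).
  rewrite -rc -expRM_natr /x -expRD; congr expR; ring.
have x1 n : 0 < x n <= 1 by rewrite expR_01// mulr_ge0// ltW.
have NE n : (n * 2 ^ n)%:R * x n = n%:R * (2 ^+ n * x n) by rewrite natrM natrX mulrA.
case: (ltP c t) => [ct|tc].
- apply: (@squeeze_cvgr _ _ _ _ (fun n => 1 - n%:R * expR (- (r * (t - c)) * n%:R)) (cst 1)).
  + apply: nearW => n; have /andP[x0 x1n] := x1 n.
    apply/andP; split; last first.
      by have /andP[] := T_01 (n * 2 ^ n) (mulr_ge0 (ltW r0) (ler0n _ n)) t0.
    have xN1 : -1 <= - x n by rewrite lerN2.
    apply: le_trans (bernoulli_ge (n * 2 ^ n) xN1).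
    by rewrite mulrN NE xE -[c - t]opprB mulrN.
  + rewrite -[X in _ --> X]subr0; apply: cvgB; first exact: cvg_cst.
    have d0 : 0 < r * (t - c) by rewrite mulr_gt0// subr_gt0.
    have d20 : 0 < r * (t - c) / 2 by rewrite divr_gt0.
    (* The constant of [expr_expR_le] for the first power, absorbing the factor n into half of the
       decay. *)
    pose K := (1`!%:R / (r * (t - c) / 2) ^+ 1).
    apply: (@squeeze_cvgr _ _ _ _ (cst 0) (fun n => K * expR (- (r * (t - c) / 2) * n%:R))).
    * apply: nearW => n; rewrite mulr_ge0 ?expR_ge0//=.
      by have := expr_expR_le 1 (ler0n R n) d0; rewrite expr1.
    * exact: cvg_cst.
    * rewrite -[X in _ --> X](mulr0 K); apply: cvgM; first exact: cvg_cst.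
      have /cvg_pinftyP := cvg_expRM_pinfty d20; apply; exact: cvgr_idn.
  + exact: cvg_cst.
- apply: (@squeeze_cvgr _ _ _ _ (cst 0) (fun n => n.+1%:R^-1)).
  + apply: nearW => n; have /andP[x0 x1n] := x1 n.
    have rn0 : 0 <= r * n%:R by rewrite mulr_ge0// ltW.
    have /andP[T0 _] := T_01 (n * 2 ^ n) rn0 t0; rewrite T0/=.
    have xN1 : -1 <= x n by rewrite (le_trans _ (ltW x0))// lerN10.
    rewrite -[leRHS]mul1r ler_pdivlMr//.
    have : n.+1%:R <= (1 + x n) ^+ (n * 2 ^ n).
      apply: le_trans (bernoulli_ge (n * 2 ^ n) xN1).
      rewrite NE -natr1 addrC lerD2l ler_peMr// xE -expR0 ler_expR.
      by rewrite mulr_ge0// mulr_ge0 ?subr_ge0// ltW.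
    move/(ler_wpM2l T0)/le_trans; apply.
    rewrite /T -exprMn exprn_ile1//.
      by rewrite mulr_ge0 ?subr_ge0// addr_ge0// ltW.
    by rewrite -/(x n); nra.
  + exact: cvg_cst.
  + exact: cvg_harmonic.
Qed.

Let int_gt (c : R) : \int[m]_(t in @Rpos R `&` `]c, +oo[) f t = 0.
Proof.
have [c0|c0] := leP c 0.
  have -> : @Rpos R `&` `]c, +oo[ = @Rpos R.
    apply/setIidl => t /RposE t0; rewrite /= in_itv/= andbT.
    exact: le_lt_trans t0.
  by rewrite -[RHS](lap0 (lexx 0)); apply: eq_Rintegral => t _; rewrite oppr0 mul0r expR0 mul1r.
rewrite Rintegral_mkcondr.
have lim : \int[m]_(t in @Rpos R) (T (ln 2 / c * n%:R) (n * 2 ^ n) t * f t) @[n --> \oo]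
   --> \int[m]_(t in @Rpos R) ((f \_ `]c, +oo[) t).
  have r0 n : 0 <= ln 2 / c * n%:R.
    by rewrite mulr_ge0// divr_ge0 ?(ltW c0)// ln_ge0// ler1n.
  apply: (Rintegral_dominated_cvg mR _ _ (integrable_norm fi)).
  - by move=> n; apply: measurable_funM.
  - move=> t /RposE t0.
    have -> : (f \_ `]c, +oo[) t = (c < t)%R%:R * f t.
      rewrite patchE; case: (ltP c t) => ct; rewrite ?mul1r ?mul0r.
        by rewrite mem_set//= in_itv/= ct.
      by rewrite memNset//= in_itv/= andbT; apply/negP; rewrite -leNgt.
    by apply: cvgM; [exact: T_cvg|exact: cvg_cst].
  - move=> t n /RposE t0; rewrite normrM ler_piMl//.
    by have /andP[T0 T1] := T_01 (n * 2 ^ n) (r0 n) t0; rewrite ger0_norm.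
apply/esym/(cvg_unique _ _ lim) => //.
rewrite (_ : (fun n => _) = cst 0); first exact: cvg_cst.
apply/funext => n; rewrite -[RHS](@int_T (ln 2 / c * n%:R) (n * 2 ^ n) 0)//.
  by apply: eq_Rintegral => t _; rewrite oppr0 mul0r expR0 mul1r.
by rewrite mulr_ge0// divr_ge0 ?(ltW c0)// ln_ge0// ler1n.
Qed.
(** Dynkin's theorem: open rays are stable under intersection and generate the Borel sets, and
    complements are handled by the vanishing of the total integral (the case s = 0). *)
Let int_measurable (A : set R) : measurable A ->
  \int[m]_(t in @Rpos R `&` A) f t = 0.
Proof.
move=> mA.
have mG : @measurable _ R = <<s @RGenOInfty.G R >> by exact: RGenOInfty.measurableE.
have GI : setI_closed (@RGenOInfty.G R).
  move=> _ _ [x ->] [y ->]; exists (Num.max x y); apply/seteqP; split => t /=.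
    by rewrite !in_itv/= !andbT gt_max => -[-> ->].
  by rewrite !in_itv/= !andbT gt_max => /andP[].
have fiA (B : set R) : measurable B -> m.-integrable (@Rpos R `&` B) (EFin \o f).
  by move=> mB; apply: (integrableS mR _ _ fi) => //; exact: measurableI.
have fT : \int[m]_(t in @Rpos R) f t = 0.
  by rewrite -[RHS](lap0 (lexx 0)); apply: eq_Rintegral => t _; rewrite oppr0 mul0r expR0 mul1r.
apply: (@dynkin_induction _ R _ (fun A => \int[m]_(t in @Rpos R `&` A) f t = 0) mG GI).
- by rewrite setIT.
- by move=> _ [c ->]; exact: int_gt.
- move=> S mS S0; rewrite -[RHS]fT -[in RHS](setIT (@Rpos R)) -(setUv S) setIUr.
  rewrite Rintegral_setU ?S0 ?add0r//.
  + exact: measurableI.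
  + by apply: measurableI => //; exact: measurableC.
  + by rewrite -setIUr setUv setIT.
  + by apply/disj_setPS => t [[_ St] [_ /(_ St)]].
- move=> F mF tF F0; rewrite setI_bigcupr.
  rewrite /Rintegral integral_bigcup//.
  + rewrite eseries0// => n _ _.
    by rewrite -[LHS]fineK ?[fine _]F0//;
      exact: (integrable_fin_num (measurableI _ _ mR (mF n)) (fiA _ (mF n))).
  + exact: trivIset_setIl.
  + by move=> n; exact: measurableI.
  + rewrite -setI_bigcupr; apply: fiA; exact: bigcupT_measurable.
- by rewrite -mG.
Qed.

Lemma laplace0_ae_eq0 : {ae m, forall t, Rpos t -> f t = 0}.
Proof.
have : ae_eq m (@Rpos R) (EFin \o f) (cst 0%E).
  apply: integral_ae_eq => //.
  move=> E ER mE; rewrite integral0.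
  have fiE : m.-integrable E (EFin \o f) by exact: (integrableS mR).
  rewrite -[LHS]fineK; last exact: integrable_fin_num.
  have := int_measurable mE; rewrite (setIidr ER) /Rintegral => fE.
  by rewrite [fine _]fE.
by apply: filterS => t h /h[].
Qed.
End uniqueness.

(** * Extraction of a subsequence converging in countably many coordinates *)

Section diagonal.
Variable R : realType.

(** By Tychonoff's theorem the sequence has a cluster point p in a product of segments. A
    subsequence converges to p because I is countable: a basic neighbourhood sees finitely many
    coordinates, and step N controls those of code below N. *)
Lemma diagonal_subsequence (I : countType) (w : I -> nat -> R) (B : R) :
  (forall i n, `|w i n| <= B) ->
  exists s : nat -> nat, {homo s : i j / (i < j)%N} /\
    forall i, cvgn (fun n => w i (s n)).
Proof.
move=> wB; pose X := prod_topology (fun _ : I => R); pose x n : X := fun i => w i n.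
have cK : compact [set f : X | forall i, `[- B, B]%classic (f i)].
  exact: (@tychonoff I (fun _ => R) (fun _ => `[- B, B]%classic) (fun _ => @segment_compact _ _ _)).
have [|p [_ px]] := cK (x @ \oo) _.
  by exists 0%N => // n _ i /=; rewrite in_itv/= -ler_norml; exact: wB.
have pnear N : nbhs (p : X)
    [set f | forall i, (pickle i < N)%N -> `|p i - f i| < N.+1%:R^-1].
  have : \forall f \near (p : X),
      forall k : 'I_N, forall i, unpickle k = Some i -> `|p i - f i| < N.+1%:R^-1.
    apply: (@filter_forall X 'I_N (fun k f => forall i, unpickle k = Some i ->
      `|p i - f i| < N.+1%:R^-1) _ (nbhs_filter p)) => k.
    case: (unpickle k) => [i|]; last by apply: filterE.
    have bp : nbhs (p i : R) (ball (p i : R) N.+1%:R^-1).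
      by apply: nbhsx_ballx; rewrite invr_gt0 ltr0n.
    have := @proj_continuous I (fun _ => R) i p _ bp.
    apply: (@filterS _ _ (nbhs_filter p)) => f fi j [<-]; exact: fi.
  apply: (@filterS _ _ (nbhs_filter p)) => f fk i iN; apply: (fk (Ordinal iN)); exact: pickleK.
have ex N M : exists n, (M <= n)%N /\
    forall i, (pickle i < N)%N -> `|p i - w i n| < N.+1%:R^-1.
  have xM : (x @ \oo) (x @` [set n | (M <= n)%N]) by exists M => // n /= Mn; exists n.
  have [_ [[n /= Mn <-] xn]] := px _ _ xM (pnear N).
  by exists n.
pose g N := projT1 (choice (ex N)); have gP N M := projT2 (choice (ex N)) M.
(* Each index is sought beyond the previous one, which makes s strictly increasing. *)
pose s := fix s n := if n is m.+1 then g n (s m).+1 else g 0%N 0%N.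
have sS n : (s n < s n.+1)%N by have [] := gP n.+1 (s n).+1.
have sP n i : (pickle i < n)%N -> `|p i - w i (s n)| < n.+1%:R^-1.
  by case: n => // n; have [_ +] := gP n.+1 (s n).+1; apply.
exists s; split.
  by apply: homo_ltn => // ? ? ?; exact: ltn_trans.
move=> i; apply/cvg_ex; exists (p i); apply/cvgrPdist_lt => e e0.
near=> n.
have ni : (pickle i < n)%N by near: n; exact: nbhs_infty_gt.
apply: (lt_trans (sP _ _ ni)).
by near: n; exact: near_infty_natSinv_lt (PosNum e0).
Unshelve. all: end_near. Qed.
End diagonal.

(** * Real square-integrable functions and the real form [Kr] of the operator *)

Section square_integrable.
Variable R : realType.
Local Notation m := (@m_meas R).
Implicit Types (a b : R -> R) (s t : R).

Definition sqint a := measurable_fun (@Rpos R) a /\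
  m.-integrable (@Rpos R) (EFin \o (fun t => a t ^+ 2)).

Let mR := @measurable_Rpos R.

Lemma sqintM_integrable a b : sqint a -> sqint b ->
  m.-integrable (@Rpos R) (EFin \o (fun t => a t * b t)).
Proof.
move=> [ma ia] [mb ib]; apply: (le_integrable mR _ _ (integrableD mR ia ib)).
  by apply/measurable_EFinP; exact: measurable_funM.
move=> t _; rewrite lee_fin/= [leRHS]ger0_norm; last by rewrite addr_ge0// sqr_ge0.
by rewrite ler_norml; apply/andP; split; nra.
Qed.

Lemma sqintD a b c : sqint a -> sqint b -> sqint (fun t => c * a t + b t).
Proof.
move=> [ma ia] [mb ib].
have mab : measurable_fun (@Rpos R) (fun t => c * a t + b t).
  by apply: measurable_funD => //; exact: measurable_funM.
split=> //; apply: (le_integrable mR _ _ (integrableD mR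
  (integrableZl mR (2 * c ^+ 2) ia) (integrableZl mR 2 ib))).
  by apply/measurable_EFinP; exact: measurable_funX.
move=> t _; rewrite lee_fin/= !ger0_norm ?sqr_ge0//.
  by have := sqr_ge0 (c * a t - b t); nra.
by rewrite addr_ge0// mulr_ge0 ?sqr_ge0// mulr_ge0// sqr_ge0.
Qed.

(** Squaring doubles the exponent, and growth e^(2 c t) with 2 c < 1 is integrable for m; this is
    the origin of the abscissa -1/2 in [half_plane]. *)
Lemma sqint_dominated a (C c : R) : c < 2^-1 -> measurable_fun (@Rpos R) a ->
  (forall t, 0 < t -> `|a t| <= C * expR (c * t)) -> sqint a.
Proof.
move=> c1 ma aC; split=> //.
apply: (@m_integrable_dominated _ _ (C ^+ 2) (2 * c) 0).
- by lra.
- exact: measurable_funX.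
- move=> t t0; rewrite normrX expr0 mulr1.
  have -> : 2 * c * t = 2%:R * (c * t) by ring.
  by rewrite expRM_natl -exprMn lerXn2r ?nnegrE ?aC// (le_trans _ (aC _ t0)).
Qed.

Lemma sqint_bounded a (C : R) : measurable_fun (@Rpos R) a ->
  (forall t, 0 < t -> `|a t| <= C) -> sqint a.
Proof.
move=> ma aC; apply: (@sqint_dominated _ C 0) => //.
by move=> t t0; rewrite mul0r expR0 mulr1 aC.
Qed.

Lemma sqint_integrable a : sqint a -> m.-integrable (@Rpos R) (EFin \o a).
Proof.
move=> ia; have i1 : sqint (cst 1) by apply: (@sqint_bounded _ 1) => // t _; rewrite normr1.
have := sqintM_integrable ia i1.
by apply: eq_integrable => // t _; rewrite /= mulr1.
Qed.

Definition mass : R := \int[m]_(t in @Rpos R) 1.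

Lemma mass_ge0 : 0 <= mass.
Proof. exact: Rintegral_ge0. Qed.

(** Cauchy-Schwarz against the constant 1, from the integral of (|a| - l)^2 being nonnegative.
    Writing [mass + 1] makes the denominator of l visibly positive. *)
Lemma sqr_norm1_le_sqint a : sqint a ->
  (\int[m]_(t in @Rpos R) `|a t|) ^+ 2 <= (mass + 1) * \int[m]_(t in @Rpos R) (a t ^+ 2).
Proof.
move=> ia; have ia1 := integrable_norm (sqint_integrable ia).
have i1 : m.-integrable (@Rpos R) (EFin \o cst 1).
  by apply: sqint_integrable; apply: (@sqint_bounded _ 1) => // t _; rewrite normr1.
have [_ ia2] := ia.
set A := \int[m]_(t in @Rpos R) (a t ^+ 2).
set B := \int[m]_(t in @Rpos R) `|a t|.
pose l := B / (mass + 1); have M1 : 0 < mass + 1 by rewrite ltr_wpDl// mass_ge0.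
have : 0 <= A - 2 * l * B + l ^+ 2 * mass.
  have -> : A - 2 * l * B + l ^+ 2 * mass =
     \int[m]_(t in @Rpos R) (a t ^+ 2 - 2 * l * `|a t| + l ^+ 2 * 1).
    rewrite RintegralD//; last 2 first.
    - exact: (integrableB mR ia2 (integrableZl mR (2 * l) ia1)).
    - exact: (integrableZl mR (l ^+ 2) i1).
    rewrite RintegralB//; last exact: (integrableZl mR (2 * l) ia1).
    by rewrite !RintegralZl.
  apply: Rintegral_ge0 => t _; rewrite -(real_normK (num_real (a t))).
  have -> : `|a t| ^+ 2 - 2 * l * `|a t| + l ^+ 2 * 1 = (`|a t| - l) ^+ 2 by ring.
  exact: sqr_ge0.
have lB : l * (mass + 1) = B by rewrite /l divfK// lt0r_neq0.
by rewrite -lB; have := sqr_ge0 l; nra.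
Qed.

Definition Kr a t := \int[m]_(s in @Rpos R) (bfun 1 (s * t) * a s).

Lemma measurable_bfunM t : measurable_fun (@Rpos R) (fun s => bfun 1 (s * t)).
Proof.
apply: measurable_funTS; apply: continuous_measurable_fun => s.
apply: continuous_comp; last exact: continuous_bfun.
by apply: cvgM; [exact: cvg_id|exact: cvg_cst].
Qed.

Lemma bfun1_le1 x : 0 <= x -> `|bfun 1 x| <= 1 :> R.
Proof. by move=> x0; have := bfun_le 1 x0; rewrite invr1. Qed.

Lemma Kr_integrable a t : 0 < t -> m.-integrable (@Rpos R) (EFin \o a) ->
  m.-integrable (@Rpos R) (EFin \o (fun s => bfun 1 (s * t) * a s)).
Proof.
move=> t0 ia; have ma : measurable_fun (@Rpos R) a.
  by case/integrableP : ia => /measurable_EFinP.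
apply: (le_integrable mR _ _ ia).
  apply/measurable_EFinP; apply: measurable_funM => //; exact: measurable_bfunM.
move=> s /RposE s0; rewrite lee_fin/= normrM ler_piMl// bfun1_le1//.
by rewrite mulr_ge0// ltW.
Qed.

Lemma Kr_le a t : 0 < t -> m.-integrable (@Rpos R) (EFin \o a) ->
  `|Kr a t| <= \int[m]_(s in @Rpos R) `|a s|.
Proof.
move=> t0 ia; have iK := Kr_integrable t0 ia.
apply: (le_trans (le_normr_Rintegral mR iK)); apply: le_Rintegral => //.
- exact: (integrable_norm iK).
- exact: (integrable_norm ia).
- move=> s /RposE s0; rewrite normrM ler_piMl// bfun1_le1//.
  by rewrite mulr_ge0// ltW.
Qed.

(** From t <= 4 e^(t / 4), the exponent 1/4 being below the threshold 1/2. *)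
Lemma sqint_id : sqint id.
Proof.
apply: (@sqint_dominated _ 4 4^-1); [lra|exact: measurable_id|].
move=> t t0; have q0 : 0 < 4^-1 :> R by rewrite invr_gt0.
have := expr_le_expR 1 (ltW t0) q0.
by rewrite !expr1 invrK (_ : 1`! = 1%N)// mul1r ger0_norm// ltW.
Qed.

(** The Lipschitz bound on [bfun 1] leaves |t - t'| times the integral of s |a(s)|, and s |a| <= s^2
    + a^2. The constant depends on a only through its norm, so bounded families are
    equicontinuous. *)
Lemma Kr_lipschitz a t t' : 0 < t -> 0 < t' -> sqint a ->
  `|Kr a t - Kr a t'| <=
  `|t - t'| * (\int[m]_(s in @Rpos R) (s ^+ 2) + \int[m]_(s in @Rpos R) (a s ^+ 2)).
Proof.
move=> t0 t'0 sa; have ia := sqint_integrable sa.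
have [i1 i2] := (Kr_integrable t0 ia, Kr_integrable t'0 ia).
have [[_ j1] [_ j2]] := (sqint_id, sa).
rewrite /Kr -RintegralB// -RintegralD// -RintegralZl//; last exact: (integrableD mR j1 j2).
apply: (le_trans (le_normr_Rintegral mR (integrableB mR i1 i2))).
apply: le_Rintegral => //.
- exact: (integrable_norm (integrableB mR i1 i2)).
- exact: (integrableZl mR `|t - t'| (integrableD mR j1 j2)).
move=> s /RposE s0; rewrite -mulrBl normrM.
have st0 : 0 <= s * t by rewrite mulr_ge0// ltW.
have st'0 : 0 <= s * t' by rewrite mulr_ge0// ltW.
apply: (le_trans (ler_wpM2r (normr_ge0 _) (bfun_lipschitz 1 st0 st'0))).
rewrite -mulrBr normrM (gtr0_norm s0) [s * _]mulrC -mulrA ler_wpM2l//.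
by rewrite -(real_normK (num_real (a s))); have := normr_ge0 (a s); nra.
Qed.

Lemma measurable_Kr a : sqint a -> measurable_fun (@Rpos R) (Kr a).
Proof.
move=> sa; apply: open_continuous_measurable_fun; first exact: interval_open.
move=> t /set_mem/RposE t0.
pose L := \int[m]_(s in @Rpos R) (s ^+ 2) + \int[m]_(s in @Rpos R) (a s ^+ 2).
have L0 : 0 <= L by rewrite addr_ge0// Rintegral_ge0// => s _; exact: sqr_ge0.
apply/cvgrPdist_le => e e0; near=> t'.
have t'0 : 0 < t' by near: t'; exact: lt_nbhsr.
apply: (le_trans (Kr_lipschitz t0 t'0 sa)).
have : `|t - t'| <= e / (L + 1).
  by near: t'; apply: cvgr_dist_le; [exact: cvg_id|rewrite divr_gt0// ltr_wpDl].
rewrite ler_pdivlMr ?ltr_wpDl//; apply: le_trans.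
by rewrite ler_wpM2l// lerDl.
Unshelve. all: end_near. Qed.

End square_integrable.

Section Kr_compact.
Local Open Scope complex_scope.
Variable R : realType.
Local Notation m := (@m_meas R).

(** The Arzela-Ascoli argument: extraction at the positive rationals, then a common Lipschitz
    constant carries convergence to every t > 0. The index i lets several families share one
    subsequence. *)
Lemma Kr_subsequence (I : countType) (a : I -> nat -> R -> R) (c : R) :
  (forall i n, sqint (a i n)) ->
  (forall i n, \int[m]_(t in @Rpos R) (a i n t ^+ 2) <= c) ->
  exists s : nat -> nat, {homo s : i j / (i < j)%N} /\
    forall i t, 0 < t -> cvgn (fun n => Kr (a i (s n)) t).
Proof.
move=> sa ac.
pose w (iq : I * rat) n := if 0 < ratr iq.2 :> R then Kr (a iq.1 n) (ratr iq.2) else 0.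
have wB iq n : `|w iq n| <= (mass R + 1) * `|c| + 1.
  have c0 : 0 <= (mass R + 1) * `|c| by rewrite mulr_ge0// addr_ge0// mass_ge0.
  rewrite /w; case: ifPn => [q0|_]; last by rewrite normr0 addr_ge0.
  have saq := sa iq.1 n.
  apply: (le_trans (Kr_le q0 (sqint_integrable saq))).
  have := sqr_norm1_le_sqint saq.
  have : (mass R + 1) * \int[m]_(t in @Rpos R) (a iq.1 n t ^+ 2) <= (mass R + 1) * `|c|.
    by rewrite ler_wpM2l ?addr_ge0 ?mass_ge0// (le_trans (ac _ _))// ler_norm.
  set x := \int[m]_(t in _) `|_|; set y := _ * `|c|; move=> h1 h2.
  (* x <= y + 1 follows from x^2 <= y, as 2 x <= x^2 + 1. *)
  by have := sqr_ge0 (x - 1); nra.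
have [s [hs cs]] := diagonal_subsequence wB; exists s; split=> // i t t0.
pose L := \int[m]_(s in @Rpos R) (s ^+ 2) + `|c|.
have L0 : 0 < L + 1.
  by rewrite ltr_wpDl// addr_ge0// Rintegral_ge0// => x _; exact: sqr_ge0.
apply: cauchy_cvg; apply: cauchy_exP => e e0.
(* A rational so close to t that the Lipschitz constant, at most L + 1, costs no more than e / 2. *)
have [q] := @rat_in_itvoo R t (t + e / 2 / (L + 1)) (ltac:(by rewrite ltrDl !divr_gt0)).
rewrite in_itv/= => /andP[tq qt]; have q0 : 0 < ratr q :> R by exact: lt_trans tq.
have := cs (i, q); rewrite /w/= q0 => cq.
exists (limn (fun n => Kr (a i (s n)) (ratr q))).
have e20 : 0 < e / 2 by rewrite divr_gt0.
move/cvgrPdist_lt : cq => /(_ _ e20); apply: filterS => n nq.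
rewrite /ball/= (splitr e).
rewrite -(subrKA (Kr (a i (s n)) (ratr q))).
apply: (le_lt_trans (ler_normD _ _)); rewrite ltr_leD//.
apply: (le_trans (Kr_lipschitz q0 t0 (sa i (s n)))).
rewrite (gtr0_norm (_ : 0 < ratr q - t)) ?subr_gt0//.
have h1 : \int[m]_(s in @Rpos R) (s ^+ 2) + \int[m]_(s0 in @Rpos R) (a i (s n) s0 ^+ 2) <= L + 1.
  by rewrite -addrA lerD2l (le_trans (ac i (s n)))// (le_trans (ler_norm _))// lerDl.
have dq : 0 <= ratr q - t by rewrite subr_ge0 ltW.
apply: (le_trans (ler_wpM2l dq h1)).
by rewrite -ler_pdivlMr// lerBlDl ltW.
Qed.
End Kr_compact.

(** * [K_op] followed by a bounded multiplier on L_2(m): linearity, bounds, compactness *)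

Section L2.
Local Open Scope complex_scope.
Variable R : realType.
Local Notation m := (@m_meas R).
Local Notation C := (R[i]^o).
Local Notation L2 := (L2m R).
Implicit Types (f g phi : R -> C) (t : R).

(** The squared modulus as a real number; the norm on [R[i]] takes its values in [R[i]]. *)
Definition sqn (z : C) : R := complex.Re z ^+ 2 + complex.Im z ^+ 2.

Lemma sqnM (z w : C) : sqn (z * w) = sqn z * sqn w.
Proof. by case: z w => [a b] [c d]; rewrite /sqn/=; ring. Qed.

Lemma sqn_ge0 (z : C) : 0 <= sqn z.
Proof. by rewrite addr_ge0// sqr_ge0. Qed.

Definition nsq f : R := \int[m]_(t in @Rpos R) sqn (f t).

Lemma nsq_ge0 f : 0 <= nsq f.
Proof. by apply: Rintegral_ge0 => t _; exact: sqn_ge0. Qed.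

Lemma hnormE f : hnorm L2 f = Num.sqrt (nsq f).
Proof.
rewrite /hnorm /L2m /cintegral /nsq /=; congr (Num.sqrt _).
by apply: eq_Rintegral => t _; case: (f t) => a b; rewrite /sqn/=; ring.
Qed.

Definition ReF f t := complex.Re (f t).
Definition ImF f t := complex.Im (f t).

Lemma hcarP f : hcar L2 f <-> sqint (ReF f) /\ sqint (ImF f).
Proof.
have mR := @measurable_Rpos R.
split.
- move=> [mr mi fi].
  have ig : m.-integrable (@Rpos R) (fun t => (ReF f t ^+ 2 + ImF f t ^+ 2)%:E).
    apply/integrableP; split.
      by apply/measurable_EFinP; apply: measurable_funD; exact: measurable_funX.
    rewrite (eq_integral (fun t => (ReF f t ^+ 2 + ImF f t ^+ 2)%:E))// => t _.
    by rewrite gee0_abs// lee_fin addr_ge0// sqr_ge0.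
  split; split=> //; apply: (le_integrable mR _ _ ig).
  + by apply/measurable_EFinP; exact: measurable_funX.
  + move=> t _; rewrite lee_fin/= !ger0_norm ?sqr_ge0 ?addr_ge0 ?sqr_ge0//.
    by rewrite lerDl sqr_ge0.
  + by apply/measurable_EFinP; exact: measurable_funX.
  + move=> t _; rewrite lee_fin/= !ger0_norm ?sqr_ge0 ?addr_ge0 ?sqr_ge0//.
    by rewrite lerDr sqr_ge0.
- move=> [[mr ir] [mi ii]]; split=> //.
  have /integrableP[_] := integrableD mR ir ii; apply: le_lt_trans.
  apply: ge0_le_integral => //.
  + by move=> t _; rewrite lee_fin addr_ge0// sqr_ge0.
  + by apply/measurable_EFinP; apply: measurable_funD; exact: measurable_funX.
  + apply: measurableT_comp => //; apply/measurable_EFinP.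
    by apply: measurable_funD; exact: measurable_funX.
  + by move=> t _; rewrite lee_fin/= ler_norm.
Qed.

Lemma sqn_integrable f : hcar L2 f -> m.-integrable (@Rpos R) (EFin \o (fun t => sqn (f t))).
Proof.
by move=> /hcarP[[_ ir] [_ ii]]; exact: (integrableD (@measurable_Rpos R) ir ii).
Qed.

Lemma hcar_bounded f (B : R) : measurable_fun (@Rpos R) (ReF f) ->
  measurable_fun (@Rpos R) (ImF f) -> (forall t, 0 < t -> sqn (f t) <= B) -> hcar L2 f.
Proof.
move=> mr mi fB; apply/hcarP.
have B0 : 0 <= B by apply: le_trans (fB 1 ltr01); exact: sqn_ge0.
split; apply: (@sqint_bounded _ _ (Num.sqrt B)) => // t t0;
  rewrite -(@ler_pXn2r _ 2) ?nnegrE ?sqrtr_ge0// sqr_sqrtr// real_normK ?num_real//;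
  apply: (le_trans _ (fB t t0)); rewrite /sqn.
  by rewrite lerDl sqr_ge0.
by rewrite lerDr sqr_ge0.
Qed.

Lemma K_opE phi t : 0 < t -> K_op phi t = Kr (ReF phi) t +i* Kr (ImF phi) t.
Proof.
move=> t0; rewrite /K_op /cintegral /Kr.
congr (_ +i* _); apply: eq_Rintegral => s /set_mem/RposE s0;
  rewrite bessel_J1E ?mulr_gt0// /ReF /ImF; case: (phi s) => a b /=; ring.
Qed.

Lemma nsqE phi : hcar L2 phi -> nsq phi =
  \int[m]_(t in @Rpos R) (ReF phi t ^+ 2) + \int[m]_(t in @Rpos R) (ImF phi t ^+ 2).
Proof.
by move=> /hcarP[[_ ir] [_ ii]]; rewrite /nsq -RintegralD//; exact: measurable_Rpos.
Qed.

(** [K_op] sends L_2(m) into bounded functions; both the operator bound and the domination in the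
    compactness proof rest on this. *)
Lemma sqn_K_op_le phi t : hcar L2 phi -> 0 < t ->
  sqn (K_op phi t) <= (mass R + 1) * nsq phi.
Proof.
move=> Hphi t0; rewrite K_opE// nsqE// /sqn/= mulrDr.
move/hcarP : Hphi => [sr si].
have aux a : sqint a -> Kr a t ^+ 2 <= (mass R + 1) * \int[m]_(t in @Rpos R) (a t ^+ 2).
  move=> sa; apply: (le_trans _ (sqr_norm1_le_sqint sa)).
  rewrite -(real_normK (num_real _)) lerXn2r ?nnegrE//.
    by apply: Rintegral_ge0 => s _.
  exact: Kr_le (sqint_integrable sa).
by rewrite lerD// aux.
Qed.

Lemma measurable_K_op phi : hcar L2 phi ->
  measurable_fun (@Rpos R) (ReF (K_op phi)) /\ measurable_fun (@Rpos R) (ImF (K_op phi)).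
Proof.
move=> /hcarP[sr si]; split.
  apply: (eq_measurable_fun (Kr (ReF phi))); last exact: measurable_Kr.
  by move=> t /set_mem/RposE t0; rewrite /ReF K_opE.
apply: (eq_measurable_fun (Kr (ImF phi))); last exact: measurable_Kr.
by move=> t /set_mem/RposE t0; rewrite /ImF K_opE.
Qed.

(* Multiplication by a bounded function after [K_op]; for [c] equal to
   [z (1 - e^-t) / (1 - z e^-t)] this is [Kz_op z]. *)
Definition mulK (c : R -> C) phi : R -> C := fun t => c t * K_op phi t.

(** B bounds the squared modulus, whence the hypotheses with [B ^+ 2] below. *)
Definition bdd_multiplier (c : R -> C) (B : R) := [/\ measurable_fun (@Rpos R) (ReF c),
  measurable_fun (@Rpos R) (ImF c) & forall t, 0 < t -> sqn (c t) <= B].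

Lemma measurable_cmul f g : measurable_fun (@Rpos R) (ReF f) -> measurable_fun (@Rpos R) (ImF f) ->
  measurable_fun (@Rpos R) (ReF g) -> measurable_fun (@Rpos R) (ImF g) ->
  measurable_fun (@Rpos R) (ReF (fun t => f t * g t)) /\
  measurable_fun (@Rpos R) (ImF (fun t => f t * g t)).
Proof.
move=> rf jf rg jg; split.
  have -> : ReF (fun t => f t * g t) = (fun t => ReF f t * ReF g t - ImF f t * ImF g t).
    by apply/funext => t; rewrite /ReF /ImF; case: (f t) (g t) => [a b] [c d].
  by apply: measurable_funB; exact: measurable_funM.
have -> : ImF (fun t => f t * g t) = (fun t => ReF f t * ImF g t + ImF f t * ReF g t).
  by apply/funext => t; rewrite /ReF /ImF; case: (f t) (g t) => [a b] [c d].
by apply: measurable_funD; exact: measurable_funM.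
Qed.

Lemma hcar_mulK (c : R -> C) (B : R) phi : bdd_multiplier c B -> hcar L2 phi ->
  hcar L2 (mulK c phi).
Proof.
move=> [rc jc cB] Hphi; have [rK jK] := measurable_K_op Hphi.
have [rm jm] := measurable_cmul rc jc rK jK.
apply: (@hcar_bounded _ (B * ((mass R + 1) * nsq phi))) => // t t0.
by rewrite sqnM ler_pM ?sqn_ge0// ?cB// sqn_K_op_le.
Qed.

(** The pointwise bound is integrated over the finite measure m; enlarging [mass] to [mass + 1]
    makes the constant a perfect square. *)
Lemma hnorm_mulK_le (c : R -> C) (B : R) phi : 0 <= B -> bdd_multiplier c (B ^+ 2) -> hcar L2 phi ->
  hnorm L2 (mulK c phi) <= B * (mass R + 1) * hnorm L2 phi.
Proof.
move=> B0 cB Hphi; rewrite !hnormE.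
have M0 := mass_ge0 R; have M1 : 0 <= mass R + 1 by rewrite addr_ge0.
rewrite -(@ler_pXn2r _ 2) ?nnegrE ?sqrtr_ge0 ?mulr_ge0 ?sqrtr_ge0//.
rewrite sqr_sqrtr ?nsq_ge0// exprMn sqr_sqrtr ?nsq_ge0//.
have i1 : m.-integrable (@Rpos R) (EFin \o cst 1).
  by apply: sqint_integrable; apply: (@sqint_bounded _ _ 1) => // t _; rewrite normr1.
apply: (@le_trans _ _ (\int[m]_(t in @Rpos R) (B ^+ 2 * ((mass R + 1) * nsq phi) * 1))).
  apply: le_Rintegral.
  - exact: measurable_Rpos.
  - exact: sqn_integrable (hcar_mulK cB Hphi).
  - exact: (integrableZl (@measurable_Rpos R) _ i1).
  move=> t /RposE t0; rewrite mulr1 sqnM; case: cB => _ _ cB.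
  by rewrite ler_pM ?sqn_ge0// ?cB// sqn_K_op_le.
rewrite RintegralZl//; last exact: measurable_Rpos.
rewrite -/(mass R).
have -> : (B * (mass R + 1)) ^+ 2 * nsq phi =
  B ^+ 2 * ((mass R + 1) * nsq phi) * (mass R + 1) by ring.
rewrite ler_wpM2l ?lerDl//; apply: mulr_ge0; first exact: sqr_ge0.
by rewrite mulr_ge0// nsq_ge0.
Qed.

Lemma cintegral_linear (a : C) f g :
  m.-integrable (@Rpos R) (EFin \o ReF f) -> m.-integrable (@Rpos R) (EFin \o ImF f) ->
  m.-integrable (@Rpos R) (EFin \o ReF g) -> m.-integrable (@Rpos R) (EFin \o ImF g) ->
  cintegral (fun t => a * f t + g t) = a * cintegral f + cintegral g.
Proof.
have mR := @measurable_Rpos R.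
move=> rf jf rg jg; case: a => a b.
rewrite /cintegral; set x := \int[m]_(t in _) _; set y := \int[m]_(t in _) _.
have -> : x = (a * \int[m]_(t in @Rpos R) ReF f t - b * \int[m]_(t in @Rpos R) ImF f t)
      + \int[m]_(t in @Rpos R) ReF g t.
  have i1 := integrableZl mR a rf; have i2 := integrableZl mR b jf.
  rewrite -!RintegralZl// -RintegralB// -RintegralD//; last exact: (integrableB mR i1 i2).
  apply: eq_Rintegral => t _; rewrite /ReF /ImF.
  by case: (f t) (g t) => [u1 u2] [v1 v2].
have -> : y = (a * \int[m]_(t in @Rpos R) ImF f t + b * \int[m]_(t in @Rpos R) ReF f t)
      + \int[m]_(t in @Rpos R) ImF g t.
  have i1 := integrableZl mR a jf; have i2 := integrableZl mR b rf.
  rewrite -!RintegralZl// -RintegralD// -RintegralD//; last exact: (integrableD mR i1 i2).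
  apply: eq_Rintegral => t _; rewrite /ReF /ImF.
  by case: (f t) (g t) => [u1 u2] [v1 v2].
by [].
Qed.

Lemma hcar_linear (a : C) f g : hcar L2 f -> hcar L2 g -> hcar L2 (a *: f + g).
Proof.
move=> /hcarP[rf jf] /hcarP[rg jg]; apply/hcarP; case: a => a b; split.
  have := sqintD a rf (sqintD (- b) jf rg).
  congr sqint; apply/funext => t; rewrite /ReF /ImF.
  rewrite !fctE /GRing.scale/=; case: (f t) (g t) => [u1 u2] [v1 v2] /=; ring.
have := sqintD a jf (sqintD b rf jg).
congr sqint; apply/funext => t; rewrite /ReF /ImF.
rewrite !fctE /GRing.scale/=; case: (f t) (g t) => [u1 u2] [v1 v2] /=; ring.
Qed.

Lemma Kr_linear (c d t : R) (a b e : R -> R) : 0 < t ->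
  sqint a -> sqint b -> sqint e ->
  Kr (fun s => c * a s + (d * b s + e s)) t = c * Kr a t + (d * Kr b t + Kr e t).
Proof.
move=> t0 sa sb se; have mR := @measurable_Rpos R.
have ia := Kr_integrable t0 (sqint_integrable sa).
have ib := Kr_integrable t0 (sqint_integrable sb).
have ie := Kr_integrable t0 (sqint_integrable se).
have ja := integrableZl mR c ia; have jb := integrableZl mR d ib.
rewrite /Kr -!RintegralZl// -RintegralD// -RintegralD//; last exact: (integrableD mR jb ie).
by apply: eq_Rintegral => s _; ring.
Qed.

Lemma ReF_linear (a : C) f g : ReF (a *: f + g) =
  (fun t => complex.Re a * ReF f t + (- complex.Im a * ImF f t + ReF g t)).
Proof.
apply/funext => t; rewrite /ReF /ImF !fctE /GRing.scale/=.
by case: a (f t) (g t) => [a b] [u1 u2] [v1 v2] /=; ring.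
Qed.

Lemma ImF_linear (a : C) f g : ImF (a *: f + g) =
  (fun t => complex.Re a * ImF f t + (complex.Im a * ReF f t + ImF g t)).
Proof.
apply/funext => t; rewrite /ReF /ImF !fctE /GRing.scale/=.
by case: a (f t) (g t) => [a b] [u1 u2] [v1 v2] /=; ring.
Qed.

Lemma K_op_linear (a : C) f g t : hcar L2 f -> hcar L2 g -> 0 < t ->
  K_op (a *: f + g) t = a * K_op f t + K_op g t.
Proof.
move=> /hcarP[rf jf] /hcarP[rg jg] t0.
rewrite !K_opE// ReF_linear ImF_linear !Kr_linear//; case: a => a b.
by apply/eqP; rewrite eq_complex /=; apply/andP; split; apply/eqP; ring.
Qed.

Lemma hnorm_eq0 f : (forall t, 0 < t -> f t = 0) -> hnorm L2 f = 0.
Proof.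
move=> f0; rewrite hnormE (_ : nsq f = 0) ?sqrtr0//.
transitivity (\int[m]_(t in @Rpos R) (0 : R)); last by rewrite /Rintegral integral0.
by apply: eq_Rintegral => t /set_mem/RposE t0; rewrite f0// /sqn/= expr0n addr0.
Qed.

Lemma mulK_linear (c : R -> C) (a : C) f g t : hcar L2 f -> hcar L2 g -> 0 < t ->
  mulK c (a *: f + g) t = a * mulK c f t + mulK c g t.
Proof.
move=> Hf Hg t0; rewrite /mulK K_op_linear// mulrDr; congr (_ + _).
exact: mulrCA.
Qed.

Lemma bounded_mulK (c : R -> C) (B : R) : 0 <= B -> bdd_multiplier c (B ^+ 2) ->
  bounded_operator L2 (mulK c).
Proof.
move=> B0 cB; split.
- by move=> f; exact: (hcar_mulK cB).
- move=> a f g Hf Hg; apply: hnorm_eq0 => t t0.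
  rewrite -[LHS]/(mulK c (a *: f + g) t - (a * mulK c f t + mulK c g t)).
  by rewrite mulK_linear// subrr.
- by exists (B * (mass R + 1)) => f Hf; exact: hnorm_mulK_le.
Qed.

(** Along the subsequence the functions [K_op (u (s n))] have a pointwise limit v and a common bound
    D, so dominated convergence on the finite measure m gives convergence in norm to c v. *)
Lemma compact_mulK (c : R -> C) (B : R) : 0 <= B -> bdd_multiplier c (B ^+ 2) ->
  compact_operator L2 (mulK c).
Proof.
move=> B0 cB; split; first exact: (bounded_mulK B0 cB).
move=> u Hu [d ud].
have nu n : nsq (u n) <= d ^+ 2.
  rewrite -[nsq _]sqr_sqrtr ?nsq_ge0// -hnormE lerXn2r ?nnegrE ?ud//.
    by rewrite sqrtr_ge0.
  by apply: le_trans (ud n); rewrite sqrtr_ge0.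
(* Real and imaginary parts are indexed by a boolean, so that one subsequence serves both. *)
pose a (b : bool) n := if b then ReF (u n) else ImF (u n).
have sa b n : sqint (a b n) by have [? ?] := (hcarP (u n)).1 (Hu n); case: b.
have ad b n : \int[m]_(t in @Rpos R) (a b n t ^+ 2) <= d ^+ 2.
  apply: (le_trans _ (nu n)); rewrite nsqE//; case: b => /=.
    by rewrite lerDl Rintegral_ge0// => t _; exact: sqr_ge0.
  by rewrite lerDr Rintegral_ge0// => t _; exact: sqr_ge0.
have [s [hs cs]] := Kr_subsequence sa ad.
pose v t : C := limn (fun n => Kr (a true (s n)) t) +i* limn (fun n => Kr (a false (s n)) t).
pose g t : C := c t * v t.
exists s, g.
have KE n t : 0 < t -> K_op (u (s n)) t = Kr (a true (s n)) t +i* Kr (a false (s n)) t.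
  by move=> t0; rewrite K_opE.
pose D := (mass R + 1) * d ^+ 2.
have KD n t : 0 < t -> sqn (K_op (u (s n)) t) <= D.
  move=> t0; apply: (le_trans (sqn_K_op_le (Hu (s n)) t0)).
  by rewrite ler_wpM2l// addr_ge0// mass_ge0.
have K_cvg b t : 0 < t ->
    Kr (a b (s n)) t @[n --> \oo] --> limn (fun n => Kr (a b (s n)) t) by exact: cs.
have Kv_cvg t : 0 < t -> sqn (K_op (u (s n)) t - v t) @[n --> \oo] --> 0.
  move=> t0; under eq_fun do rewrite KE//.
  rewrite /sqn/= /v/= (_ : 0 = 0 ^+ 2 + 0 ^+ 2 :> R); last by rewrite expr0n addr0.
  have c0 b : Kr (a b (s n)) t - limn (fun n => Kr (a b (s n)) t) @[n --> \oo] --> 0.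
    rewrite -[X in _ --> X](subrr (limn (fun n => Kr (a b (s n)) t))).
    by apply: cvgB; [exact: K_cvg|exact: cvg_cst].
  exact: (cvgD (cvgM (c0 true) (c0 true)) (cvgM (c0 false) (c0 false))).
have vD t : 0 < t -> sqn (v t) <= D.
  move=> t0; have : sqn (K_op (u (s n)) t) @[n --> \oo] --> sqn (v t).
    under eq_fun do rewrite KE//.
    rewrite /sqn/= /v/=.
    exact: (cvgD (cvgM (K_cvg true t t0) (K_cvg true t t0))
       (cvgM (K_cvg false t t0) (K_cvg false t t0))).
  move/(@cvg_lim _ (@Rhausdorff R)) => e; rewrite -e; apply: limr_le.
  - rewrite /sqn; apply/cvg_ex; exists (sqn (v t)).
    under eq_fun do rewrite KE//.
    exact: (cvgD (cvgM (K_cvg true t t0) (K_cvg true t t0))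
       (cvgM (K_cvg false t t0) (K_cvg false t t0))).
  - by apply: nearW => n; exact: KD.
have mv b : measurable_fun (@Rpos R) (fun t => limn (fun n => Kr (a b (s n)) t)).
  apply: (measurable_fun_cvg (h := fun n : nat => Kr (a b (s n)))).
    by move=> n; exact: measurable_Kr.
  by move=> t /RposE t0; exact: K_cvg.
have [rc jc cB'] := cB.
have [rg jg] := @measurable_cmul c v rc jc (mv true) (mv false).
have Hg : hcar L2 g.
  apply: (@hcar_bounded _ (B ^+ 2 * D)) => // t t0.
  by rewrite sqnM ler_pM ?sqn_ge0// ?cB'// vD.
split=> //.
have E n : hnorm L2 (mulK c (u (s n)) - g) =
      Num.sqrt (nsq (fun t => c t * (K_op (u (s n)) t - v t))).
  rewrite hnormE; congr (Num.sqrt (nsq _)); apply/funext => t.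
  by rewrite !fctE /mulK /g mulrBr.
rewrite (funext E) -[X in _ --> X]sqrtr0; apply: continuous_cvg; first exact: sqrt_continuous.
have i1 : m.-integrable (@Rpos R) (EFin \o cst 1).
  by apply: sqint_integrable; apply: (@sqint_bounded _ _ 1) => // t _; rewrite normr1.
have -> : 0 = \int[m]_(t in @Rpos R) (0 : R) by rewrite /Rintegral integral0.
(* 4 D comes from |p - q|^2 <= 2 |p|^2 + 2 |q|^2. *)
apply: (Rintegral_dominated_cvg (@measurable_Rpos R) _ _
  (integrableZl (@measurable_Rpos R) (B ^+ 2 * (4 * D)) i1)).
- move=> n; have [rK jK] := measurable_K_op (Hu (s n)).
  have [rm jm] := measurable_cmul rc jc rK jK.
  have -> : (fun t => sqn (c t * (K_op (u (s n)) t - v t))) =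
      (fun t => (ReF (mulK c (u (s n))) t - ReF g t) ^+ 2 +
                (ImF (mulK c (u (s n))) t - ImF g t) ^+ 2).
    apply/funext => t; rewrite mulrBr /sqn /ReF /ImF /mulK /g.
    by case: (c t * K_op _ t) (c t * v t) => [? ?] [? ?].
  by apply: measurable_funD; apply: measurable_funX; exact: measurable_funB.
- move=> t /RposE t0; rewrite (funext (fun n => sqnM _ _)).
  rewrite -[X in _ --> X](mulr0 (sqn (c t))); apply: cvgM; first exact: cvg_cst.
  exact: Kv_cvg.
- move=> t n /RposE t0; rewrite /= mulr1 ger0_norm ?sqn_ge0//.
  rewrite sqnM ler_pM ?sqn_ge0// ?cB'//.
  have := KD n t t0; have := vD t t0; rewrite /sqn.
  by case: (K_op _ t) (v t) => [x y] [x' y'] /=;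
    have := sqr_ge0 (x + x'); have := sqr_ge0 (y + y'); nra.
Qed.

End L2.

(** * The complex transform: injectivity, unitarity, independence of representatives *)

Section laplace_transform.
Local Open Scope complex_scope.
Variable R : realType.
Local Notation m := (@m_meas R).
Local Notation C := (R[i]^o).
Local Notation L2 := (L2m R).
Implicit Types (f g phi : R -> C) (t : R) (w : C).

Definition lexp w t : C := cexp (- (t%:C * w)).

Lemma lexpE w t : lexp w t =
  expcos (complex.Re w) (complex.Im w) t +i* expsin (complex.Re w) (complex.Im w) t.
Proof.
case: w => a b; rewrite /lexp /cexp /expcos /expsin/=.
have -> : - (t * a - 0 * b) = - a * t by ring.
have -> : - (t * b + 0 * a) = - (b * t) by ring.
by apply/eqP; rewrite cosN sinN eq_complex/= !mul0r subr0 addr0 mulrN !eqxx.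
Qed.

Lemma hcar_lexp w : half_plane w -> hcar L2 (lexp w).
Proof.
move=> hw; apply/hcarP; move: hw; rewrite /half_plane/=; case: w => a b /= hw.
have -> : ReF (lexp (a +i* b)) = expcos a b by apply/funext => t; rewrite /ReF lexpE.
have -> : ImF (lexp (a +i* b)) = expsin a b by apply/funext => t; rewrite /ImF lexpE.
split; apply: (@sqint_dominated _ _ 1 (- a)); try (by rewrite ltrNl).
- by apply: measurable_funTS; apply: continuous_measurable_fun; exact: continuous_expcos.
- by move=> t _; rewrite mul1r expcos_le.
- by apply: measurable_funTS; apply: continuous_measurable_fun; exact: continuous_expsin.
- by move=> t _; rewrite mul1r expsin_le.
Qed.

Definition cintegrable f := m.-integrable (@Rpos R) (EFin \o ReF f) /\
  m.-integrable (@Rpos R) (EFin \o ImF f).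

Lemma cintegrableM f g : hcar L2 f -> hcar L2 g -> cintegrable (fun t => f t * g t).
Proof.
move=> /hcarP[rf jf] /hcarP[rg jg]; have mR := @measurable_Rpos R.
have i1 := sqintM_integrable rf rg; have i2 := sqintM_integrable jf jg.
have i3 := sqintM_integrable rf jg; have i4 := sqintM_integrable jf rg.
split.
  apply: (eq_integrable mR _ _ _ (integrableB mR i1 i2)) => t _.
  by rewrite /= /ReF /ImF -EFinB; case: (f t) (g t) => [a b] [c d].
apply: (eq_integrable mR _ _ _ (integrableD mR i3 i4)) => t _.
by rewrite /= /ReF /ImF -EFinD; case: (f t) (g t) => [a b] [c d].
Qed.

Lemma laplaceE phi w : half_plane w -> laplace phi w = cintegral (fun t => lexp w t * phi t).
Proof. by move=> hw; rewrite /laplace patchE mem_set. Qed.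

Lemma laplace_out phi w : ~ half_plane w -> laplace phi w = 0.
Proof. by move=> hw; rewrite /laplace patchE memNset. Qed.

Lemma laplace_linear (a : C) f g : hcar L2 f -> hcar L2 g ->
  laplace (a *: f + g) = a *: laplace f + laplace g.
Proof.
move=> Hf Hg; apply/funext => w; have [hw|hw] := pselect (half_plane w); last first.
  by rewrite !fctE !laplace_out// scaler0 addr0.
rewrite !fctE !laplaceE//.
have [if1 if2] := cintegrableM (hcar_lexp hw) Hf.
have [ig1 ig2] := cintegrableM (hcar_lexp hw) Hg.
rewrite -[RHS]/(a * _ + _) -cintegral_linear//.
congr cintegral; apply/funext => t; rewrite -[a *: _]/(a * _).
by rewrite mulrDr mulrCA.
Qed.

Lemma hcar0 : hcar L2 (0 : R -> C).
Proof.
apply: (@hcar_bounded _ _ 0); rewrite ?/ReF ?/ImF//.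
by move=> t _; rewrite /sqn/= expr0n addr0.
Qed.

(** Real points w = s >= 0 suffice: there the exponential is real, so the real and imaginary parts
    of f each fall under [laplace0_ae_eq0]. *)
Lemma laplace_eq0_ae f : hcar L2 f -> laplace f = 0 ->
  {ae m, forall t, Rpos t -> f t = 0}.
Proof.
move=> Hf f0; have [rf jf] := (hcarP f).1 Hf.
have h s : 0 <= s -> half_plane (s%:C : C).
  by move=> s0; rewrite /half_plane/= (lt_le_trans _ s0)// oppr_lt0.
have lexpR s t : lexp s%:C t = (expR (- s * t))%:C.
  by rewrite lexpE /expcos /expsin/= mul0r cos0 sin0 mulr1 mulr0 oppr0.
have e s : 0 <= s -> cintegral (fun t => lexp s%:C t * f t) = 0.
  by move=> s0; rewrite -laplaceE ?f0//; exact: h.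
have r0 s : 0 <= s -> \int[m]_(t in @Rpos R) (expR (- s * t) * ReF f t) = 0.
  move=> s0; transitivity (complex.Re (cintegral (fun t => lexp s%:C t * f t))).
    2: by rewrite e.
  apply: eq_Rintegral => t _.
  by rewrite lexpR /ReF; case: (f t) => a b /=; rewrite mul0r subr0.
have j0 s : 0 <= s -> \int[m]_(t in @Rpos R) (expR (- s * t) * ImF f t) = 0.
  move=> s0; transitivity (complex.Im (cintegral (fun t => lexp s%:C t * f t))).
    2: by rewrite e.
  apply: eq_Rintegral => t _.
  by rewrite lexpR /ImF; case: (f t) => a b /=; rewrite mul0r addr0.
have := laplace0_ae_eq0 (sqint_integrable rf) r0.
have := laplace0_ae_eq0 (sqint_integrable jf) j0.
apply: filterS2 => t fi fr Rt; have := fi Rt; have := fr Rt; rewrite /ReF /ImF.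
by case: (f t) => a b /= -> ->.
Qed.

Lemma laplace_inj_ae f g : hcar L2 f -> hcar L2 g -> laplace f = laplace g ->
  {ae m, forall t, Rpos t -> f t = g t}.
Proof.
move=> Hf Hg fg; have Hd := hcar_linear (-1) Hg Hf.
have /(laplace_eq0_ae Hd) : laplace (-1 *: g + f) = 0.
  by rewrite laplace_linear// fg scaleN1r addNr.
apply: filterS => t h Rt; have := h Rt; rewrite !fctE => /eqP.
by rewrite -[_ *: _]/(-1 * g t) mulN1r addrC subr_eq0 => /eqP.
Qed.

Lemma cintegral_ae f g :
  measurable_fun (@Rpos R) (ReF f) -> measurable_fun (@Rpos R) (ImF f) ->
  measurable_fun (@Rpos R) (ReF g) -> measurable_fun (@Rpos R) (ImF g) ->
  {ae m, forall t, Rpos t -> f t = g t} -> cintegral f = cintegral g.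
Proof.
move=> rf jf rg jg fg; have mR := @measurable_Rpos R.
rewrite /cintegral /Rintegral; congr (fine _ +i* fine _); apply: ae_eq_integral => //;
  try (exact/measurable_EFinP); by move: fg; apply: filterS => t h /h ->.
Qed.

Lemma hcar_measurable f : hcar L2 f ->
  measurable_fun (@Rpos R) (ReF f) /\ measurable_fun (@Rpos R) (ImF f).
Proof. by case. Qed.

(** Equality at each t > 0 rather than almost everywhere, because t enters only through the
    kernel. *)
Lemma K_op_ae f g t : hcar L2 f -> hcar L2 g -> 0 < t ->
  {ae m, forall t, Rpos t -> f t = g t} -> K_op f t = K_op g t.
Proof.
move=> Hf Hg t0 fg; rewrite !K_opE//.
have [rf jf] := hcar_measurable Hf; have [rg jg] := hcar_measurable Hg.
have mR := @measurable_Rpos R; have mb := measurable_bfunM t.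
rewrite /Kr /Rintegral; congr (fine _ +i* fine _); apply: ae_eq_integral => //;
  try (by apply/measurable_EFinP; exact: measurable_funM);
  by move: fg; apply: filterS => s h /h; rewrite /ReF /ImF => ->.
Qed.

(** The default of [xget] never occurs, f itself being a witness. *)
Lemma laplace_invP f : hcar L2 f ->
  hcar L2 (laplace_inv (laplace f)) /\ laplace (laplace_inv (laplace f)) = laplace f.
Proof.
move=> Hf; rewrite /laplace_inv.
by case: xgetP => [phi _ []//|/(_ f)] /=; case; split.
Qed.

Lemma laplace_invK f : hcar L2 f ->
  {ae m, forall t, Rpos t -> laplace_inv (laplace f) t = f t}.
Proof. by move=> Hf; have [h1 h2] := laplace_invP Hf; exact: laplace_inj_ae. Qed.

Lemma measurable_conjM f g : hcar L2 f -> hcar L2 g ->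
  measurable_fun (@Rpos R) (ReF (fun t => (f t)^* * g t)) /\
  measurable_fun (@Rpos R) (ImF (fun t => (f t)^* * g t)).
Proof.
move=> /hcar_measurable[rf jf] /hcar_measurable[rg jg].
apply: (@measurable_cmul _ (fun t => (f t)^*)) => //.
  by apply: eq_measurable_fun rf => t _; rewrite /ReF; case: (f t).
apply: (eq_measurable_fun (fun t => - ImF f t)); last exact: measurable_funN.
by move=> t _; rewrite /ImF; case: (f t).
Qed.

Lemma hdot_H1 f g : hcar L2 f -> hcar L2 g ->
  hdot (H1 R) (laplace f) (laplace g) = hdot L2 f g.
Proof.
move=> Hf Hg; have [Hf' _] := laplace_invP Hf; have [Hg' _] := laplace_invP Hg.
have [r1 j1] := measurable_conjM Hf Hg; have [r2 j2] := measurable_conjM Hf' Hg'.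
apply: cintegral_ae => //.
have := laplace_invK Hf; have := laplace_invK Hg.
by apply: filterS2 => t hg hf Rt; rewrite hg// hf.
Qed.

Lemma laplace_unitary : unitary L2 (H1 R) (@laplace R).
Proof.
split.
- by move=> f Hf; exists f.
- by move=> g [f Hf fg]; exists f.
- exact: laplace_linear.
- exact: hdot_H1.
Qed.

Lemma hnorm_H1 f : hcar L2 f -> hnorm (H1 R) (laplace f) = hnorm L2 f.
Proof. by move=> Hf; rewrite /hnorm hdot_H1. Qed.

Lemma eq_cintegral f g : (forall t, 0 < t -> f t = g t) -> cintegral f = cintegral g.
Proof.
move=> fg; rewrite /cintegral; congr (_ +i* _); apply: eq_Rintegral => t /set_mem/RposE t0;
  by rewrite fg.
Qed.

(** [K_op] erases the a.e. difference between f and the preimage chosen by [laplace_inv]. *)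
Lemma mulK_laplace_inv (c : R -> C) f : hcar L2 f ->
  laplace (mulK c (laplace_inv (laplace f))) = laplace (mulK c f).
Proof.
move=> Hf; have [Hf' _] := laplace_invP Hf.
apply/funext => w; have [hw|hw] := pselect (half_plane w); last by rewrite !laplace_out.
rewrite (laplaceE (mulK c f) hw) (laplaceE (mulK c (laplace_inv (laplace f))) hw).
apply: eq_cintegral => t t0; congr (_ * (_ * _)).
exact: (K_op_ae Hf' Hf t0 (laplace_invK Hf)).
Qed.

End laplace_transform.

(** * The multiplier [kz z], its dependence on z and its difference quotients *)

Section multipliers.
Local Open Scope complex_scope.
Variable R : realType.
Local Notation m := (@m_meas R).
Local Notation C := (R[i]^o).
Local Notation L2 := (L2m R).
Implicit Types (f g : R -> C) (t x : R) (z w h : C).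

Definition cmeasurable f := measurable_fun (@Rpos R) (ReF f) /\ measurable_fun (@Rpos R) (ImF f).

Lemma cmeasurableM f g : cmeasurable f -> cmeasurable g -> cmeasurable (fun t => f t * g t).
Proof. by move=> [rf jf] [rg jg]; exact: measurable_cmul. Qed.

Lemma cmeasurableB f g : cmeasurable f -> cmeasurable g -> cmeasurable (fun t => f t - g t).
Proof.
move=> [rf jf] [rg jg]; split.
  apply: (eq_measurable_fun (fun t => ReF f t - ReF g t)); last exact: measurable_funB.
  by move=> t _; rewrite /ReF; case: (f t) (g t) => [? ?] [? ?].
apply: (eq_measurable_fun (fun t => ImF f t - ImF g t)); last exact: measurable_funB.
by move=> t _; rewrite /ImF; case: (f t) (g t) => [? ?] [? ?].
Qed.

Lemma cmeasurable_cst z : cmeasurable (cst z).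
Proof. by split; exact: measurable_cst. Qed.

Lemma cmeasurable_real (u : R -> R) : measurable_fun (@Rpos R) u ->
  cmeasurable (fun t => (u t)%:C).
Proof. by move=> mu; split => //; exact: measurable_cst. Qed.

Definition den z t : C := 1 - z * (expR (- t))%:C.

Lemma denE z t : den z t =
  (1 - complex.Re z * expR (- t)) +i* (- (complex.Im z * expR (- t))).
Proof.
by case: z => a b; apply/eqP; rewrite /den eq_complex /=; apply/andP; split; apply/eqP; ring.
Qed.

Lemma sqnV z : sqn z^-1 = (sqn z)^-1.
Proof.
have [->|z0] := eqVneq z 0; first by rewrite invr0 /sqn/= expr0n addr0 invr0.
have n0 : sqn z != 0.
  apply: contra z0; rewrite /sqn paddr_eq0 ?sqr_ge0// !sqrf_eq0 => /andP[/eqP ra /eqP rb].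
  by apply/eqP; case: z ra rb => a b /= -> ->.
apply: (mulfI n0); rewrite -sqnM divff// divff//.
by rewrite /sqn/= expr1n expr0n addr0.
Qed.

Lemma cmeasurable_invden z : (forall t, 0 < t -> sqn (den z t) != 0) ->
  cmeasurable (fun t => (den z t)^-1).
Proof.
move=> d0; have ce : continuous (fun t => expR (- t) : R).
  by move=> t; apply: continuous_comp; [exact: cvgN|exact: continuous_expR].
have aux (N : R -> R) : continuous N ->
    measurable_fun (@Rpos R) (fun t => N t / sqn (den z t)).
  move=> cN; apply: open_continuous_measurable_fun; first exact: interval_open.
  move=> t /set_mem/RposE t0; apply: cvgM; first exact: cN.
  apply: cvgV; first exact: d0.
  rewrite /continuous_at; under eq_fun do rewrite denE /sqn/=.
  rewrite denE /sqn/=; apply: cvgD.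
    apply: cvgM; apply: cvgB; try exact: cvg_cst.
      by apply: cvgM; [exact: cvg_cst|exact: ce].
    by apply: cvgM; [exact: cvg_cst|exact: ce].
  apply: cvgM; apply: cvgN; apply: cvgM; try exact: cvg_cst; exact: ce.
split.
  apply: (eq_measurable_fun (fun t => (1 - complex.Re z * expR (- t)) / sqn (den z t))).
    by move=> t _; rewrite /ReF denE /sqn.
  apply: aux => t; apply: cvgB; first exact: cvg_cst.
  by apply: cvgM; [exact: cvg_cst|exact: ce].
apply: (eq_measurable_fun (fun t => complex.Im z * expR (- t) / sqn (den z t))).
  by move=> t _; rewrite /ImF denE /sqn/= [in RHS]mulNr opprK.
by apply: aux => t; apply: cvgM; [exact: cvg_cst|exact: ce].
Qed.

Lemma cut_planeP z : cut_plane z -> complex.Im z != 0 \/ complex.Re z <= 1.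
Proof.
rewrite /cut_plane/= ltcE/= negb_and -leNgt => /orP[]; by [left|right].
Qed.

(** Only z = 1 has to be excluded: it is a limit of the points 1 + e / 2 of the cut. *)
Lemma interior_cut_planeP z : interior (@cut_plane R) z -> complex.Im z != 0 \/ complex.Re z < 1.
Proof.
move=> iz; have := interior_subset iz => /cut_planeP[|]; first by left.
rewrite le_eqVlt => /predU1P[z1|]; last by right.
left; apply/eqP => z0.
have {z1 z0} z1 : z = 1 :> R[i] by case: z z1 z0 {iz} => a b /= -> ->.
move: iz; rewrite z1 /interior => /nbhs_ballP[e/= e0 /(_ (1 + e / 2))].
have e20 : 0 < e / 2 :> R[i] by rewrite divr_gt0.
rewrite /cut_plane/= ltrDl e20 => H; have // : false; apply: H.
rewrite /ball/= /ball_/= opprD addNKr normrN gtr0_norm//.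
by rewrite ltr_pdivrMr// ltr_pMr// ltr1n.
Qed.

(** Put z = a + i b and u = e^-t. Off the real axis, b^2 / (a^2 + b^2) is the squared distance from
    1 to the line through 0 and z. On it, with a < 1, the number 1 - a u lies between 1 and 1 -
    a. *)
Lemma den_lower z : complex.Im z != 0 \/ complex.Re z < 1 ->
  exists2 d : R, 0 < d & forall t, 0 < t -> d <= sqn (den z t).
Proof.
case: z => a b /=; have u01 t : 0 < t -> 0 < expR (- t) < 1.
  by move=> t0; rewrite expR_gt0 expR_lt1 oppr_lt0.
have [b0 [//|a1]|b0 _] := eqVneq b 0.
  exists (Num.min 1 (1 - a) ^+ 2).
    by rewrite exprn_gt0// lt_min ltr01 subr_gt0.
  move=> t /u01/andP[u0 u1]; rewrite denE /sqn/= b0 mul0r oppr0 [X in _ <= _ + X]expr0n addr0.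
  rewrite lerXn2r ?nnegrE//.
  - by rewrite le_min ler01 subr_ge0 ltW.
  - rewrite subr_ge0; have [a0|a0] := leP a 0; last by nra.
    by rewrite (le_trans _ ler01)// mulr_le0_ge0// ltW.
  - have [a0|a0] := leP a 0.
      by rewrite ge_min lerBrDl gerDr mulr_le0_ge0// ltW.
    by rewrite ge_min; apply/orP; right; nra.
have ab : 0 < a ^+ 2 + b ^+ 2 by rewrite ltr_wpDl ?sqr_ge0// exprn_even_gt0.
exists (b ^+ 2 / (a ^+ 2 + b ^+ 2)).
  by rewrite divr_gt0// exprn_even_gt0.
move=> t t0; rewrite denE /sqn/= ler_pdivrMr// -subr_ge0.
set u := expR _.
(* A completed square, zero when u z is the foot of the perpendicular from 1. *)
have -> : ((1 - a * u) ^+ 2 + (- (b * u)) ^+ 2) * (a ^+ 2 + b ^+ 2) - b ^+ 2 =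
  ((a ^+ 2 + b ^+ 2) * u - a) ^+ 2 by ring.
exact: sqr_ge0.
Qed.

Lemma sqnD_le z w : sqn (z + w) <= 2 * sqn z + 2 * sqn w.
Proof.
case: z w => [a b] [c d]; rewrite /sqn/=.
by have := sqr_ge0 (a - c); have := sqr_ge0 (b - d); nra.
Qed.

Lemma sqnMr z (r : R) : sqn (z * r%:C) = sqn z * r ^+ 2.
Proof. by rewrite sqnM /sqn/= [X in _ * (_ + X)]expr0n addr0. Qed.

(** From d <= |den z|^2 <= 2 |den (z + h)|^2 + 2 |h|^2 with |h|^2 <= d / 4. *)
Lemma den_perturb z h (d : R) t : 0 < t -> d <= sqn (den z t) -> sqn h <= d / 4 ->
  d / 4 <= sqn (den (z + h) t).
Proof.
move=> t0 dz hd; have := sqnD_le (den (z + h) t) (h * (expR (- t))%:C).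
have -> : den (z + h) t + h * (expR (- t))%:C = den z t by rewrite /den; ring.
rewrite sqnMr => /(le_trans dz) H.
have u1 : expR (- t) ^+ 2 <= 1.
  by rewrite exprn_ile1 ?expR_ge0// expR_le1 oppr_le0 ltW.
have := ler_wpM2l (sqn_ge0 h) u1; rewrite mulr1; lra.
Qed.

Definition kz z t : C := z * ((1 - (expR (- t))%:C) * (den z t)^-1).
(* derivative of [kz] in [z], and the error of the difference quotient *)
Definition dkz z t : C := (1 - (expR (- t))%:C) * (den z t)^-1 * (den z t)^-1.
Definition rkz z h t : C := h^-1 * (kz (z + h) t - kz z t) - dkz z t.

Lemma Kz_opE z phi : Kz_op z phi = mulK (kz z) phi.
Proof.
apply/funext => t; rewrite /Kz_op /M_frac /mulK /kz -[LHS]/(z * _).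
by rewrite !mulrA.
Qed.

Lemma cmeasurable_1Bu : cmeasurable (fun t => 1 - (expR (- t))%:C).
Proof.
apply: (cmeasurableB (cmeasurable_cst 1)); apply: cmeasurable_real.
apply: measurable_funTS; apply: continuous_measurable_fun.
by move=> t; apply: continuous_comp; [exact: cvgN|exact: continuous_expR].
Qed.

Lemma sqn_1Bu t : 0 < t -> 0 <= sqn (1 - (expR (- t))%:C) <= 1.
Proof.
move=> t0; rewrite sqn_ge0/= /sqn/= subr0 expr0n addr0.
have u0 := expR_ge0 (- t); have u1 : expR (- t) <= 1 by rewrite expR_le1 oppr_le0 ltW.
by rewrite exprn_ile1 ?subr_ge0// gerBl.
Qed.

Lemma kz_multiplier z (d : R) : 0 < d -> (forall t, 0 < t -> d <= sqn (den z t)) ->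
  bdd_multiplier (kz z) (sqn z / d).
Proof.
move=> d0 dz; have dn t : 0 < t -> sqn (den z t) != 0.
  by move=> t0; rewrite gt_eqF// (lt_le_trans d0)// dz.
have [rk jk] := cmeasurableM (cmeasurable_cst z)
  (cmeasurableM cmeasurable_1Bu (cmeasurable_invden dn)).
split=> // t t0; rewrite !sqnM sqnV ler_wpM2l ?sqn_ge0//.
have /andP[u0 u1] := sqn_1Bu t0; rewrite -[leRHS]mul1r ler_pM ?invr_ge0 ?sqn_ge0//.
by rewrite lef_pV2 ?posrE ?dz// (lt_le_trans d0)// dz.
Qed.

Lemma dkz_multiplier z (d : R) : 0 < d -> (forall t, 0 < t -> d <= sqn (den z t)) ->
  bdd_multiplier (dkz z) (d^-1 ^+ 2).
Proof.
move=> d0 dz; have dn t : 0 < t -> sqn (den z t) != 0.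
  by move=> t0; rewrite gt_eqF// (lt_le_trans d0)// dz.
have ci := cmeasurable_invden dn.
have [rk jk] := cmeasurableM (cmeasurableM cmeasurable_1Bu ci) ci.
split=> // t t0; rewrite !sqnM sqnV.
have /andP[u0 u1] := sqn_1Bu t0; have s0 := sqn_ge0 (den z t).
have i1 : (sqn (den z t))^-1 <= d^-1 by rewrite lef_pV2 ?posrE ?dz// (lt_le_trans d0)// dz.
have i0 : 0 <= (sqn (den z t))^-1 by rewrite invr_ge0.
by rewrite expr2 ler_pM ?mulr_ge0// -[leRHS]mul1r ler_pM.
Qed.

(** The explicit factor h on the right makes the error small uniformly in t once the denominators
    are bounded below. *)
Lemma difference_quotient (F : fieldType) (z h x : F) :
  h != 0 -> 1 - z * x != 0 -> 1 - (z + h) * x != 0 ->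
  h^-1 * ((z + h) * ((1 - x) * (1 - (z + h) * x)^-1) - z * ((1 - x) * (1 - z * x)^-1)) -
   (1 - x) * (1 - z * x)^-1 * (1 - z * x)^-1 =
  h * (x * ((1 - x) * ((1 - z * x)^-1 * (1 - z * x)^-1 * (1 - (z + h) * x)^-1))).
Proof. by move=> h0 n1 n2; field; rewrite n2 n1 h0. Qed.

Lemma sqn_eq0 z : (sqn z == 0) = (z == 0).
Proof.
apply/eqP/eqP => [/eqP|->]; last by rewrite /sqn/= expr0n addr0.
rewrite /sqn paddr_eq0 ?sqr_ge0// !sqrf_eq0.
by case: z => a b /= /andP[/eqP -> /eqP ->].
Qed.

(** 4 / d^3 collects 1 / d from each of two denominators at z and 4 / d from the one at z + h. *)
Lemma rkz_multiplier z h (d : R) : 0 < d -> (forall t, 0 < t -> d <= sqn (den z t)) ->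
  h != 0 -> sqn h <= d / 4 -> bdd_multiplier (rkz z h) (sqn h * (4 / d ^+ 3)).
Proof.
move=> d0 dz h0 hd; have dzh t (t0 : 0 < t) := den_perturb t0 (dz t t0) hd.
have d40 : 0 < d / 4 by rewrite divr_gt0.
have [rk jk _] := kz_multiplier d0 dz; have [rk' jk' _] := kz_multiplier d40 dzh.
have [rd jd _] := dkz_multiplier d0 dz.
have [rr jr] := cmeasurableB (cmeasurableM (cmeasurable_cst h^-1)
  (cmeasurableB (conj rk' jk') (conj rk jk))) (conj rd jd).
split=> // t t0.
have n1 : den z t != 0 by rewrite -sqn_eq0 gt_eqF// (lt_le_trans d0)// dz.
have n2 : den (z + h) t != 0 by rewrite -sqn_eq0 gt_eqF// (lt_le_trans d40)// dzh.
rewrite /rkz /kz /dkz (difference_quotient h0 n1 n2) -/(den z t) -/(den (z + h) t).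
rewrite !sqnM ler_wpM2l ?sqn_ge0// !sqnV.
have /andP[u0 u1] := sqn_1Bu t0.
have i1 : (sqn (den z t))^-1 <= d^-1 by rewrite lef_pV2 ?posrE ?dz// (lt_le_trans d0)// dz.
have i2 : (sqn (den (z + h) t))^-1 <= (d / 4)^-1.
  by rewrite lef_pV2 ?posrE ?dzh// (lt_le_trans d40)// dzh.
have x1 : sqn (expR (- t))%:C <= 1.
  by rewrite /sqn/= expr0n addr0 exprn_ile1 ?expR_ge0// expR_le1 oppr_le0 ltW.
have -> : 4 / d ^+ 3 = 1 * (1 * (d^-1 * d^-1 * (d / 4)^-1)) by field; exact: lt0r_neq0.
by rewrite !ler_pM ?mulr_ge0 ?invr_ge0 ?sqn_ge0.
Qed.

End multipliers.

(** * The operators on [H1]: boundedness, compactness, analyticity in z *)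

Section transfer_to_H1.
Local Open Scope complex_scope.
Variable R : realType.
Local Notation C := (R[i]^o).
Local Notation L2 := (L2m R).
Local Notation H1 := (H1 R).
Implicit Types (f g phi psi : R -> C) (t x : R) (z w h : C).

Lemma eq_laplace f g : (forall t, 0 < t -> f t = g t) -> laplace f = laplace g.
Proof.
move=> fg; apply/funext => w; have [hw|hw] := pselect (half_plane w); last by rewrite !laplace_out.
rewrite (laplaceE f hw) (laplaceE g hw); apply: eq_cintegral => t t0.
by rewrite fg.
Qed.

Lemma hcarB f g : hcar L2 f -> hcar L2 g -> hcar L2 (f - g).
Proof.
by move=> Hf Hg; have := hcar_linear (-1) Hg Hf; rewrite scaleN1r addrC.
Qed.

Lemma hcarZ (a : C) f : hcar L2 f -> hcar L2 (a *: f).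
Proof. by move=> Hf; have := hcar_linear a Hf (hcar0 R); rewrite addr0. Qed.

Lemma laplaceB f g : hcar L2 f -> hcar L2 g -> laplace (f - g) = laplace f - laplace g.
Proof.
by move=> Hf Hg; rewrite addrC -scaleN1r laplace_linear// scaleN1r addrC.
Qed.

Lemma laplace0 : laplace (0 : R -> C) = 0.
Proof. by rewrite -(subrr (0 : R -> C)) laplaceB ?subrr//; exact: hcar0. Qed.

Lemma laplaceZ (a : C) f : hcar L2 f -> laplace (a *: f) = a *: laplace f.
Proof.
by move=> Hf; have := laplace_linear a Hf (hcar0 R); rewrite !addr0 laplace0 addr0.
Qed.

Lemma hnorm_H1_0 : hnorm H1 0 = 0.
Proof.
by rewrite -laplace0 hnorm_H1; [exact: hnorm_eq0|exact: hcar0].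
Qed.

Definition mulK_H1 (c : R -> C) (f : C -> C) := laplace (mulK c (laplace_inv f)).

Lemma mulK_H1_laplace (c : R -> C) phi : hcar L2 phi ->
  mulK_H1 c (laplace phi) = laplace (mulK c phi).
Proof. exact: mulK_laplace_inv. Qed.

Lemma bounded_mulK_H1 (c : R -> C) (B : R) : 0 <= B -> bdd_multiplier c (B ^+ 2) ->
  bounded_operator H1 (mulK_H1 c).
Proof.
move=> B0 cB; split.
- move=> _ [phi Hphi <-]; rewrite mulK_H1_laplace//.
  by exists (mulK c phi) => //; exact: (hcar_mulK cB).
- move=> a _ _ [phi Hphi <-] [psi Hpsi <-].
  rewrite -laplace_linear// !mulK_H1_laplace//; last exact: hcar_linear.
  have H1' := hcar_mulK cB Hphi; have H2' := hcar_mulK cB Hpsi.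
  rewrite -(laplace_linear a H1' H2').
  rewrite (@eq_laplace _ (a *: mulK c phi + mulK c psi)).
    by rewrite subrr hnorm_H1_0.
  by move=> t t0; rewrite mulK_linear.
- exists (B * (mass R + 1)) => _ [phi Hphi <-].
  rewrite mulK_H1_laplace// !hnorm_H1//; last exact: (hcar_mulK cB).
  exact: hnorm_mulK_le.
Qed.

(** Preimages of the sequence are chosen in L_2(m); [laplace], being linear and isometric, carries
    the subsequence and its limit over. *)
Lemma compact_mulK_H1 (c : R -> C) (B : R) : 0 <= B -> bdd_multiplier c (B ^+ 2) ->
  compact_operator H1 (mulK_H1 c).
Proof.
move=> B0 cB; split; first exact: (bounded_mulK_H1 B0 cB).
move=> u Hu [d ud].
have /choice[v vP] : forall n, exists phi, hcar L2 phi /\ laplace phi = u n.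
  by move=> n; have [phi Hphi e] := Hu n; exists phi.
have Hv n : hcar L2 (v n) by have [] := vP n.
have uE n : u n = laplace (v n) by have [] := vP n.
have [_ /(_ v Hv)[|s [g [hs Hg sg]]]] := compact_mulK B0 cB.
  by exists d => n; rewrite -hnorm_H1// -uE.
exists s, (laplace g); split => //; first by exists g.
have E n : hnorm H1 (mulK_H1 c (u (s n)) - laplace g) = hnorm L2 (mulK c (v (s n)) - g).
  have HK := hcar_mulK cB (Hv (s n)).
  rewrite uE mulK_H1_laplace// -(laplaceB HK Hg) hnorm_H1//.
  exact: hcarB.
by rewrite (funext E).
Qed.

Lemma norm_sqnE z : (`|z| : R[i]) = (Num.sqrt (sqn z))%:C.
Proof. exact: normc_def. Qed.

(** The difference quotient minus the candidate derivative is again [K_op] followed by a multiplier,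
    [rkz z h], so a bound on that multiplier controls the operator norm. *)
Lemma kz_op_derivable z : interior (@cut_plane R) z ->
  op_derivable H1 (fun z => mulK_H1 (kz z)) z.
Proof.
move=> /interior_cut_planeP/den_lower[d d0 dz].
have d10 : 0 <= d^-1 by rewrite invr_ge0 ltW.
exists (mulK_H1 (dkz z)); split.
  exact: (bounded_mulK_H1 d10 (dkz_multiplier d0 dz)).
move=> e e0; have M0 := mass_ge0 R.
(* Chosen so that B (mass + 1), the constant of [hnorm_mulK_le], equals e. *)
pose B := e / (mass R + 1); have M1 : 0 < mass R + 1 by rewrite ltr_wpDl.
have B0 : 0 < B by rewrite divr_gt0.
(* With r <= 1, |h| < r gives |h|^2 <= r; the second bound is for [den_perturb], and the third makes
   |h|^2 (4 / d^3) <= B^2. *)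
pose r := Num.min 1 (Num.min (d / 4) (B ^+ 2 * (d ^+ 3 / 4))).
have r0 : 0 < r.
  rewrite !lt_min ltr01 divr_gt0//= mulr_gt0 ?exprn_gt0// divr_gt0// exprn_gt0//.
have rC0 : 0 < r%:C :> R[i] by rewrite ltcR.
near=> h => _ [phi Hphi <-].
have h0 : h != 0 by near: h; exact: nbhs_dnbhs_neq.
have hr : (`|h| : R[i]) < r%:C by near: h; exact: dnbhs0_lt.
have sh : sqn h <= r.
  move: hr; rewrite norm_sqnE ltcR => hr.
  have s0 := sqrtr_ge0 (sqn h).
  rewrite -[sqn h]sqr_sqrtr ?sqn_ge0// expr2.
  apply: (le_trans (ler_pM s0 s0 (ltW hr) (ltW hr))).
  by rewrite ler_piMr ?(ltW r0)// /r ge_min lexx.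
have hd : sqn h <= d / 4 by apply: (le_trans sh); rewrite /r !ge_min lexx !orbT.
have hB : sqn h * (4 / d ^+ 3) <= B ^+ 2.
  rewrite -ler_pdivlMr ?divr_gt0 ?exprn_gt0// invf_div.
  by apply: (le_trans sh); rewrite /r !ge_min lexx !orbT.
have d40 : 0 < d / 4 by rewrite divr_gt0.
have k1 := hcar_mulK (kz_multiplier d0 dz) Hphi.
have dzh t (t0 : 0 < t) := den_perturb t0 (dz t t0) hd.
have k2 := hcar_mulK (kz_multiplier d40 dzh) Hphi.
have k3 := hcar_mulK (dkz_multiplier d0 dz) Hphi.
have [rr jr rB] := rkz_multiplier d0 dz h0 hd.
have rm : bdd_multiplier (rkz z h) (B ^+ 2).
  by split=> // t t0; apply: (le_trans (rB t t0)).
rewrite !mulK_H1_laplace// -(laplaceB k2 k1).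
have k21 := hcarB k2 k1.
rewrite -(laplaceZ h^-1 k21) -(laplaceB (hcarZ h^-1 k21) k3).
rewrite (@eq_laplace _ (mulK (rkz z h) phi)).
  rewrite !hnorm_H1//; last exact: (hcar_mulK rm).
  apply: (le_trans (hnorm_mulK_le (ltW B0) rm Hphi)).
  by rewrite /B divfK// lt0r_neq0.
move=> t t0; rewrite !fctE /mulK /rkz -[h^-1 *: _]/(h^-1 * _).
by rewrite -mulrBl mulrA -mulrBl.
Unshelve. all: end_near. Qed.

(** At z = 1 the denominator 1 - e^-t tends to 0 with t, but it equals the numerator, so [kz 1] is
    constantly 1. Every other point of the cut plane falls under [den_lower]. *)
Lemma kz_cut_multiplier z : cut_plane z -> exists2 B, 0 <= B & bdd_multiplier (kz z) (B ^+ 2).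
Proof.
move=> cz; have [z1|z1] := eqVneq z 1.
  exists 1 => //; rewrite z1.
  have kE t : 0 < t -> kz (1 : C) t = 1.
    move=> t0; rewrite /kz /den !mul1r divff// subr_eq0 eq_sym.
    by rewrite -[1]/(1%:C) (inj_eq (@complexI R)) lt_eqF// expR_lt1 oppr_lt0.
  split.
  - apply: (eq_measurable_fun (cst (1 : R))); last exact: measurable_cst.
    by move=> t /set_mem/RposE t0; rewrite /ReF kE.
  - apply: (eq_measurable_fun (cst (0 : R))); last exact: measurable_cst.
    by move=> t /set_mem/RposE t0; rewrite /ImF kE.
  - by move=> t t0; rewrite kE// /sqn/= expr0n addr0.
have [|d d0 dz] := @den_lower R z.
  have [|] := cut_planeP cz; first by left.
  rewrite le_eqVlt => /predU1P[r1|]; last by right.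
  left; apply: contra z1 => /eqP i0; apply/eqP.
  by case: z r1 i0 {cz} => a b /= -> ->.
exists (Num.sqrt (sqn z / d)); first exact: sqrtr_ge0.
rewrite sqr_sqrtr; first exact: kz_multiplier.
by rewrite divr_ge0 ?sqn_ge0 ?ltW.
Qed.

End transfer_to_H1.

(** * Exchange of two integrals with a bounded kernel *)

Section Rintegral_exchange.
Context d (T : measurableType d) (R : realType).
Variables (mu : {finite_measure set T -> \bar R}) (D : set T) (mD : measurable D).
Variables (k : T * T -> R) (h g : T -> R).
Hypothesis mk : measurable_fun setT k.
Hypothesis k1 : forall x y, D x -> D y -> `|k (x, y)| <= 1.
Hypothesis ih : mu.-integrable D (EFin \o h).
Hypothesis ig : mu.-integrable D (EFin \o g).

Let mh : measurable_fun D h.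
Proof. by case/integrableP : ih => /measurable_EFinP. Qed.

Let mg : measurable_fun D g.
Proof. by case/integrableP : ig => /measurable_EFinP. Qed.

Let mky x : measurable_fun D (fun y => k (x, y)).
Proof.
by apply: measurable_funTS; apply: (measurableT_comp mk); exact: measurable_pair1.
Qed.

Let mkx y : measurable_fun D (fun x => k (x, y)).
Proof.
by apply: measurable_funTS; apply: (measurableT_comp mk); exact: measurable_pair2.
Qed.

Let i1 x : D x -> mu.-integrable D (EFin \o (fun y => k (x, y) * g y)).
Proof.
move=> Dx; apply: (le_integrable mD _ _ ig).
  by apply/measurable_EFinP; exact: measurable_funM.
by move=> y Dy; rewrite /= lee_fin normrM ler_piMl// k1.
Qed.

Let i2 y : D y -> mu.-integrable D (EFin \o (fun x => h x * k (x, y))).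
Proof.
move=> Dy; apply: (le_integrable mD _ _ ih).
  by apply/measurable_EFinP; exact: measurable_funM.
by move=> x Dx; rewrite /= lee_fin normrM ler_piMr// k1.
Qed.

(** Fubini for the integrand extended by 0 outside D x D; as |k| <= 1, its absolute integral is at
    most the product of the integrals of |h| and |g|. *)
Lemma Rintegral_exchange :
  \int[mu]_(x in D) (h x * \int[mu]_(y in D) (k (x, y) * g y)) =
  \int[mu]_(y in D) (g y * \int[mu]_(x in D) (h x * k (x, y))).
Proof.
pose G (p : T * T) := (((h \_ D) p.1 * (k p * (g \_ D) p.2))%R)%:E.
have mhD : measurable_fun setT (h \_ D) by exact/(measurable_restrictT h mD).
have mgD : measurable_fun setT (g \_ D) by exact/(measurable_restrictT g mD).
have mG : measurable_fun setT G.
  apply/measurable_EFinP; apply: measurable_funM.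
    exact: (measurableT_comp mhD measurable_fst).
  apply: measurable_funM => //; exact: (measurableT_comp mgD measurable_snd).
have Gx x : (\int[mu]_y G (x, y) =
    ((fun x => (h x * \int[mu]_(y in D) (k (x, y) * g y))%:E) \_ D) x)%E.
  rewrite patchE; case: ifPn => [/set_mem Dx|xD].
    rewrite EFinM /Rintegral fineK; last by have := integrable_fin_num mD (i1 Dx).
    rewrite -integralZl//; last exact: i1.
    rewrite [RHS]integral_mkcond; apply: eq_integral => y _.
    rewrite /G /= !patchE mem_set//; case: ifP => // _.
    by rewrite !mulr0.
  by rewrite integral0_eq// => y _; rewrite /G/= patchE (negbTE xD) mul0r.
have Gy y : (\int[mu]_x G (x, y) =
    ((fun y => (g y * \int[mu]_(x in D) (h x * k (x, y)))%:E) \_ D) y)%E.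
  rewrite patchE; case: ifPn => [/set_mem Dy|yD].
    rewrite EFinM /Rintegral fineK; last by have := integrable_fin_num mD (i2 Dy).
    rewrite -integralZl//; last exact: i2.
    rewrite [RHS]integral_mkcond; apply: eq_integral => x _.
    rewrite /G /= !patchE (mem_set Dy); case: ifP => // _.
      by rewrite -EFinM mulrA mulrC.
    by rewrite mul0r.
  by rewrite integral0_eq// => x _; rewrite /G/= [X in _ * (_ * X)]patchE (negbTE yD) !mulr0.
have iG : ((mu \x mu)%E).-integrable setT G.
  apply/(integrable12ltyP _ _ mG).
  have [_ hoo] := integrableP _ _ _ ih; have [_ goo] := integrableP _ _ _ ig.
  apply: (@le_lt_trans _ _ (\int[mu]_(x in D) (`|(h x)%:E| * \int[mu]_(y in D) `|(g y)%:E|))%E).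
    rewrite [leRHS]integral_mkcond; apply: ge0_le_integral => //.
    - by move=> x _; exact: integral_ge0.
    - apply: (measurable_fun_fubini_tonelli_F (abse \o G)) => //.
        exact: measurableT_comp.
      by move=> p; exact: abse_ge0.
    - apply/(measurable_restrictT _ mD); apply: emeasurable_funM => //.
      by apply: measurableT_comp => //; exact/measurable_EFinP.
    move=> x _; rewrite patchE; case: ifPn => [/set_mem Dx|xD].
      rewrite -ge0_integralZl//; last first.
        by apply: measurableT_comp => //; exact/measurable_EFinP.
      rewrite [leRHS]integral_mkcond; apply: ge0_le_integral => //.
      - apply: measurableT_comp => //; apply: (measurableT_comp mG); exact: measurable_pair1.
      - apply/(measurable_restrictT _ mD); apply: emeasurable_funM => //.
        by apply: measurableT_comp => //; exact/measurable_EFinP.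
      move=> y _; rewrite /G/= !patchE mem_set//; case: ifPn => [/set_mem Dy|_].
        by rewrite -EFinM lee_fin !normrM ler_wpM2l// ler_piMl// k1.
      (* The restriction takes the value [point] outside D, which is 0 in R. *)
      by rewrite -[point in X in (`|X|%:E)]/(0 : R) !mulr0 normr0.
    by rewrite integral0_eq// => y _; rewrite /G/= patchE (negbTE xD) mul0r normr0.
  rewrite ge0_integralZr//.
  - by rewrite lte_mul_pinfty// ?integral_ge0// ge0_fin_numE// integral_ge0.
  - by apply: measurableT_comp => //; exact/measurable_EFinP.
  - exact: integral_ge0.
have := Fubini iG; rewrite (funext Gx) (funext Gy) -!integral_mkcond => e.
by rewrite /Rintegral e.
Qed.

End Rintegral_exchange.

(** * A single term of the series as a transform *)

Section Q_operator.
Local Open Scope complex_scope.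
Variable R : realType.
Local Notation m := (@m_meas R).
Local Notation leb := (@lebesgue_measure R).
Local Notation C := (R[i]^o).
Local Notation L2 := (L2m R).
Implicit Types (f g phi : R -> C) (x : R -> R) (s t : R) (z w : C) (n : nat).

Lemma measurable_bfun_mul : measurable_fun setT (fun p : R * R => bfun 1 (p.2 * p.1)).
Proof.
apply: (measurableT_comp (f := @bfun R 1)).
  by apply: continuous_measurable_fun; exact: continuous_bfun.
by apply: measurable_funM.
Qed.

Section single_term.
Variables (a b k l : R).
Hypotheses (a1 : 2^-1 < a) (kl1 : a * k - b * l = 1) (kl2 : a * l + b * k = 0).

Let mR := @measurable_Rpos R.

Let a0 : 0 < a.
Proof. by rewrite (lt_trans _ a1). Qed.

(* [(expR t - 1) * m_density t = t] turns the integral against [m] into the one of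
   [laplace_bfun_cos] and [laplace_bfun_sin]. *)
Let transform_exchange (h : R -> R) (J : R -> R) x : continuous h ->
  (forall t, `|h t| <= expR (- a * t)) ->
  (forall s, 0 <= s -> \int[leb]_(t in @Rpos R) (t * h t * bfun 1 (s * t)) = J s) ->
  m.-integrable (@Rpos R) (EFin \o x) ->
  m.-integrable (@Rpos R) (EFin \o (fun t => (expR t - 1) * h t)) /\
  \int[m]_(t in @Rpos R) ((expR t - 1) * h t * Kr x t) = \int[m]_(s in @Rpos R) (x s * J s).
Proof.
move=> ch hC hJ ix.
have hb t : 0 < t -> `|(expR t - 1) * h t| <= 1 * t ^+ 0 * expR ((1 - a) * t).
  move=> t0; rewrite normrM expr0 !mul1r mulrBl mul1r expRD -mulNr.
  have e1 : 1 <= expR t by rewrite -expR0 ler_expR ltW.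
  by rewrite ler_pM// ger0_norm ?subr_ge0// gerBl.
have mh : measurable_fun (@Rpos R) (fun t => (expR t - 1) * h t).
  apply: measurable_funTS; apply: continuous_measurable_fun => t.
  by apply: cvgM; [apply: cvgB; [exact: continuous_expR|exact: cvg_cst]|exact: ch].
have a2 : 1 - a < 1 by rewrite gtrBl.
have ih := m_integrable_dominated a2 mh hb.
split=> //; rewrite /Kr.
have k1 t s : Rpos t -> Rpos s -> `|bfun 1 ((t, s).2 * (t, s).1)| <= 1 :> R.
  by move=> /RposE t0 /RposE s0; rewrite bfun1_le1// mulr_ge0// ltW.
rewrite (Rintegral_exchange mR measurable_bfun_mul k1 ih ix).
apply: eq_Rintegral => s /set_mem/RposE s0; congr (_ * _).
rewrite -(hJ _ (ltW s0)) m_RintegralE; last first.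
  apply: (m_integrable_dominated a2 (C := 1) (k := 0)).
    by apply: measurable_funM => //=; under eq_fun do rewrite mulrC; exact: measurable_bfunM.
  move=> t t0; rewrite normrM; apply: le_trans (hb _ t0).
  by rewrite ler_piMr// bfun1_le1// mulr_ge0// ltW.
apply: eq_Rintegral => t /set_mem/RposE t0.
have e1 : expR t - 1 != 0 by rewrite subr_eq0 gt_eqF// expR_gt1.
by rewrite /m_density /=; field.
Qed.

Lemma cos_exchange x : m.-integrable (@Rpos R) (EFin \o x) ->
  m.-integrable (@Rpos R) (EFin \o (fun t => (expR t - 1) * expcos a b t)) /\
  \int[m]_(t in @Rpos R) ((expR t - 1) * expcos a b t * Kr x t) =
  \int[m]_(s in @Rpos R)
     (x s * ((k ^+ 2 - l ^+ 2) * expcos k l s - 2 * k * l * expsin k l s)).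
Proof.
apply: transform_exchange; [exact: continuous_expcos|exact: expcos_le|].
exact: laplace_bfun_cos.
Qed.

Lemma sin_exchange x : m.-integrable (@Rpos R) (EFin \o x) ->
  m.-integrable (@Rpos R) (EFin \o (fun t => (expR t - 1) * expsin a b t)) /\
  \int[m]_(t in @Rpos R) ((expR t - 1) * expsin a b t * Kr x t) =
  \int[m]_(s in @Rpos R)
     (x s * (2 * k * l * expcos k l s + (k ^+ 2 - l ^+ 2) * expsin k l s)).
Proof.
apply: transform_exchange; [exact: continuous_expsin|exact: expsin_le|].
exact: laplace_bfun_sin.
Qed.

End single_term.

Lemma Kr_mul_integrable (h : R -> R) x : m.-integrable (@Rpos R) (EFin \o h) -> sqint x ->
  m.-integrable (@Rpos R) (EFin \o (fun t => h t * Kr x t)).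
Proof.
move=> ih sx; have mR := @measurable_Rpos R; have ix := sqint_integrable sx.
have mh : measurable_fun (@Rpos R) h by case/integrableP : ih => /measurable_EFinP.
pose c := \int[m]_(s in @Rpos R) `|x s|.
have c0 : 0 <= c by exact: Rintegral_ge0.
apply: (le_integrable mR _ _ (integrableZl mR c ih)).
  by apply/measurable_EFinP; apply: measurable_funM => //; exact: measurable_Kr.
move=> t /RposE t0; rewrite /= lee_fin !normrM mulrC ler_wpM2r// (ger0_norm c0).
exact: Kr_le.
Qed.

(** With k + i l = 1 / w, the exchange lemmas produce (k + i l)^2 e^(- (k + i l) s) integrated
    against phi. Two real identities for each of Re phi and Im phi combine into the complex one. *)
Lemma Q_term_transform phi w : hcar L2 phi -> 2^-1 < complex.Re w ->
  (w^-1) ^+ 2 * laplace phi w^-1 =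
  cintegral (fun t => (expR t - 1)%:C * lexp w t * K_op phi t).
Proof.
case: w => a b Hphi /= a1; have mR := @measurable_Rpos R.
have a0 : 0 < a by rewrite (lt_trans _ a1).
have n0 : 0 < a ^+ 2 + b ^+ 2 by rewrite ltr_wpDr ?sqr_ge0// exprn_gt0.
pose k := a / (a ^+ 2 + b ^+ 2); pose l := - (b / (a ^+ 2 + b ^+ 2)).
have k0 : 0 < k by rewrite divr_gt0.
have kl1 : a * k - b * l = 1 by rewrite /k /l; field; exact: lt0r_neq0.
have kl2 : a * l + b * k = 0 by rewrite /k /l; ring.
have wV : (a +i* b)^-1 = k +i* l :> C by [].
have c2 : ((a +i* b)^-1) ^+ 2 = (k ^+ 2 - l ^+ 2) +i* (2 * k * l) :> C.
  by rewrite wV expr2; congr (_ +i* _); ring.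
have hw : half_plane (k +i* l : C).
  by rewrite /half_plane/= (lt_trans _ k0)// oppr_lt0.
have [sr si] := (hcarP phi).1 Hphi.
have [ir1 er] := cos_exchange a1 kl1 kl2 (sqint_integrable sr).
have [ii1 ei] := sin_exchange a1 kl1 kl2 (sqint_integrable si).
have [_ er'] := sin_exchange a1 kl1 kl2 (sqint_integrable sr).
have [_ ei'] := cos_exchange a1 kl1 kl2 (sqint_integrable si).
have [sc ss] := (hcarP _).1 (hcar_lexp hw).
have lE s : lexp (k +i* l : C) s = expcos k l s +i* expsin k l s by rewrite lexpE.
have scE : ReF (lexp (k +i* l : C)) = expcos k l by apply/funext => s; rewrite /ReF lE.
have ssE : ImF (lexp (k +i* l : C)) = expsin k l by apply/funext => s; rewrite /ImF lE.
rewrite {}scE {}ssE in sc ss.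
have sqint0 : sqint (cst 0 : R -> R).
  by apply: (@sqint_bounded _ _ 0) => // t _; rewrite normr0.
have sP : sqint (fun s => (k ^+ 2 - l ^+ 2) * expcos k l s - 2 * k * l * expsin k l s).
  have := sqintD (k ^+ 2 - l ^+ 2) sc (sqintD (- (2 * k * l)) ss sqint0).
  by congr sqint; apply/funext => s /=; ring.
have sQ : sqint (fun s => 2 * k * l * expcos k l s + (k ^+ 2 - l ^+ 2) * expsin k l s).
  have := sqintD (2 * k * l) sc (sqintD (k ^+ 2 - l ^+ 2) ss sqint0).
  by congr sqint; apply/funext => s /=; ring.
have lw t : lexp (a +i* b : C) t = expcos a b t +i* expsin a b t by rewrite lexpE.
(* The factor w^-2 is moved inside the transform as a scalar multiple of phi. *)
rewrite c2 wV -[LHS]/((((k ^+ 2 - l ^+ 2) +i* (2 * k * l) : C) *: laplace phi) (k +i* l)).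
rewrite -laplaceZ// laplaceE//; congr (_ +i* _).
  transitivity (\int[m]_(t in @Rpos R) ((expR t - 1) * expcos a b t * Kr (ReF phi) t)
    - \int[m]_(t in @Rpos R) ((expR t - 1) * expsin a b t * Kr (ImF phi) t)).
    rewrite er ei -RintegralB//; last 2 first.
    - exact: (sqintM_integrable sr sP).
    - exact: (sqintM_integrable si sQ).
    apply: eq_Rintegral => s _; rewrite lE !fctE /ReF /ImF.
    by case: (phi s) => u v; rewrite /GRing.scale/=; ring.
  rewrite -RintegralB//; last 2 first.
  - exact: (Kr_mul_integrable ir1 sr).
  - exact: (Kr_mul_integrable ii1 si).
  apply: eq_Rintegral => t /set_mem/RposE t0; rewrite K_opE// lw /=.
  by rewrite !mul0r !(subr0, addr0).
transitivity (\int[m]_(t in @Rpos R) ((expR t - 1) * expcos a b t * Kr (ImF phi) t)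
  + \int[m]_(t in @Rpos R) ((expR t - 1) * expsin a b t * Kr (ReF phi) t)).
  rewrite er' ei' -RintegralD//; last 2 first.
  - exact: (sqintM_integrable si sP).
  - exact: (sqintM_integrable sr sQ).
  apply: eq_Rintegral => s _; rewrite lE !fctE /ReF /ImF.
  by case: (phi s) => u v; rewrite /GRing.scale/=; ring.
rewrite -RintegralD//; last 2 first.
- exact: (Kr_mul_integrable ir1 si).
- exact: (Kr_mul_integrable ii1 sr).
apply: eq_Rintegral => t /set_mem/RposE t0; rewrite K_opE// lw /=.
by rewrite !mul0r !(subr0, addr0).
Qed.

End Q_operator.

(** * Summation of the series in the closed unit disc *)

Section Q_series.
Local Open Scope complex_scope.
Variable R : realType.
Local Notation m := (@m_meas R).
Local Notation C := (R[i]^o).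
Local Notation L2 := (L2m R).
Implicit Types (f g phi : R -> C) (t : R) (z w : C) (n : nat).

Lemma normcB_le z w (e : R) : 0 < e -> `|complex.Re z - complex.Re w| <= e / 2 ->
  `|complex.Im z - complex.Im w| <= e / 2 -> (`|z - w| : R[i]) <= e%:C.
Proof.
case: z w => [a b] [c d] e0 /=; rewrite !ler_norml => /andP[r1 r2] /andP[j1 j2].
rewrite norm_sqnE lecR -(ger0_norm (ltW e0)) -sqrtr_sqr ler_wsqrtr// /sqn/=.
have h1 : (a - c) ^+ 2 <= (e / 2) ^+ 2 by nra.
have h2 : (b - d) ^+ 2 <= (e / 2) ^+ 2 by nra.
nra.
Qed.

Lemma cvg_complex (f_ : nat -> C) z :
  (fun n => complex.Re (f_ n)) @ \oo --> complex.Re z ->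
  (fun n => complex.Im (f_ n)) @ \oo --> complex.Im z -> f_ @ \oo --> z.
Proof.
move=> rf jf; apply/cvgrPdist_le => -[e e'] e0.
have [{}e0 ->] : 0 < e /\ e' = 0 by move: e0; rewrite ltcE/= => /andP[/eqP -> ->].
have e20 : 0 < e / 2 by rewrite divr_gt0.
near=> n; apply: normcB_le => //; near: n.
  by move/cvgrPdist_le : rf; exact.
by move/cvgrPdist_le : jf; exact.
Unshelve. all: end_near. Qed.

Lemma sqn_Re_le z : `|complex.Re z| ^+ 2 <= sqn z.
Proof. by rewrite real_normK ?num_real// /sqn lerDl sqr_ge0. Qed.

Lemma sqn_Im_le z : `|complex.Im z| ^+ 2 <= sqn z.
Proof. by rewrite real_normK ?num_real// /sqn lerDr sqr_ge0. Qed.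

(** Real form of the convergence of the integral of (1 - e_n) f, where p_n and q_n are, up to sign,
    the parts of e_n. The ratio q t is only below 1 pointwise, so domination by 2 (|u| + |v|)
    replaces a uniform estimate. *)
Lemma Rintegral_perturbed_cvg (u v q : R -> R) (p_ q_ : nat -> R -> R) :
  m.-integrable (@Rpos R) (EFin \o u) -> m.-integrable (@Rpos R) (EFin \o v) ->
  (forall n, measurable_fun (@Rpos R) (p_ n)) -> (forall n, measurable_fun (@Rpos R) (q_ n)) ->
  (forall t, 0 < t -> 0 <= q t < 1) ->
  (forall n t, 0 < t -> `|p_ n t| <= q t ^+ n) -> (forall n t, 0 < t -> `|q_ n t| <= q t ^+ n) ->
  \int[m]_(t in @Rpos R) ((1 - p_ n t) * u t - q_ n t * v t) @[n --> \oo] -->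
  \int[m]_(t in @Rpos R) u t.
Proof.
move=> iu iv mp mq q01 pq qq; have mR := @measurable_Rpos R.
have cvg0 (e : nat -> R -> R) t : 0 < t -> (forall n t, 0 < t -> `|e n t| <= q t ^+ n) ->
    (fun n => e n t) @ \oo --> (0 : R).
  move=> t0 eq; apply/norm_cvg0P; have /andP[q0 q1] := q01 _ t0.
  have qc : (fun n => q t ^+ n) @ \oo --> (0 : R) by apply: cvg_expr; rewrite ger0_norm.
  apply: (squeeze_cvgr _ (cvg_cst 0) qc).
  by apply: nearW => n; rewrite normr_ge0 eq.
have le1 (e : nat -> R -> R) n t : 0 < t -> (forall n t, 0 < t -> `|e n t| <= q t ^+ n) ->
    `|e n t| <= 1.
  move=> t0 eq; apply: (le_trans (eq n t t0)); have /andP[q0 q1] := q01 _ t0.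
  by rewrite exprn_ile1// ltW.
have ig : m.-integrable (@Rpos R) (EFin \o (fun t => 2 * (`|u t| + `|v t|))).
  exact: (integrableZl mR 2 (integrableD mR (integrable_norm iu) (integrable_norm iv))).
have mu : measurable_fun (@Rpos R) u by case/integrableP : iu => /measurable_EFinP.
have mv : measurable_fun (@Rpos R) v by case/integrableP : iv => /measurable_EFinP.
apply: (Rintegral_dominated_cvg mR _ _ ig).
- move=> n; apply: measurable_funB; apply: measurable_funM => //.
  exact: measurable_funB.
- move=> t /RposE t0; rewrite -[u t in X in _ --> X](_ : (1 - 0) * u t - 0 * v t = _); last first.
    by rewrite subr0 mul1r mul0r subr0.
  apply: cvgB; apply: cvgM; try exact: cvg_cst; last exact: cvg0.
  by apply: cvgB; [exact: cvg_cst|exact: cvg0].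
- move=> t n /RposE t0; apply: (le_trans (ler_normB _ _)).
  rewrite [leRHS]mulrDr lerD//.
    rewrite normrM ler_wpM2r//; apply: (le_trans (ler_normB _ _)).
    by rewrite normr1 -[2]/(1 + 1) lerD2l le1.
  by rewrite normrM ler_wpM2r// (le_trans (le1 _ _ _ t0 qq))// ler1n.
Qed.

Lemma cintegral_cvg f (e : nat -> R -> C) (q : R -> R) : cintegrable f ->
  (forall n, cmeasurable (e n)) -> (forall t, 0 < t -> 0 <= q t < 1) ->
  (forall n t, 0 < t -> sqn (e n t) <= (q t ^+ n) ^+ 2) ->
  (fun n => cintegral (fun t => (1 - e n t) * f t)) @ \oo --> cintegral f.
Proof.
move=> [rf jf] me q01 eq.
have q0 n t : 0 < t -> 0 <= q t ^+ n.
  by move=> t0; have /andP[q0 q1] := q01 _ t0; rewrite exprn_ge0.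
have er n t : 0 < t -> `|ReF (e n) t| <= q t ^+ n.
  move=> t0; rewrite -(@ler_pXn2r _ 2)// ?nnegrE// ?q0//.
  by apply: le_trans (eq n _ t0); exact: sqn_Re_le.
have ei n t : 0 < t -> `|ImF (e n) t| <= q t ^+ n.
  move=> t0; rewrite -(@ler_pXn2r _ 2)// ?nnegrE// ?q0//.
  by apply: le_trans (eq n _ t0); exact: sqn_Im_le.
have mr n : measurable_fun (@Rpos R) (ReF (e n)) by case: (me n).
have mj n : measurable_fun (@Rpos R) (ImF (e n)) by case: (me n).
apply: cvg_complex.
  have ei' n t : 0 < t -> `|- ImF (e n) t| <= q t ^+ n by move=> t0; rewrite normrN ei.
  have mj' n : measurable_fun (@Rpos R) (fun t => - ImF (e n) t) by exact: measurable_funN.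
  have := Rintegral_perturbed_cvg rf jf mr mj' q01 er ei'.
  rewrite (_ : (fun n => _) = (fun n => complex.Re (cintegral (fun t => (1 - e n t) * f t))))//.
  apply/funext => n; apply: eq_Rintegral => t _; rewrite /ReF /ImF.
  by case: (e n t) (f t) => [p1 p2] [p3 p4] /=; ring.
have := Rintegral_perturbed_cvg jf rf mr mj q01 er ei.
rewrite (_ : (fun n => _) = (fun n => complex.Im (cintegral (fun t => (1 - e n t) * f t))))//.
apply/funext => n; apply: eq_Rintegral => t _; rewrite /ReF /ImF.
by case: (e n t) (f t) => [p1 p2] [p3 p4] /=; ring.
Qed.

Lemma cmeasurableX f n : cmeasurable f -> cmeasurable (fun t => f t ^+ n).
Proof.
move=> mf; elim: n => [|n ih]; first exact: cmeasurable_cst.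
by have := cmeasurableM mf ih; congr cmeasurable; apply/funext => t; rewrite exprS.
Qed.

Lemma sqnX z n : sqn (z ^+ n) = sqn z ^+ n.
Proof.
elim: n => [|n ih]; first by rewrite !expr0 /sqn/= expr1n expr0n addr0.
by rewrite !exprS sqnM ih.
Qed.


Lemma half_planeD w n : half_plane w -> 2^-1 < complex.Re (w + n.+1%:R).
Proof.
rewrite /half_plane/= -(rmorph_nat (real_complex R)); case: w => a b /= aw.
by have := ler0n R n; rewrite -(natr1 n); lra.
Qed.

Lemma lexpD w n t : lexp (w + n%:R) t = lexp w t * (expR (- t) ^+ n)%:C.
Proof.
rewrite !lexpE -(rmorph_nat (real_complex R)); case: w => a b /=.
rewrite /expcos /expsin !addr0.
have -> : expR (- (a + n%:R) * t) = expR (- a * t) * expR (- t) ^+ n.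
  by rewrite -expRM_natl -expRD; congr expR; ring.
by apply/eqP; rewrite eq_complex/=; apply/andP; split; apply/eqP; ring.
Qed.

Lemma sqn_real (r : R) : sqn (r%:C : C) = r ^+ 2.
Proof. by rewrite /sqn/= [X in _ + X]expr0n addr0. Qed.

(** This is (e^t - 1) e^(- (n + 1) t), the multiplier of the term of index n without its power of
    z. *)
Definition term_mult n t : C := (expR (- t) ^+ n * (1 - expR (- t)))%:C.

Lemma term_multiplier n : bdd_multiplier (term_mult n) 1.
Proof.
have ce : continuous (fun t => expR (- t) : R).
  by move=> t; apply: continuous_comp; [exact: cvgN|exact: continuous_expR].
have me := continuous_measurable_fun ce.
have [mr mj] : cmeasurable (term_mult n).
  apply: cmeasurable_real; apply: measurable_funTS; apply: measurable_funM.
    exact: measurable_funX.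
  exact: measurable_funB.
split=> // t t0; rewrite sqn_real.
have u0 := expR_ge0 (- t); have u1 : expR (- t) <= 1 by rewrite expR_le1 oppr_le0 ltW.
rewrite exprn_ile1// ?mulr_ge0 ?exprn_ge0 ?subr_ge0//.
by rewrite mulr_ile1 ?exprn_ge0 ?exprn_ile1 ?subr_ge0// gerBl.
Qed.

Lemma Q_termE z phi w n : hcar L2 phi -> half_plane w ->
  Q_term z (laplace phi) w n = laplace (z ^+ n.+1 *: mulK (term_mult n) phi) w.
Proof.
move=> Hphi hw; have HK := hcar_mulK (term_multiplier n) Hphi.
rewrite laplaceZ// -[RHS]/(z ^+ n.+1 * laplace (mulK (term_mult n) phi) w).
rewrite /Q_term -mulrA (Q_term_transform Hphi (half_planeD n hw)) laplaceE//.
congr (_ * _); apply: eq_cintegral => t t0.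
rewrite lexpD /mulK mulrA; congr (_ * _); rewrite mulrCA; congr (_ * _).
rewrite -rmorphM exprS /=; congr (_ %:C).
have e : expR t * expR (- t) = 1 :> R by rewrite -expRD subrr expR0.
by rewrite mulrBl mul1r mulrA e mul1r [in RHS]mulrBr mulr1 [in RHS]mulrC.
Qed.

Section unit_disc.
Variables (z : C) (z1 : (`|z| : R[i]) <= 1).

Let sz : sqn z <= 1.
Proof.
move: z1; rewrite norm_sqnE -[1]/(1%:C) lecR => h.
by rewrite -[sqn z]sqr_sqrtr ?sqn_ge0// exprn_ile1// sqrtr_ge0.
Qed.

Lemma norm_le1_cut_plane : cut_plane z.
Proof.
rewrite /cut_plane/=; apply/negP => z1'; have := lt_le_trans z1' (real_ler_norm _).
by move=> /(_ (gtr0_real (lt_trans ltr01 z1'))) /lt_le_trans/(_ z1); rewrite ltxx.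
Qed.

Let q01 t : 0 < t -> 0 <= expR (- t) < 1.
Proof. by move=> t0; rewrite expR_ge0 expR_lt1 oppr_lt0. Qed.

Let sqn_zu t n : sqn ((z * (expR (- t))%:C) ^+ n) <= (expR (- t) ^+ n) ^+ 2.
Proof.
rewrite sqnX -exprM mulnC exprM lerXn2r ?nnegrE ?sqn_ge0 ?sqr_ge0//.
by rewrite sqnMr ler_piMl ?sqr_ge0.
Qed.

Let den0 t : 0 < t -> den z t != 0.
Proof.
move=> t0; rewrite subr_eq0; apply/eqP => e.
have := sqn_zu t 1; rewrite !expr1 -e; have /andP[u0 u1] := q01 t0.
by rewrite /sqn/= expr1n expr0n addr0 leNgt exprn_ilt1.
Qed.

(** Closed form of the geometric sum of z^(k + 1) u^k (1 - u) over k < n, with u = e^-t: the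
    multiplier of the n-th partial sum. *)
Let partial n t : C := (1 - (z * (expR (- t))%:C) ^+ n) * kz z t.

Let mzu n : cmeasurable (fun t => (z * (expR (- t))%:C) ^+ n).
Proof.
apply: cmeasurableX; apply: cmeasurableM; first exact: cmeasurable_cst.
apply: cmeasurable_real; apply: measurable_funTS; apply: continuous_measurable_fun.
by move=> t; apply: continuous_comp; [exact: cvgN|exact: continuous_expR].
Qed.

Let partial_multiplier n : exists B, bdd_multiplier (partial n) B.
Proof.
have [B B0 [mr mj kB]] := kz_cut_multiplier norm_le1_cut_plane.
have [pr pj] := cmeasurableM (cmeasurableB (cmeasurable_cst 1) (mzu n)) (conj mr mj).
exists (4 * B ^+ 2); split=> // t t0; rewrite sqnM ler_pM ?sqn_ge0// ?kB//.
have := sqnD_le 1 (- (z * (expR (- t))%:C) ^+ n).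
have -> : sqn (- (z * (expR (- t))%:C) ^+ n) = sqn ((z * (expR (- t))%:C) ^+ n).
  by rewrite -mulN1r sqnM /sqn/= !oppr0 expr0n sqrrN expr1n addr0 mul1r.
have -> : sqn (1 : C) = 1 by rewrite /sqn/= expr1n expr0n addr0.
have h : (expR (- t) ^+ n) ^+ 2 <= 1 :> R.
  have /andP[u0 u1] := q01 t0.
  by rewrite exprn_ile1 ?exprn_ge0// exprn_ile1// ltW.
by have := sqn_zu t n; lra.
Qed.

Lemma series_Q_term phi w n : hcar L2 phi -> half_plane w ->
  series (Q_term z (laplace phi) w) n = laplace (mulK (partial n) phi) w.
Proof.
move=> Hphi hw; elim: n => [|n ih].
  rewrite /series/= big_geq// (@eq_laplace _ _ (0 : R -> C)) ?laplace0// => t t0.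
  by rewrite /mulK /partial expr0 subrr !mul0r.
have [B cB] := partial_multiplier n; have HK := hcar_mulK cB Hphi.
have HT := hcarZ (z ^+ n.+1) (hcar_mulK (term_multiplier n) Hphi).
rewrite seriesSr ih Q_termE// addrC.
have := laplace_linear 1 HT HK; rewrite !scale1r => /(congr1 (@^~ w)) e.
rewrite -[LHS]e; congr (_ w); apply: eq_laplace => t t0.
rewrite !fctE /mulK -[_ *: _]/(_ * _) mulrA -mulrDl.
congr (_ * _); rewrite /partial /kz /term_mult rmorphM rmorphXn rmorphB rmorph1.
have := den0 t0; rewrite /den; set u := (expR (- t))%:C => d0.
by rewrite !exprMn !exprS; field.
Qed.

(** The error factor (z u)^n has modulus at most e^(- n t), which tends to 0 for each t > 0 even on
    the unit circle and at z = 1. *)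
Lemma cvg_series_Q_term phi w : hcar L2 phi -> half_plane w ->
  series (Q_term z (laplace phi) w) @ \oo --> laplace (mulK (kz z) phi) w.
Proof.
move=> Hphi hw; rewrite laplaceE//.
have [B B0 kB] := kz_cut_multiplier norm_le1_cut_plane.
have cf := cintegrableM (hcar_lexp hw) (hcar_mulK kB Hphi).
have := cintegral_cvg cf mzu q01 (fun n t _ => sqn_zu t n).
rewrite (_ : (fun n => _) = series (Q_term z (laplace phi) w))//.
apply/funext => n; rewrite series_Q_term// laplaceE//; congr cintegral.
by apply/funext => t; rewrite mulrCA; congr (_ * _); exact: mulrA.
Qed.

End unit_disc.

End Q_series.

Section Q_op.
Variable R : realType.
Local Notation C := (R[i]^o).

Lemma mulK_H1_Q_op (z : C) f : (`|z| : R[i]) <= 1 -> hcar (H1 R) f ->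
  (forall w, half_plane w -> cvgn (series (Q_term z f w))) /\
  mulK_H1 (kz z) f = Q_op z f.
Proof.
move=> z1 [phi Hphi <-]; have cv w hw := cvg_series_Q_term z1 (w := w) Hphi hw.
split=> [w /cv/cvgP//|]; rewrite mulK_H1_laplace//; apply/funext => w.
have [hw|hw] := pselect (half_plane w); last first.
  by rewrite laplace_out// /Q_op patchE memNset.
rewrite /Q_op patchE mem_set//; apply/esym; apply: cvg_lim (cv w hw).
exact: norm_hausdorff.
Qed.

End Q_op.

Theorem theorem1 (R : realType) :
  unitary (L2m R) (H1 R) (@laplace R) /\
  (exists Q : R[i]^o -> (R[i]^o -> R[i]^o) -> (R[i]^o -> R[i]^o),
    [/\ forall (z : R[i]^o) f, (`|z| : R[i]) <= 1 -> hcar (H1 R) f ->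
          (forall w, half_plane w -> cvgn (series (Q_term z f w))) /\
          Q z f = Q_op z f,
        op_analytic (H1 R) (interior (@cut_plane R)) Q,
        forall (z : R[i]^o) phi, cut_plane z -> hcar (L2m R) phi ->
          Q z (laplace phi) = laplace (Kz_op z phi) &
        forall z : R[i]^o, cut_plane z ->
          compact_operator (H1 R) (Q z) /\
          compact_operator (L2m R) (Kz_op z)]).
Proof.
split; first exact: laplace_unitary.
(* All dependence on z sits in the scalar multiplier [kz z], and one formula covers the whole cut
   plane. *)
exists (fun z => mulK_H1 (kz z)); split.
- exact: mulK_H1_Q_op.
- split=> z cz; last exact: kz_op_derivable.
  have [B B0 kB] := kz_cut_multiplier (interior_subset cz).
  exact: (bounded_mulK_H1 B0 kB).
- by move=> z phi _ Hphi; rewrite mulK_H1_laplace// Kz_opE.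
- move=> z /kz_cut_multiplier[B B0 kB].
  rewrite (_ : Kz_op z = mulK (kz z)); last by apply/funext => phi; exact: Kz_opE.
  by split; [exact: (compact_mulK_H1 B0 kB)|exact: (compact_mulK B0 kB)].
Qed.
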